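(* Let $\theta\in(0,1)$ be irrational with $w(\theta)=w>1$. If $w<\infty$, then $$\frac{w/\tau-1}{w^2-1}\le\dim_H\mathcal U_\tau[\theta]\le\frac{1/\tau+1}{w+1}\quad\text{for }\tfrac1w\le\tau\le1,$$ $$0\le\dim_H\mathcal U_\tau[\theta]\le\frac{w/\tau-1}{w^2-1}\quad\text{for }1<\tau\le w.$$ Moreover, if $w(\theta)=\infty$, then $\dim_H\mathcal U_\tau[\theta]=0$ for all $\tau>0$.
   Context: $\mathbb T=\mathbb R/\mathbb Z$; points identified with fractional parts. $\|t\|$ is the distance from $t$ to the nearest integer. For irrational $\theta$, $w(\theta)=\sup\{s>0:\liminf_{j\to\infty}j^s\|j\theta\|=0\}$. For $\tau>0$, $\mathcal U_\tau[\theta]$ is the set of $y\in\mathbb T$ such that there exists $Q_0$ with: for every real $Q\ge Q_0$ there is an integer $1\le n\le Q$ with $\|n\theta-y\|<Q^{-\tau}$. *)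

(* Defs.v *)
From Stdlib Require Import Reals Lra ClassicalEpsilon.
Open Scope R_scope.

Definition distZ (t : R) : R := Rmin (frac_part t) (1 - frac_part t).

Definition rpow (t s : R) : R := if Rle_dec t 0 then 0 else Rpower t s.

(** liminf_{j -> oo} j^s ||j theta|| = 0  (the sequence is nonnegative). *)
Definition liminf_zero (theta s : R) : Prop :=
  forall eps, 0 < eps -> forall N : nat, exists j : nat,
    (N <= j)%nat /\ rpow (INR j) s * distZ (INR j * theta) < eps.

Definition W_set (theta : R) (s : R) : Prop := 0 < s /\ liminf_zero theta s.

Definition is_lub_set (P : R -> Prop) (m : R) : Prop :=
  (forall x, P x -> x <= m) /\ (forall b, (forall x, P x -> x <= b) -> m <= b).

Definition is_glb_set (P : R -> Prop) (m : R) : Prop :=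
  (forall x, P x -> m <= x) /\ (forall b, (forall x, P x -> b <= x) -> b <= m).

Definition irr_exponent_eq (theta w : R) : Prop := is_lub_set (W_set theta) w.

Definition irr_exponent_infinite (theta : R) : Prop :=
  forall M, exists s, W_set theta s /\ M < s.

(** U_tau[theta], as a subset of [0,1) (points of T = R/Z as fractional parts). *)
Definition U_set (tau theta : R) (y : R) : Prop :=
  0 <= y < 1 /\
  exists Q0 : R, forall Q : R, Q0 <= Q ->
    exists n : nat, (1 <= n)%nat /\ INR n <= Q /\
      distZ (INR n * theta - y) < Rpower Q (- tau).

Definition hausdorff_null (s : R) (E : R -> Prop) : Prop :=
  forall delta eps, 0 < delta -> 0 < eps ->
  exists (U : nat -> R -> Prop) (r : nat -> R),
    (forall i, 0 <= r i <= delta) /\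
    (forall i x y, U i x -> U i y -> Rabs (x - y) <= r i) /\
    (forall x, E x -> exists i, U i x) /\
    (forall n, sum_f_R0 (fun i => rpow (r i) s) n < eps).

Definition hdim (E : R -> Prop) : R :=
  epsilon (inhabits 0) (is_glb_set (fun s => 0 < s /\ hausdorff_null s E)).

(* Main.v *)
(** Let [q_k] be the convergent denominators of [theta] and [d_k = ||q_k theta||].

    Upper bounds.  Since [n = a j + b] puts [n theta] near [b theta], the points [n theta], [n <= Q],
    lie within [Q^(-tau)] of the [j] points [b theta] when [Q^(1+tau) = j / ||j theta||].  So the set
    is covered by [j] arcs of length about [(||j theta|| / j)^(tau/(1+tau))]; good approximations [j]
    give the bound [(1/tau + 1)/(w + 1)], and the dimension zero when [w] is infinite.  For [tau > 1]
    only few of these arcs are needed: by induction on the scale, the set is covered by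
    [X^(beta + o(1))] arcs of length [1/X] with [beta = (w - tau)/((1 + tau)(w - 1))], because a
    short arc meets at most one of the separated balls of radius [Q^(-tau)].

    Lower bound.  The numbers [N theta], with [N] a sum of increments of the form [b q_k], form a tree
    whose uniform distribution is of Frostman type.  Such a point satisfies the uniform condition for
    [q_k < Q <= q_(k+1)] when the digits [b] stay below about [(d_k q_k^tau)^(-1/(1+tau))].  If
    [tau < 1] the condition only matters at levels with [q_(k+1) > (q_k / 2)^(1/tau)], which are so
    sparse that constants are harmless.  If [tau = 1] every level matters and constants do too: the
    number of admissible digits at each block of levels must be at least the square root of the growth
    of [q_k] over the block, which forces an exact analysis of the small partial quotients. *)

Require Import Defs.
From Stdlib Require Import Reals ZArith Lra Lia List ClassicalEpsilon Classical FinFun.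
Open Scope R_scope.

(** One exponent governs both directions. With [t = tau/(1+tau)], level [k] sees the set at scale
    [(d_k/q_k)^t]; if about [q_k^beta] pieces are present at that level, the corresponding dimension
    is [beta (1+tau) / (tau (1+w))], and the critical [beta] of the overview turns this into
    [(w/tau - 1)/(w^2 - 1)]. For [tau > 1] any larger [beta] bounds the number of pieces from above,
    for [tau < 1] any smaller one bounds it from below; both facts reduce to linear inequalities
    between [ln q_k], [ln d_k] and the logarithm of the next scale. The obstacle at [tau = 1] is
    visible there: a level with [q_(k+1)] comparable to [q_k] gains only the exponent [1 - 2t],
    which is then zero, so a bounded loss at every level would accumulate. Nor can a margin be
    bought by raising [tau], as is done below 1, since beyond 1 only the trivial lower bound is
    claimed. At [tau = 1] the critical [beta] is 1/2 for every [w], which is the origin of the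
    square roots. Since [hdim] is a chosen value, even a lower bound for it requires some exponent
    known to be null. *)

Lemma distZ_attained (t : R) : exists k : Z, distZ t = Rabs (t - IZR k).
Proof.
  unfold distZ. pose proof (base_fp t) as [h1 h2].
  pose proof (Rplus_Int_part_frac_part t) as h3.
  destruct (Rle_dec (frac_part t) (1 - frac_part t)) as [h | h].
  - exists (Int_part t). rewrite Rmin_left, Rabs_right; lra.
  - exists (Int_part t + 1)%Z. rewrite Rmin_right, Rabs_left, plus_IZR; try rewrite plus_IZR; lra.
Qed.

Lemma distZ_le_Rabs (t : R) (k : Z) : distZ t <= Rabs (t - IZR k).
Proof.
  unfold distZ. pose proof (base_fp t) as [h1 h2].
  pose proof (Rplus_Int_part_frac_part t) as h3.
  destruct (Z_le_gt_dec k (Int_part t)) as [h | h].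
  - apply IZR_le in h. rewrite Rabs_right by lra.
    eapply Rle_trans; [apply Rmin_l | lra].
  - assert (h' : (Int_part t + 1 <= k)%Z) by lia. apply IZR_le in h'. rewrite plus_IZR in h'.
    rewrite Rabs_left1 by lra. eapply Rle_trans; [apply Rmin_r | lra].
Qed.

Lemma distZ_ge0 (t : R) : 0 <= distZ t.
Proof. destruct (distZ_attained t) as [k ->]. apply Rabs_pos. Qed.

Lemma distZ_le_half (t : R) : distZ t <= / 2.
Proof.
  unfold distZ. destruct (Rle_dec (frac_part t) (/ 2)).
  - eapply Rle_trans; [apply Rmin_l | lra].
  - eapply Rle_trans; [apply Rmin_r | lra].
Qed.

Lemma distZ_le_abs (t : R) : distZ t <= Rabs t.
Proof. replace t with (t - IZR 0) at 2 by (simpl; ring). apply distZ_le_Rabs. Qed.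

Lemma distZ_0 : distZ 0 = 0.
Proof.
  apply Rle_antisym; [| apply distZ_ge0]. eapply Rle_trans; [apply distZ_le_abs |]. rewrite Rabs_R0. lra.
Qed.

Lemma distZ_addZ (t : R) (k : Z) : distZ (t + IZR k) = distZ t.
Proof.
  apply Rle_antisym.
  - destruct (distZ_attained t) as [l ->].
    replace (t - IZR l) with (t + IZR k - IZR (l + k)) by (rewrite plus_IZR; ring).
    apply distZ_le_Rabs.
  - destruct (distZ_attained (t + IZR k)) as [l ->].
    replace (t + IZR k - IZR l) with (t - IZR (l - k)) by (rewrite minus_IZR; ring).
    apply distZ_le_Rabs.
Qed.

Lemma distZ_opp (t : R) : distZ (- t) = distZ t.
Proof.
  assert (h : forall u, distZ (- u) <= distZ u).
  { intros u. destruct (distZ_attained u) as [l ->].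
    rewrite <- Rabs_Ropp. replace (- (u - IZR l)) with (- u - IZR (- l)) by (rewrite opp_IZR; ring).
    apply distZ_le_Rabs. }
  apply Rle_antisym; [apply h |]. rewrite <- (Ropp_involutive t) at 1. apply h.
Qed.

Lemma distZ_add (s t : R) : distZ (s + t) <= distZ s + distZ t.
Proof.
  destruct (distZ_attained s) as [k ->], (distZ_attained t) as [l ->].
  eapply Rle_trans; [apply (distZ_le_Rabs _ (k + l)) |].
  replace (s + t - IZR (k + l)) with ((s - IZR k) + (t - IZR l)) by (rewrite plus_IZR; ring).
  apply Rabs_triang.
Qed.

Lemma distZ_sub (s t : R) : distZ (s - t) <= distZ s + distZ t.
Proof. rewrite <- (distZ_opp t). apply distZ_add. Qed.

Lemma distZ_sym (s t : R) : distZ (s - t) = distZ (t - s).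
Proof. rewrite <- distZ_opp. f_equal. ring. Qed.

Lemma distZ_triang (s u t : R) : distZ (s - t) <= distZ (s - u) + distZ (u - t).
Proof. replace (s - t) with ((s - u) + (u - t)) by ring. apply distZ_add. Qed.

Lemma distZ_nmul (n : nat) (t : R) : distZ (INR n * t) <= INR n * distZ t.
Proof.
  destruct (distZ_attained t) as [k ->].
  replace (INR n * Rabs (t - IZR k)) with (Rabs (INR n * t - IZR (Z.of_nat n * k))).
  - apply distZ_le_Rabs.
  - rewrite mult_IZR, <- INR_IZR_INZ, <- Rmult_minus_distr_l, Rabs_mult.
    rewrite (Rabs_right (INR n)); [reflexivity | apply Rle_ge, pos_INR].
Qed.

Lemma distZ_eq_abs (t : R) : Rabs t <= / 2 -> distZ t = Rabs t.
Proof.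
  intros h. apply Rle_antisym; [apply distZ_le_abs |].
  destruct (distZ_attained t) as [k ->].
  destruct (Z.eq_dec k 0) as [-> | hk].
  - replace (t - 0) with t by ring. lra.
  - assert (1 <= Rabs (IZR k)).
    { rewrite <- abs_IZR. apply IZR_le. lia. }
    pose proof (Rabs_triang_inv (IZR k) t). rewrite Rabs_minus_sym. lra.
Qed.

(** * Real powers and integer parts *)

Lemma Rpower_pos (x y : R) : 0 < Rpower x y.
Proof. apply exp_pos. Qed.

Lemma rpow_pos (t s : R) : 0 < t -> rpow t s = Rpower t s.
Proof. intros h. unfold rpow. destruct (Rle_dec t 0); [lra | reflexivity]. Qed.

Lemma rpow_ge0 (t s : R) : 0 <= rpow t s.
Proof. unfold rpow. destruct (Rle_dec t 0); [lra | left; apply Rpower_pos]. Qed.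

Lemma Rpower_ln_le (x y u v : R) : y * ln x <= v * ln u -> Rpower x y <= Rpower u v.
Proof.
  intros [h | h]; unfold Rpower; [left; now apply exp_increasing | rewrite h; lra].
Qed.

Lemma exists_nat_gt (x : R) : exists n : nat, x < INR n.
Proof.
  destruct (Rle_dec 0 x) as [h | h].
  - destruct (archimed x) as [h1 _]. exists (Z.to_nat (up x)).
    assert (0 <= up x)%Z. { apply le_IZR. lra. }
    rewrite INR_IZR_INZ, Z2Nat.id by lia. lra.
  - exists 0%nat. simpl. lra.
Qed.

Lemma nat_floor (x : R) : 0 <= x -> exists n : nat, INR n <= x < INR n + 1.
Proof.
  intros h. destruct (base_Int_part x) as [h1 h2].
  assert (hz : (0 <= Int_part x)%Z).
  { assert (-1 < Int_part x)%Z; [apply lt_IZR; simpl; lra | lia]. }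
  exists (Z.to_nat (Int_part x)).
  rewrite INR_IZR_INZ, Z2Nat.id by lia. lra.
Qed.

(** * Hausdorff dimension *)

(** The choice in [hdim] is meaningful only if the null exponents have an infimum; they are bounded
    below by 0, so one witness [s0] is enough. Passing to negatives turns the infimum into a
    supremum. *)
Lemma hdim_glb (E : R -> Prop) (s0 : R) : 0 < s0 -> hausdorff_null s0 E ->
  is_glb_set (fun s => 0 < s /\ hausdorff_null s E) (hdim E).
Proof.
  intros h0 hn. unfold hdim. apply epsilon_spec.
  destruct (completeness (fun x => 0 < - x /\ hausdorff_null (- x) E)) as [m [hm1 hm2]].
  - exists 0. intros x [hx _]. lra.
  - exists (- s0). now rewrite Ropp_involutive.
  - exists (- m). split.
    + intros x hx. assert (- x <= m); [| lra].
      apply hm1. now rewrite Ropp_involutive.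
    + intros b hb. assert (m <= - b); [| lra].
      apply hm2. intros x hx. specialize (hb _ hx). lra.
Qed.

Lemma hdim_le (E : R -> Prop) (b : R) : 0 <= b ->
  (forall s, b < s -> hausdorff_null s E) -> hdim E <= b.
Proof.
  intros hb h.
  destruct (hdim_glb E (b + 1)) as [h1 _]; [lra | apply h; lra |].
  apply le_epsilon. intros eps he. apply h1. split; [lra | apply h; lra].
Qed.

Lemma hdim_ge (E : R -> Prop) (b s0 : R) : 0 < s0 -> hausdorff_null s0 E ->
  (forall s, 0 < s < b -> ~ hausdorff_null s E) -> b <= hdim E.
Proof.
  intros h0 hn h. destruct (hdim_glb E s0 h0 hn) as [_ h2].
  apply h2. intros s [hs1 hs2]. apply Rnot_lt_le. intros hlt. now apply (h s).
Qed.

Lemma hausdorff_null_subset (s : R) (E F : R -> Prop) :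
  (forall x, E x -> F x) -> hausdorff_null s F -> hausdorff_null s E.
Proof.
  intros hsub hF delta eps hd he.
  destruct (hF delta eps hd he) as (U & r & h1 & h2 & h3 & h4).
  exists U, r. repeat split; auto; apply h1.
Qed.

(** A pair [(c, r)] stands for the interval of centre [c] and diameter [r], since [hausdorff_null]
    weighs sets by their diameters. *)
Definition ball_sum (f : R * R -> R) (l : list (R * R)) : R :=
  fold_right (fun b acc => f b + acc) 0 l.

Lemma ball_sum_app f l1 l2 : ball_sum f (l1 ++ l2) = ball_sum f l1 + ball_sum f l2.
Proof. induction l1 as [| b l IH]; simpl; [ring | rewrite IH; ring]. Qed.

Lemma ball_sum_ge0 f l : (forall b, 0 <= f b) -> 0 <= ball_sum f l.
Proof. intros h. induction l as [| b l IH]; simpl; [lra | specialize (h b); lra]. Qed.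

Lemma ball_sum_const (f : R * R -> R) c l : (forall b, In b l -> f b = c) ->
  ball_sum f l = INR (length l) * c.
Proof.
  induction l as [| b l IH]; intros h; [simpl; ring |].
  change (ball_sum f (b :: l)) with (f b + ball_sum f l).
  change (length (b :: l)) with (S (length l)).
  rewrite IH, S_INR, h; [ring | now left |]. intros; apply h; now right.
Qed.

Lemma sum_nth_le_ball_sum (f : R * R -> R) (dflt : R * R) : (forall b, 0 <= f b) ->
  f dflt = 0 -> forall l n, sum_f_R0 (fun i => f (nth i l dflt)) n <= ball_sum f l.
Proof.
  intros hf hd. induction l as [| b l IH]; intros n.
  - simpl. right. rewrite (sum_eq _ (fun _ => 0)).
    + rewrite sum_cte. ring.
    + intros i _. now destruct i.
  - destruct n as [| n].
    + simpl. pose proof (ball_sum_ge0 f l hf). lra.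
    + rewrite decomp_sum by lia. simpl pred. simpl nth at 1.
      change (ball_sum f (b :: l)) with (f b + ball_sum f l).
      apply Rplus_le_compat_l. apply IH.
Qed.

Fixpoint prefix_cat (L : nat -> list (R * R)) (m : nat) : list (R * R) :=
  match m with O => L O | S m' => prefix_cat L m' ++ L m end.

Lemma prefix_cat_split L m k : exists l, prefix_cat L (m + k) = prefix_cat L m ++ l.
Proof.
  induction k as [| k [l hl]].
  - exists nil. rewrite Nat.add_0_r, app_nil_r. reflexivity.
  - exists (l ++ L (m + S k)%nat). rewrite Nat.add_succ_r. simpl.
    rewrite hl, <- app_assoc. reflexivity.
Qed.

(** Countable stability: [F m] receives the budget [eps / 2^(m+2)], and the finite lists are
    concatenated into a single sequence of intervals. *)
Lemma hausdorff_null_of_ball_lists (s : R) (E : R -> Prop) (F : nat -> R -> Prop) :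
  (forall x, E x -> exists m, F m x) ->
  (forall m delta eps, 0 < delta -> 0 < eps -> exists l : list (R * R),
     (forall b, In b l -> 0 <= snd b <= delta) /\
     (forall x, F m x -> exists b, In b l /\ 2 * Rabs (x - fst b) <= snd b) /\
     ball_sum (fun b => rpow (snd b) s) l < eps) ->
  hausdorff_null s E.
Proof.
  intros hE hF delta eps hd he.
  set (f := fun b : R * R => rpow (snd b) s).
  assert (hf : forall b, 0 <= f b) by (intros; apply rpow_ge0).
  assert (hf0 : f (0, 0) = 0).
  { unfold f, rpow; simpl. destruct (Rle_dec 0 0); lra. }
  assert (HL : forall m, exists l, (forall b, In b l -> 0 <= snd b <= delta) /\
     (forall x, F m x -> exists b, In b l /\ 2 * Rabs (x - fst b) <= snd b) /\
     ball_sum f l < eps / 2 * (/ 2) ^ (S m) /\ (1 <= length l)%nat).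
  { intros m. destruct (hF m delta (eps / 2 * (/ 2) ^ (S m))) as (l & h1 & h2 & h3).
    - exact hd.
    - apply Rmult_lt_0_compat; [lra | apply pow_lt; lra].
    (* The padding by a degenerate ball of weight 0 makes every list nonempty, so that prefix number
       [i] has an entry of index [i]. *)
    - exists ((0, 0) :: l). repeat split.
      + destruct H as [<- | H]; [simpl; lra | now apply h1].
      + destruct H as [<- | H]; [simpl; lra | now apply h1].
      + intros x hx. destruct (h2 x hx) as [b [hb1 hb2]]. exists b. split; [now right | exact hb2].
      + change (f (0,0) + ball_sum f l < eps / 2 * (/ 2) ^ S m). rewrite hf0.
        unfold f. lra.
      + simpl. lia. }
  apply choice in HL. destruct HL as [L hL].
  set (P := prefix_cat L).
  assert (hlen : forall m, (S m <= length (P m))%nat).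
  { induction m as [| m IH]; unfold P in *; simpl.
    - apply hL.
    - rewrite length_app. pose proof (proj2 (proj2 (proj2 (hL (S m))))). lia. }
  assert (hin : forall m b, In b (P m) -> 0 <= snd b <= delta).
  { induction m as [| m IH]; intros b; unfold P in *; simpl.
    - apply hL.
    - rewrite in_app_iff. intros [H | H]; [now apply IH | now apply (hL (S m))]. }
  assert (hsum : forall m, ball_sum f (P m) <= eps / 2 * (1 - (/ 2) ^ (S m))).
  { induction m as [| m IH]; unfold P in *; simpl prefix_cat.
    - pose proof (proj1 (proj2 (proj2 (hL O)))). simpl in *. lra.
    - rewrite ball_sum_app. pose proof (proj1 (proj2 (proj2 (hL (S m))))) as H1.
      change ((/ 2) ^ S (S m)) with (/ 2 * (/ 2) ^ (S m)) in *. lra. }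
  (* Entry [i] is already final in prefix [i]; the diagonal [nth i (P i)] therefore enumerates the
     whole concatenation. *)
  assert (hnth : forall i m, (i <= m)%nat -> nth i (P i) (0, 0) = nth i (P m) (0, 0)).
  { intros i m him. destruct (prefix_cat_split L i (m - i)) as [l hl].
    replace (i + (m - i))%nat with m in hl by lia. unfold P. rewrite hl.
    rewrite app_nth1; [reflexivity | apply hlen]. }
  exists (fun i x => 2 * Rabs (x - fst (nth i (P i) (0, 0))) <= snd (nth i (P i) (0, 0))).
  exists (fun i => snd (nth i (P i) (0, 0))).
  split; [| split; [| split]].
  - intros i. apply (hin i). apply nth_In. apply hlen.
  - intros i x y hx hy.
    replace (x - y) with ((x - fst (nth i (P i) (0, 0))) - (y - fst (nth i (P i) (0, 0)))) by ring.
    eapply Rle_trans; [apply Rabs_triang |]. rewrite Rabs_Ropp. lra.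
  - intros x hx. destruct (hE x hx) as [m hm].
    destruct (proj1 (proj2 (hL m)) x hm) as [b [hb1 hb2]].
    assert (hb : In b (P m)).
    { unfold P. destruct m; simpl; [exact hb1 | rewrite in_app_iff; now right]. }
    destruct (In_nth _ _ (0, 0) hb) as [i [hi1 hi2]].
    exists i. assert (h : nth i (P i) (0, 0) = b); [| rewrite h; exact hb2].
    destruct (Nat.le_ge_cases i m) as [h | h].
    + now rewrite (hnth i m).
    + destruct (prefix_cat_split L m (i - m)) as [l hl].
      replace (m + (i - m))%nat with i in hl by lia. unfold P. rewrite hl.
      rewrite app_nth1; assumption.
  - intros n. apply Rle_lt_trans with (ball_sum f (P n)).
    + rewrite (sum_eq _ (fun i => f (nth i (P n) (0, 0)))).
      * now apply sum_nth_le_ball_sum.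
      * intros i hi. unfold f. now rewrite (hnth i n).
    + eapply Rle_lt_trans; [apply hsum |].
      assert (0 < (/ 2) ^ S n) by (apply pow_lt; lra). nra.
Qed.

(** * Covers by arcs of the circle *)

Definition circle_cover (F : R -> Prop) (l : list R) (r : R) : Prop :=
  forall y, F y -> exists c, In c l /\ distZ (y - c) <= r.

(** An arc may wrap around the end of [[0,1)], so it is unrolled into three intervals, about the
    fractional part of its centre and that point shifted by 1 either way. The factor 3 and the
    passage from radius to diameter cost [3 * 2^s], taken off [eps] in advance. *)
Lemma hausdorff_null_of_circle_covers (s : R) (E : R -> Prop) (F : nat -> R -> Prop) :
  0 < s ->
  (forall x, E x -> exists m, F m x) ->
  (forall m x, F m x -> 0 <= x < 1) ->
  (forall m delta eps, 0 < delta -> 0 < eps -> exists l r,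
     0 < r <= delta /\ circle_cover (F m) l r /\ INR (length l) * Rpower r s < eps) ->
  hausdorff_null s E.
Proof.
  intros hs hE hF01 hF. apply hausdorff_null_of_ball_lists with F; [exact hE |].
  intros m delta eps hd he.
  pose proof (Rpower_pos 2 s) as h2s.
  destruct (hF m (delta / 2) (eps / (3 * Rpower 2 s))) as (l & r & [hr1 hr2] & hc & hl).
  { lra. } { apply Rdiv_lt_0_compat; lra. }
  set (L := flat_map (fun c => (frac_part c, 2 * r) :: (frac_part c - 1, 2 * r)
                             :: (frac_part c + 1, 2 * r) :: nil) l).
  exists L.
  assert (hsnd : forall b, In b L -> snd b = 2 * r).
  { intros b hb. unfold L in hb. apply in_flat_map in hb. destruct hb as [c [_ hb]].
    simpl in hb. destruct hb as [<- | [<- | [<- | []]]]; reflexivity. }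
  split; [| split].
  - intros b hb. rewrite (hsnd b hb). lra.
  - intros x hx. pose proof (hF01 m x hx) as hx01.
    destruct (hc x hx) as [c [hc1 hc2]].
    destruct (distZ_attained (x - c)) as [k hk].
    pose proof (distZ_le_half (x - c)) as hh.
    pose proof (base_fp c) as [hc3 hc4]. pose proof (Rplus_Int_part_frac_part c) as hc5.
    rewrite hk in hc2, hh.
    assert (hk' : x - c - IZR k = x - frac_part c - IZR (k + Int_part c)) by (rewrite plus_IZR; lra).
    rewrite hk' in hc2, hh. set (z := (k + Int_part c)%Z) in *.
    assert (hz : (-2 < z < 2)%Z).
    { revert hh. unfold Rabs. destruct (Rcase_abs _); split; apply lt_IZR; simpl; lra. }
    assert (hz' : z = 0%Z \/ z = 1%Z \/ z = (-1)%Z) by lia.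
    destruct hz' as [hz' | [hz' | hz']]; rewrite hz' in *.
    + exists (frac_part c, 2 * r). split.
      * apply in_flat_map. exists c. split; [exact hc1 | simpl; tauto].
      * simpl fst; simpl snd. replace (x - frac_part c) with (x - frac_part c - 0) by ring. lra.
    + exists (frac_part c + 1, 2 * r). split.
      * apply in_flat_map. exists c. split; [exact hc1 | simpl; tauto].
      * simpl fst; simpl snd. replace (x - (frac_part c + 1)) with (x - frac_part c - 1) by ring. lra.
    + exists (frac_part c - 1, 2 * r). split.
      * apply in_flat_map. exists c. split; [exact hc1 | simpl; tauto].
      * simpl fst; simpl snd. replace (x - (frac_part c - 1)) with (x - frac_part c - -1) by ring. lra.
  - rewrite (ball_sum_const _ (Rpower 2 s * Rpower r s)).
    + assert (hlen : INR (length L) = 3 * INR (length l)).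
      { unfold L. clear. induction l as [| c l IH]; [simpl; ring |].
        simpl flat_map. cbn [app length]. rewrite !S_INR, IH. ring. }
      rewrite hlen.
      apply (Rmult_lt_compat_r (3 * Rpower 2 s)) in hl; [| lra].
      replace (eps / (3 * Rpower 2 s) * (3 * Rpower 2 s)) with eps in hl by (field; lra). lra.
    + intros b hb. rewrite (hsnd b hb), rpow_pos by lra.
      rewrite Rpower_mult_distr; [reflexivity | lra | lra].
Qed.

Lemma Rpower_neg_small (eta eps : R) : 0 < eta -> 0 < eps ->
  exists N, 0 < N /\ forall x, N <= x -> Rpower x (- eta) < eps.
Proof.
  intros h1 h2. exists (exp (- ln eps / eta + 1)). split; [apply exp_pos |].
  intros x hx. unfold Rpower. rewrite <- (exp_ln eps h2) at 1. apply exp_increasing.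
  assert (h : - ln eps / eta + 1 <= ln x).
  { rewrite <- (ln_exp (- ln eps / eta + 1)).
    destruct hx as [hx | hx]; [left; apply ln_increasing; [apply exp_pos | exact hx] | right; now rewrite hx]. }
  apply (Rmult_le_compat_l eta) in h; [| lra].
  replace (eta * (- ln eps / eta + 1)) with (- ln eps + eta) in h by (field; lra). lra.
Qed.

Lemma ln_div (x y : R) : 0 < x -> 0 < y -> ln (x / y) = ln x - ln y.
Proof.
  intros hx hy. unfold Rdiv. rewrite ln_mult, ln_Rinv; try lra.
  now apply Rinv_0_lt_compat.
Qed.

Lemma ln_Rle (x y : R) : 0 < x -> x <= y -> ln x <= ln y.
Proof. intros h [h1 | ->]; [left; now apply ln_increasing | lra]. Qed.

Lemma ln_Rle_inv (x y : R) : 0 < x -> 0 < y -> ln x <= ln y -> x <= y.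
Proof. intros hx hy [h | h]; [left; now apply ln_lt_inv | right; now apply ln_inv]. Qed.

(** * Covers obtained from one good approximation *)

Definition irrational (theta : R) : Prop :=
  ~ exists (p q : Z), q <> 0%Z /\ theta = IZR p / IZR q.

Lemma distZ_irrational_pos (theta : R) (n : nat) : irrational theta -> (1 <= n)%nat ->
  0 < distZ (INR n * theta).
Proof.
  intros hi hn. destruct (distZ_ge0 (INR n * theta)) as [h | h]; [exact h |].
  exfalso. destruct (distZ_attained (INR n * theta)) as [k hk].
  apply hi. exists k, (Z.of_nat n). split; [lia |].
  rewrite <- INR_IZR_INZ. assert (INR n <> 0) by (apply not_0_INR; lia).
  rewrite hk in h.
  assert (h0 : INR n * theta = IZR k) by (revert h; unfold Rabs; destruct (Rcase_abs _); lra).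
  apply (Rmult_eq_reg_l (INR n)); [| exact H]. field_simplify; lra.
Qed.

(** Fixing the threshold lets one scale [Q] serve all points at once; integer thresholds exhaust
    [U_set]. *)
Definition U_from (tau theta Q0 y : R) : Prop :=
  0 <= y < 1 /\ forall Q : R, Q0 <= Q ->
    exists n : nat, (1 <= n)%nat /\ INR n <= Q /\ distZ (INR n * theta - y) < Rpower Q (- tau).

Lemma U_set_exhaust (tau theta y : R) : U_set tau theta y -> exists m : nat, U_from tau theta (INR m) y.
Proof.
  intros [h1 [Q0 h2]]. destruct (exists_nat_gt Q0) as [m hm]. exists m. split; [exact h1 |].
  intros Q hQ. apply h2. lra.
Qed.

(* Writing [n = a j + b] with [1 <= b <= j] moves [n theta] to [b theta] at the cost [a ||j theta||];
   the choice [Q ^ (1 + tau) = j / ||j theta||] makes this cost at most [Q ^ (- tau)]. *)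
Lemma U_from_near_multiples (theta tau Q0 y Q : R) (j : nat) : U_from tau theta Q0 y ->
  Q0 <= Q -> (1 <= j)%nat -> Q * distZ (INR j * theta) <= INR j * Rpower Q (- tau) ->
  exists b, (1 <= b <= j)%nat /\ distZ (y - INR b * theta) <= 2 * Rpower Q (- tau).
Proof.
  intros [_ hy] hQ hj hd.
  destruct (hy Q hQ) as (n & hn1 & hn2 & hn3).
  set (a := ((n - 1) / j)%nat). set (b := ((n - 1) mod j + 1)%nat).
  assert (hj0 : j <> 0%nat) by lia.
  assert (hnab : n = (a * j + b)%nat).
  { unfold a, b. pose proof (Nat.div_mod (n - 1) j hj0). lia. }
  assert (hb : (1 <= b <= j)%nat).
  { unfold b. pose proof (Nat.mod_upper_bound (n - 1) j hj0). lia. }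
  exists b. split; [exact hb |].
  rewrite distZ_sym.
  replace (INR b * theta - y) with ((INR n * theta - y) - INR a * (INR j * theta)).
  2:{ rewrite hnab, plus_INR, mult_INR. ring. }
  eapply Rle_trans; [apply distZ_sub |].
  assert (h1 : distZ (INR a * (INR j * theta)) <= Rpower Q (- tau)); [| lra].
  eapply Rle_trans; [apply distZ_nmul |].
  assert (hjp : 0 < INR j) by (apply lt_0_INR; lia).
  apply (Rmult_le_reg_l (INR j)); [exact hjp |].
  eapply Rle_trans; [| exact hd]. rewrite <- Rmult_assoc.
  apply Rmult_le_compat_r; [apply distZ_ge0 |].
  eapply Rle_trans; [| exact hn2]. rewrite hnab, plus_INR, mult_INR.
  pose proof (pos_INR b). lra.
Qed.

(** This [Q] balances two errors: the drift [Q d / x] caused by reducing indices modulo [x], and the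
    tolerance [Q^(-tau)]. *)
Lemma optimal_Q (tau x d : R) : 0 < tau -> 0 < x -> 0 < d ->
  let Q := Rpower (x / d) (/ (1 + tau)) in
  Q * d = x * Rpower Q (- tau) /\
  Rpower Q (- tau) = Rpower (d / x) (tau / (1 + tau)).
Proof.
  intros ht hx hd Q.
  assert (hdx : 0 < x / d) by now apply Rdiv_lt_0_compat.
  assert (hQ : ln Q = / (1 + tau) * (ln x - ln d)).
  { unfold Q. rewrite ln_Rpower, ln_div by lra. reflexivity. }
  split.
  - apply ln_inv.
    + apply Rmult_lt_0_compat; [apply Rpower_pos | exact hd].
    + apply Rmult_lt_0_compat; [exact hx | apply Rpower_pos].
    + rewrite !ln_mult; try apply Rpower_pos; try lra.
      rewrite ln_Rpower, hQ. field. lra.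
  - unfold Rpower. f_equal. rewrite hQ, ln_div by lra. field. lra.
Qed.

(** With [t = tau/(1+tau)], an approximation [||j theta|| < j^(-v)] yields [j] arcs of radius at
    most [2 j^(-(1+v) t)]. Their total weight is of order [j^(1 - (1+v) t s)], whose exponent is
    negative exactly under the hypothesis on [s (v + 1)]. *)
Lemma U_set_null_of_approximations (theta tau s v : R) : irrational theta ->
  0 < tau -> 0 < v -> 0 < s -> 1 / tau + 1 < s * (v + 1) ->
  (forall N : nat, exists j : nat, (N <= j)%nat /\ rpow (INR j) v * distZ (INR j * theta) < 1) ->
  hausdorff_null s (U_set tau theta).
Proof.
  intros hirr ht hv hs hsv happ.
  apply hausdorff_null_of_circle_covers with (fun m => U_from tau theta (INR m)); [exact hs | | |].
  { intros x hx. now apply U_set_exhaust. }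
  { intros m x hx. apply hx. }
  intros m delta eps hd he.
  set (t := tau / (1 + tau)).
  assert (htt : 0 < t) by (apply Rdiv_lt_0_compat; lra).
  assert (het : 0 < (1 + v) * t * s - 1).
  { assert (1 < s * (v + 1) * t); [| lra].
    apply Rmult_lt_reg_r with (1 / tau + 1).
    - assert (0 < 1 / tau) by (apply Rdiv_lt_0_compat; lra). lra.
    - replace (s * (v + 1) * t * (1 / tau + 1)) with (s * (v + 1)) by (unfold t; field; lra). lra. }
  destruct (Rpower_neg_small ((1 + v) * t) (delta / 2)) as (N1 & hN1 & hN1'); [| lra |].
  { apply Rmult_lt_0_compat; lra. }
  destruct (Rpower_neg_small ((1 + v) * t * s - 1) (eps / Rpower 2 s)) as (N2 & hN2 & hN2'); [lra | |].
  { apply Rdiv_lt_0_compat; [lra | apply Rpower_pos]. }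
  (* The last term guarantees that the balanced [Q] is at least the threshold [m]:
     [Q^(1+tau) = j/d >= j >= m^(1+tau)]. *)
  destruct (exists_nat_gt (1 + N1 + N2 + Rpower (INR m) (1 + tau))) as [N hN].
  destruct (happ N) as (j & hNj & hj).
  pose proof (Rpower_pos (INR m) (1 + tau)).
  apply le_INR in hNj.
  assert (hj1 : (1 <= j)%nat).
  { apply INR_le. simpl. lra. }
  assert (hjp : 0 < INR j) by lra.
  set (d := distZ (INR j * theta)) in *.
  assert (hdp : 0 < d) by now apply distZ_irrational_pos.
  rewrite rpow_pos in hj by exact hjp.
  assert (hlnd : ln d < - v * ln (INR j)).
  { apply ln_increasing in hj; [| apply Rmult_lt_0_compat; [apply Rpower_pos | lra]].
    rewrite ln_mult, ln_Rpower, ln_1 in hj; [lra | apply Rpower_pos | lra]. }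
  assert (hlnj : 0 <= ln (INR j)). { rewrite <- ln_1. apply ln_Rle; lra. }
  destruct (optimal_Q tau (INR j) d ht hjp hdp) as [hQ1 hQ2].
  set (Q := Rpower (INR j / d) (/ (1 + tau))) in *.
  assert (hr : Rpower Q (- tau) <= Rpower (INR j) (- ((1 + v) * t))).
  { rewrite hQ2. apply Rpower_ln_le. fold t. rewrite ln_div by lra. nra. }
  set (r := 2 * Rpower Q (- tau)).
  assert (hrp : 0 < r) by (unfold r; pose proof (Rpower_pos Q (- tau)); lra).
  exists (map (fun b => INR b * theta) (seq 1 j)), r. split; [| split].
  - split; [exact hrp |]. unfold r. assert (Rpower (INR j) (- ((1 + v) * t)) < delta / 2) by (apply hN1'; lra). lra.
  - intros y hy. destruct (U_from_near_multiples theta tau (INR m) y Q j hy) as (b & hb1 & hb2).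
    + destruct (Nat.eq_dec m 0) as [-> | hm].
      * simpl. left. apply Rpower_pos.
      * assert (0 < INR m) by (apply lt_0_INR; lia).
        apply ln_Rle_inv; [assumption | apply Rpower_pos |].
        unfold Q. rewrite ln_Rpower, ln_div by lra.
        assert (hm2 : ln (Rpower (INR m) (1 + tau)) <= ln (INR j)) by (apply ln_Rle; lra).
        rewrite ln_Rpower in hm2.
        apply (Rmult_le_reg_l (1 + tau)); [lra |].
        replace ((1 + tau) * (/ (1 + tau) * (ln (INR j) - ln d))) with (ln (INR j) - ln d) by (field; lra).
        nra.
    + exact hj1.
    + right. exact hQ1.
    + exists (INR b * theta). split; [| exact hb2].
      apply in_map_iff. exists b. split; [reflexivity | apply in_seq; lia].
  - rewrite length_map, length_seq. unfold r.
    rewrite <- Rpower_mult_distr by (try lra; apply Rpower_pos).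
    assert (h5 : Rpower (Rpower Q (- tau)) s <= Rpower (INR j) (- ((1 + v) * t) * s)).
    { rewrite <- Rpower_mult. apply Rle_Rpower_l; [lra |]. split; [apply Rpower_pos | exact hr]. }
    assert (h6 : INR j * Rpower (INR j) (- ((1 + v) * t) * s) = Rpower (INR j) (- ((1 + v) * t * s - 1))).
    { rewrite <- (Rpower_1 (INR j) hjp) at 1. rewrite <- Rpower_plus. f_equal. ring. }
    assert (h7 : Rpower (INR j) (- ((1 + v) * t * s - 1)) < eps / Rpower 2 s) by (apply hN2'; lra).
    pose proof (Rpower_pos 2 s) as h8.
    apply Rle_lt_trans with (Rpower 2 s * (INR j * Rpower (INR j) (- ((1 + v) * t) * s))).
    + rewrite (Rmult_comm (INR j)), Rmult_assoc. apply Rmult_le_compat_l; [lra |].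
      rewrite Rmult_comm. apply Rmult_le_compat_l; [lra | exact h5].
    + rewrite h6. apply (Rmult_lt_compat_l (Rpower 2 s)) in h7; [| exact h8].
      replace (Rpower 2 s * (eps / Rpower 2 s)) with eps in h7 by (field; lra). exact h7.
Qed.

(** * Continued fractions *)

(* Indices are shifted by one with respect to the usual convention, so that no index is negative:
   [cfD theta k] is [d_(k-1) = |q_(k-1) theta - p_(k-1)|], [cfQ theta k] is [q_(k-1)], and
   [cfa theta k] is the partial quotient [a_(k+1)]; thus [cfD theta 0 = 1] and [cfQ theta 0 = 0]. *)
Fixpoint cfDD (theta : R) (k : nat) : R * R :=
  match k with
  | O => (1, theta)
  | S k' => let (x, y) := cfDD theta k' in (y, x - IZR (Int_part (x / y)) * y)
  end.

Definition cfD (theta : R) (k : nat) : R := fst (cfDD theta k).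

Definition cfa (theta : R) (k : nat) : nat :=
  Z.to_nat (Int_part (fst (cfDD theta k) / snd (cfDD theta k))).

Fixpoint cfQQ (theta : R) (k : nat) : nat * nat :=
  match k with
  | O => (0, 1)%nat
  | S k' => let (x, y) := cfQQ theta k' in (y, cfa theta k' * y + x)%nat
  end.

Definition cfQ (theta : R) (k : nat) : nat := fst (cfQQ theta k).

Fixpoint cfPP (theta : R) (k : nat) : Z * Z :=
  match k with
  | O => (1, 0)%Z
  | S k' => let (x, y) := cfPP theta k' in (y, Z.of_nat (cfa theta k') * y + x)%Z
  end.

Definition cfP (theta : R) (k : nat) : Z := fst (cfPP theta k).

Lemma cfQ_rec theta k : cfQ theta (S (S k)) = (cfa theta k * cfQ theta (S k) + cfQ theta k)%nat.
Proof. unfold cfQ. simpl. now destruct (cfQQ theta k). Qed.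

Lemma cfP_rec theta k :
  cfP theta (S (S k)) = (Z.of_nat (cfa theta k) * cfP theta (S k) + cfP theta k)%Z.
Proof. unfold cfP. simpl. now destruct (cfPP theta k). Qed.

Lemma cfD_snd theta k : snd (cfDD theta k) = cfD theta (S k).
Proof. unfold cfD. simpl. now destruct (cfDD theta k). Qed.

Lemma cf_det theta k :
  (cfP theta k * Z.of_nat (cfQ theta (S k)) - cfP theta (S k) * Z.of_nat (cfQ theta k) = (-1) ^ Z.of_nat k)%Z.
Proof.
  induction k as [| k IH]; [reflexivity |].
  rewrite cfQ_rec, cfP_rec, Nat2Z.inj_succ, Z.pow_succ_r, <- IH by lia. lia.
Qed.

Lemma sign_square (k : nat) : ((-1) ^ Z.of_nat k * (-1) ^ Z.of_nat k = 1)%Z.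
Proof.
  rewrite <- Z.pow_add_r by lia. replace (Z.of_nat k + Z.of_nat k)%Z with (2 * Z.of_nat k)%Z by lia.
  rewrite Z.pow_mul_r by lia. apply Z.pow_1_l. lia.
Qed.

Lemma pow_m1_cases (k : nat) : (-1) ^ k = 1 \/ (-1) ^ k = -1.
Proof. induction k as [| k [IH | IH]]; simpl; rewrite ?IH; lra. Qed.

Lemma Rabs_pow_m1 (k : nat) (x : R) : Rabs ((-1) ^ k * x) = Rabs x.
Proof. rewrite Rabs_mult. destruct (pow_m1_cases k) as [-> | ->]; unfold Rabs at 1; destruct (Rcase_abs _); lra. Qed.

Class irrational01 (theta : R) : Prop :=
  { irrational01_unit : 0 < theta < 1; irrational01_irr : irrational theta }.

Section ContinuedFraction.

Context {theta : R} {Hth : irrational01 theta}.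

Notation D := (cfD theta).
Notation Q := (cfQ theta).
Notation qR k := (INR (cfQ theta (S k))).
Notation P := (cfP theta).
Notation a := (cfa theta).

(** The Euclidean step keeps the remainders decreasing, and irrationality keeps them positive: a
    zero remainder would make a positive multiple of [theta] an integer. The items are proved
    together because the natural number [cfa theta k] is the intended floor only once the remainders
    are positive. *)
Lemma cf_invariant (k : nat) :
  0 < D (S k) < D k /\ (1 <= Q (S k))%nat /\
  INR (Q k) * theta - IZR (P k) = - (-1) ^ k * D k /\
  (qR k) * theta - IZR (P (S k)) = (-1) ^ k * D (S k).
Proof.
  induction k as [| k (h1 & h2 & h3 & h4)].
  - unfold cfD, cfQ, cfP. simpl. pose proof irrational01_unit. repeat split; try lra. lia.
  - assert (hfl : IZR (Int_part (D k / D (S k))) = INR (a k) /\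
                  0 <= D k - INR (a k) * D (S k) < D (S k)).
    { destruct (base_Int_part (D k / D (S k))) as [h5 h6].
      assert (h7 : 1 < D k / D (S k)).
      { apply Rmult_lt_reg_r with (D (S k)); [lra |].
        unfold Rdiv. rewrite Rmult_assoc, Rinv_l; lra. }
      assert (h8 : (0 <= Int_part (D k / D (S k)))%Z).
      { assert (-1 < Int_part (D k / D (S k)))%Z; [apply lt_IZR; simpl; lra | lia]. }
      assert (h9 : IZR (Int_part (D k / D (S k))) = INR (a k)).
      { unfold cfa. rewrite cfD_snd. fold (D k). rewrite INR_IZR_INZ, Z2Nat.id by exact h8. reflexivity. }
      split; [exact h9 |]. rewrite <- h9.
      assert (h10 : D k = D k / D (S k) * D (S k)) by (field; lra).
      split; nra. }
    destruct hfl as [hfl1 hfl2].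
    assert (hD : D (S (S k)) = D k - INR (a k) * D (S k)).
    { rewrite <- hfl1. rewrite <- cfD_snd. simpl.
      rewrite <- (cfD_snd theta k). unfold cfD. now destruct (cfDD theta k). }
    assert (ha : (1 <= a k)%nat).
    { destruct (a k) as [| n] eqn:e; [| lia]. simpl in hfl2. lra. }
    assert (hq : (1 <= Q (S (S k)))%nat).
    { rewrite cfQ_rec. nia. }
    assert (h5 : (qR (S k)) * theta - IZR (P (S (S k))) = (-1) ^ (S k) * D (S (S k))).
    { rewrite cfQ_rec, cfP_rec, plus_INR, mult_INR, plus_IZR, mult_IZR, <- INR_IZR_INZ, hD.
      replace ((INR (a k) * qR k + INR (Q k)) * theta - (INR (a k) * IZR (P (S k)) + IZR (P k)))
        with (INR (a k) * ((qR k) * theta - IZR (P (S k))) + (INR (Q k) * theta - IZR (P k))) by ring.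
      rewrite h3, h4. simpl. ring. }
    repeat split; try lra; try exact hq; try exact h5.
    + assert (hne : D (S (S k)) <> 0); [| lra].
      intros he. pose proof (distZ_irrational_pos theta (Q (S (S k))) irrational01_irr hq) as h6.
      rewrite he, Rmult_0_r in h5.
      pose proof (distZ_le_Rabs ((qR (S k)) * theta) (P (S (S k)))) as h7.
      rewrite h5, Rabs_R0 in h7. lra.
    + rewrite h4. simpl. ring.
Qed.

Lemma cfD_pos k : 0 < D k.
Proof. pose proof (cf_invariant k). lra. Qed.

Lemma cfD_decr k : D (S k) < D k.
Proof. pose proof (cf_invariant k). lra. Qed.

Lemma cfQ_pos k : (1 <= Q (S k))%nat.
Proof. apply cf_invariant. Qed.

Lemma cfQ_ge1 k : 1 <= qR k.
Proof. apply (le_INR 1), cfQ_pos. Qed.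

Lemma cfQ_theta k : (qR k) * theta = IZR (P (S k)) + (-1) ^ k * D (S k).
Proof. pose proof (cf_invariant k). lra. Qed.

Lemma cfD_rec k : D k = INR (a k) * D (S k) + D (S (S k)).
Proof.
  assert (hp : 0 < D (S k)) by apply cfD_pos.
  pose proof (cfQ_theta (S k)) as h1. pose proof (cfQ_theta k) as h2.
  pose proof (cf_invariant k) as (_ & _ & h3 & _).
  rewrite cfQ_rec, cfP_rec, plus_INR, mult_INR, plus_IZR, mult_IZR, <- INR_IZR_INZ in h1.
  simpl pow in h1. destruct (pow_m1_cases k) as [e | e]; rewrite e in *; nra.
Qed.

Lemma cfa_pos k : (1 <= a k)%nat.
Proof.
  pose proof (cfD_rec k) as h. pose proof (cfD_decr k). pose proof (cfD_decr (S k)).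
  destruct (a k); [simpl in h; lra | lia].
Qed.

Lemma cfQ_mono_S k : (Q k <= Q (S k))%nat.
Proof.
  destruct k; [unfold cfQ; simpl; lia |].
  rewrite cfQ_rec. pose proof (cfa_pos k). nia.
Qed.

Lemma cfQ_mono k l : (k <= l)%nat -> (Q k <= Q l)%nat.
Proof. induction 1 as [| l _ IH]; [lia | pose proof (cfQ_mono_S l); lia]. Qed.

Lemma cfQ_ge k : (k <= Q (S k))%nat.
Proof.
  induction k as [| k IH]; [lia |].
  rewrite cfQ_rec. pose proof (cfa_pos k). destruct k.
  - unfold cfQ at 1 2. simpl. nia.
  - pose proof (cfQ_pos k). nia.
Qed.

(** The recursions for denominators and for remainders are adjoint, so this pairing is preserved.
    With monotonicity it makes [q_k d_(k-1)] lie between 1/2 and 1. *)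
Lemma cfQ_D k : (qR k) * D k + INR (Q k) * D (S k) = 1.
Proof.
  induction k as [| k IH].
  - unfold cfQ, cfD. simpl. ring.
  - rewrite cfQ_rec, plus_INR, mult_INR. rewrite (cfD_rec k) in IH. nra.
Qed.

Lemma cfQ_D_le1 k : (qR k) * D k <= 1.
Proof. pose proof (cfQ_D k). pose proof (pos_INR (Q k)). pose proof (cfD_pos (S k)). nra. Qed.

Lemma cfQ_D_ge_half k : 1 <= 2 * ((qR k) * D k).
Proof.
  pose proof (cfQ_D k) as h. pose proof (cfD_decr k). pose proof (cfD_pos (S k)).
  pose proof (le_INR _ _ (cfQ_mono_S k)). pose proof (pos_INR (Q k)). nra.
Qed.

(** In the unimodular basis of two consecutive convergents, [(n, p)] has integer coordinates
    [(x, y)]. The bound on [n] forces [x] to be nonzero and [y] to be zero or of the opposite sign;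
    since consecutive errors have opposite signs too, the two contributions add up instead of
    cancelling. *)
Lemma cf_best k n : (0 < n < Q (S k))%nat -> D k <= distZ (INR n * theta).
Proof.
  intros hn. destruct (distZ_attained (INR n * theta)) as [p ->].
  pose proof (cf_invariant k) as (hD & _ & h3 & h4).
  pose proof (cf_det theta k) as hdet.
  set (e := ((-1) ^ Z.of_nat k)%Z) in *.
  assert (he : (e * e = 1)%Z) by apply sign_square.
  (* Cramer's rule, the determinant [e] being its own inverse. *)
  set (x := (e * (p * Z.of_nat (Q (S k)) - Z.of_nat n * P (S k)))%Z).
  set (y := (e * (Z.of_nat n * P k - p * Z.of_nat (Q k)))%Z).
  assert (hn' : Z.of_nat n = (x * Z.of_nat (Q k) + y * Z.of_nat (Q (S k)))%Z).
  { transitivity (e * e * Z.of_nat n)%Z; [rewrite he; ring |]. unfold x, y. rewrite <- hdet at 2. ring. }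
  assert (hp : p = (x * P k + y * P (S k))%Z).
  { transitivity (e * e * p)%Z; [rewrite he; ring |]. unfold x, y. rewrite <- hdet at 2. ring. }
  assert (hnp : INR n * theta - IZR p = (-1) ^ k * (IZR y * D (S k) - IZR x * D k)).
  { rewrite INR_IZR_INZ, hn', hp at 1. rewrite !plus_IZR, !mult_IZR, <- !INR_IZR_INZ.
    replace ((IZR x * INR (Q k) + IZR y * qR k) * theta - (IZR x * IZR (P k) + IZR y * IZR (P (S k))))
      with (IZR x * (INR (Q k) * theta - IZR (P k)) + IZR y * ((qR k) * theta - IZR (P (S k)))) by ring.
    rewrite h3, h4. ring. }
  rewrite hnp, Rabs_pow_m1.
  assert (hx : (y < 0 -> 1 <= x)%Z /\ (y = 0 -> 1 <= x)%Z /\ (0 < y -> x <= -1)%Z).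
  { assert (hb : (0 < Z.of_nat n < Z.of_nat (Q (S k)))%Z) by lia.
    pose proof (Nat2Z.is_nonneg (Q k)) as hA.
    clear - hn' hb hA. clearbody x y.
    generalize dependent (Z.of_nat (Q k)). generalize dependent (Z.of_nat (Q (S k))).
    generalize dependent (Z.of_nat n). intros m B hB A hA' hm.
    assert (h1 : (x <= 0 -> x * A <= 0)%Z) by (intros; apply Z.mul_nonpos_nonneg; lia).
    assert (h2 : (0 <= x -> 0 <= x * A)%Z) by (intros; apply Z.mul_nonneg_nonneg; lia).
    assert (h3 : (y < 0 -> y * B <= 0)%Z) by (intros; apply Z.mul_nonpos_nonneg; lia).
    assert (h4 : (1 <= y -> B <= y * B)%Z).
    { intros h. apply (Z.mul_le_mono_nonneg_r _ _ B) in h; lia. }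
    repeat split; intros h; destruct (Z_le_gt_dec 1 x); destruct (Z_le_gt_dec 0 x); try lia; subst; lia. }
  destruct hx as (hx1 & hx2 & hx3).
  destruct (Z.lt_trichotomy y 0) as [hy | [hy | hy]].
  - assert (hx := IZR_le _ _ (hx1 hy)). apply IZR_lt in hy.
    rewrite Rabs_left1; nra.
  - assert (hx := IZR_le _ _ (hx2 hy)). rewrite hy.
    rewrite Rabs_left1; nra.
  - assert (hx := IZR_le _ _ (hx3 hy)). apply IZR_lt in hy.
    rewrite Rabs_right; nra.
Qed.

Lemma cf_separated k n n' : (1 <= n <= Q (S k))%nat -> (1 <= n' <= Q (S k))%nat -> n <> n' ->
  D k <= distZ (INR n * theta - INR n' * theta).
Proof.
  intros h h' hne. destruct (Nat.lt_ge_cases n n') as [hlt | hge].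
  - rewrite distZ_sym.
    replace (INR n' * theta - INR n * theta) with (INR (n' - n) * theta) by (rewrite minus_INR by lia; ring).
    apply cf_best. lia.
  - replace (INR n * theta - INR n' * theta) with (INR (n - n') * theta) by (rewrite minus_INR by lia; ring).
    apply cf_best. lia.
Qed.

Lemma cf_locate (k0 : nat) (Y : R) : (qR k0) <= Y ->
  exists k, (k0 <= k)%nat /\ (qR k) <= Y < qR (S k).
Proof.
  intros h. destruct (exists_nat_gt Y) as [n hn].
  assert (hstep : forall j, (qR (k0 + j)) <= Y \/
    exists k, (k0 <= k)%nat /\ (qR k) <= Y < qR (S k)).
  { induction j as [| j [IH | IH]].
    - left. now rewrite Nat.add_0_r.
    - destruct (Rle_dec (qR (k0 + S j)) Y) as [h1 | h1]; [now left |].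
      right. exists (k0 + j)%nat. split; [lia |]. rewrite Nat.add_succ_r in h1. lra.
    - now right. }
  destruct (hstep n) as [h1 | h1]; [| exact h1].
  exfalso. pose proof (le_INR _ _ (cfQ_ge (k0 + n))) as h2. rewrite plus_INR in h2.
  pose proof (pos_INR k0). lra.
Qed.

Lemma cf_distZ k : distZ ((qR k) * theta) <= D (S k).
Proof.
  rewrite cfQ_theta, Rplus_comm, distZ_addZ.
  eapply Rle_trans; [apply distZ_le_abs |]. rewrite Rabs_pow_m1.
  pose proof (cfD_pos (S k)). rewrite Rabs_right; lra.
Qed.

End ContinuedFraction.

(** * Lower bounds for Hausdorff dimension *)

Definition Rleb (x y : R) : bool := if Rle_dec x y then true else false.

Lemma Rleb_true x y : Rleb x y = true <-> x <= y.
Proof. unfold Rleb. destruct (Rle_dec x y); split; auto; try easy. Qed.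

Lemma length_le_sum_filter {A : Type} (b : nat -> A -> bool) (J : nat) (L : list A) :
  (forall p, In p L -> exists i, (i <= J)%nat /\ b i p = true) ->
  INR (length L) <= sum_f_R0 (fun i => INR (length (filter (b i) L))) J.
Proof.
  induction L as [| p L IH]; intros h.
  - simpl. rewrite sum_cte. lra.
  - rewrite (sum_eq _ (fun i => (if b i p then 1 else 0) + INR (length (filter (b i) L)))).
    2:{ intros i _. simpl filter. destruct (b i p); [| ring].
        simpl length. rewrite S_INR. ring. }
    rewrite sum_plus. change (length (p :: L)) with (S (length L)). rewrite S_INR, Rplus_comm.
    apply Rplus_le_compat.
    + destruct (h p (or_introl eq_refl)) as [i [hi hb]].
      clear - hi hb. induction J as [| J IH].
      * replace i with 0%nat in hb by lia. simpl. rewrite hb. lra.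
      * simpl. assert (hnn : forall n, 0 <= sum_f_R0 (fun i => if b i p then 1 else 0) n).
        { intros n. apply cond_pos_sum. intros k. destruct (b k p); lra. }
        destruct (Nat.eq_dec i (S J)) as [-> | hne].
        -- rewrite hb. specialize (hnn J). lra.
        -- assert (1 <= sum_f_R0 (fun i => if b i p then 1 else 0) J) by (apply IH; lia).
           destruct (b (S J) p); lra.
    + apply IH. intros q hq. apply h. now right.
Qed.

Lemma finite_positive_min (r : nat -> R) (J : nat) : (forall i, 0 < r i) ->
  exists m, 0 < m /\ forall i, (i <= J)%nat -> m <= r i.
Proof.
  intros hr. induction J as [| J [m [h1 h2]]].
  - exists (r 0%nat). split; [apply hr |]. intros i hi. replace i with 0%nat by lia. lra.
  - exists (Rmin m (r (S J))). split; [now apply Rmin_glb_lt |].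
    intros i hi. destruct (Nat.eq_dec i (S J)) as [-> | hne]; [apply Rmin_r |].
    eapply Rle_trans; [apply Rmin_l |]. apply h2. lia.
Qed.

(* By compactness finitely many enlarged sets of the cover suffice; a finite stage of the uniform
   distribution finer than all of them then has total mass less than one. *)
Lemma not_null_of_uniform_points (s C : R) (E : R -> Prop) (pts : nat -> list R) (rho : nat -> R) :
  0 < s -> 0 < C ->
  (forall x, (forall eps, 0 < eps -> exists y, E y /\ Rabs (y - x) < eps) -> E x) ->
  (forall x, E x -> 0 <= x <= 1) ->
  (forall n p, In p (pts n) -> E p) ->
  (forall n, (1 <= length (pts n))%nat) ->
  (forall eps, 0 < eps -> exists n, rho n < eps) ->
  (forall n x r, 0 < r -> rho n <= r ->
     INR (length (filter (fun p => Rleb (Rabs (p - x)) r) (pts n)))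
       <= C * INR (length (pts n)) * Rpower r s) ->
  ~ hausdorff_null s E.
Proof.
  intros hs hC hclosed h01 hE hlen hrho hcount hnull.
  pose proof (Rpower_pos 2 s) as h2s.
  (* Chosen so that the total mass comes out as at most [C (2^s + 1) e0 = 1/2]. *)
  set (e0 := / (2 * C * (Rpower 2 s + 1))).
  assert (he0 : 0 < e0) by (apply Rinv_0_lt_compat; nra).
  destruct (hnull 1 e0) as (U & r & hr & hU & hcov & hsum); [lra | exact he0 |].
  assert (Hf : forall i, exists c, forall y, U i y -> Rabs (y - c) <= r i).
  { intros i. destruct (classic (exists c, U i c)) as [[c hc] | hn].
    - exists c. intros y hy. exact (hU i y c hy hc).
    - exists 0. intros y hy. exfalso. apply hn. now exists y. }
  apply choice in Hf. destruct Hf as [f hf].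
  (* These radii have [s]-th powers of sum at most [e0]. They make the enlarged radius strictly
     larger than [r i] even when [r i = 0], which gives the open margin that compactness needs. *)
  set (ei := fun i : nat => Rpower (e0 * (/ 2) ^ (S i)) (/ s)).
  assert (hei : forall i, 0 < ei i) by (intros; apply Rpower_pos).
  set (r' := fun i => Rmax (2 * r i) (ei i)).
  assert (hr'0 : forall i, 0 < r' i).
  { intros i. eapply Rlt_le_trans; [apply hei | apply Rmax_r]. }
  assert (hrr' : forall i, r i < r' i).
  { intros i. specialize (hei i).
    pose proof (Rmax_l (2 * r i) (ei i)). pose proof (Rmax_r (2 * r i) (ei i)). unfold r'. lra. }
  assert (hpow : forall i, 0 < e0 * (/ 2) ^ S i).
  { intros i. apply Rmult_lt_0_compat; [exact he0 | apply pow_lt; lra]. }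
  assert (hr's : forall i, Rpower (r' i) s <= Rpower 2 s * rpow (r i) s + e0 * (/ 2) ^ (S i)).
  { intros i. unfold r'. destruct (Rle_dec (2 * r i) (ei i)) as [h | h].
    - rewrite Rmax_right by exact h. unfold ei. rewrite Rpower_mult.
      replace (/ s * s) with 1 by (field; lra).
      rewrite Rpower_1 by apply hpow. pose proof (rpow_ge0 (r i) s). nra.
    - specialize (hei i). rewrite Rmax_left by lra. rewrite rpow_pos by lra.
      rewrite Rpower_mult_distr by lra. specialize (hpow i). lra. }
  (* Otherwise choose for each [J] a point of [E] outside the first [J + 1] enlarged sets. These
     points accumulate at a point of the closed set [E], which lies in some [U i], so late ones
     enter the enlargement of index [i]. *)
  assert (HJ : exists J : nat, forall x, E x -> exists i, (i <= J)%nat /\ Rabs (x - f i) <= r' i).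
  { apply NNPP. intros hno.
    assert (Hun : forall J, exists x, E x /\ forall i, (i <= J)%nat -> r' i < Rabs (x - f i)).
    { intros J. apply NNPP. intros hno'. apply hno. exists J. intros x hx.
      apply NNPP. intros hno''. apply hno'. exists x. split; [exact hx |].
      intros i hi. apply Rnot_le_lt. intros hle. apply hno''. now exists i. }
    apply choice in Hun. destruct Hun as [un hun].
    destruct (Bolzano_Weierstrass un _ (compact_P3 0 1)) as [l hl].
    { intros n. apply h01, hun. }
    assert (hEl : E l).
    { apply hclosed. intros eps he.
      destruct (hl (disc l (mkposreal eps he)) 0%nat) as [p [_ hp]].
      { exists (mkposreal eps he). intros x hx. exact hx. }
      exists (un p). split; [apply hun | exact hp]. }
    destruct (hcov l hEl) as [i hi]. specialize (hf i l hi).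
    assert (hd : 0 < r' i - r i) by (specialize (hrr' i); lra).
    destruct (hl (disc l (mkposreal _ hd)) i) as [p [hp1 hp2]].
    { exists (mkposreal _ hd). intros x hx. exact hx. }
    unfold disc in hp2. simpl in hp2.
    destruct (hun p) as [_ hp3]. specialize (hp3 i hp1).
    assert (h : Rabs (un p - f i) <= Rabs (un p - l) + Rabs (l - f i)); [| lra].
    replace (un p - f i) with ((un p - l) + (l - f i)) by ring. apply Rabs_triang. }
  destruct HJ as [J hJ].
  destruct (finite_positive_min r' J hr'0) as [m [hm1 hm2]].
  destruct (hrho m hm1) as [n hn].
  assert (h1 := length_le_sum_filter (fun i p => Rleb (Rabs (p - f i)) (r' i)) J (pts n)).
  assert (hlen' : 1 <= INR (length (pts n))) by (apply (le_INR 1), hlen).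
  assert (h2 : INR (length (pts n)) <= sum_f_R0 (fun i => C * INR (length (pts n)) *
      (Rpower 2 s * rpow (r i) s + e0 * (/ 2) ^ (S i))) J).
  { eapply Rle_trans; [apply h1 |].
    - intros p hp. destruct (hJ p (hE n p hp)) as [i [hi1 hi2]]. exists i. split; [exact hi1 |].
      now apply Rleb_true.
    - apply sum_Rle. intros i hi. eapply Rle_trans; [apply hcount |].
      + apply hr'0.
      + specialize (hm2 i hi). lra.
      + apply Rmult_le_compat_l; [nra | apply hr's]. }
  assert (h3 : sum_f_R0 (fun i => C * INR (length (pts n)) *
      (Rpower 2 s * rpow (r i) s + e0 * (/ 2) ^ (S i))) J
    = C * INR (length (pts n)) * (Rpower 2 s * sum_f_R0 (fun i => rpow (r i) s) J
        + e0 * (1 - (/ 2) ^ (S J)))).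
  { clear. induction J as [| J IH].
    - simpl. field.
    - rewrite !tech5, IH. simpl. field. }
  rewrite h3 in h2. specialize (hsum J).
  assert (h4 : 0 < (/ 2) ^ S J) by (apply pow_lt; lra).
  assert (h5 : Rpower 2 s * sum_f_R0 (fun i => rpow (r i) s) J + e0 * (1 - (/ 2) ^ (S J))
               <= (Rpower 2 s + 1) * e0) by nra.
  assert (h6 : C * ((Rpower 2 s + 1) * e0) = / 2) by (unfold e0; field; lra).
  assert (h7 : C * (Rpower 2 s * sum_f_R0 (fun i => rpow (r i) s) J + e0 * (1 - (/ 2) ^ (S J))) <= / 2).
  { apply Rle_trans with (C * ((Rpower 2 s + 1) * e0)); [apply Rmult_le_compat_l; lra | lra]. }
  nra.
Qed.

(** Closing up inside [[0,1]] can add the endpoint 1, which is not a fractional part. *)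
Lemma hausdorff_null_add_point (s : R) (E : R -> Prop) (p : R) : 0 < s ->
  hausdorff_null s E -> hausdorff_null s (fun x => E x \/ x = p).
Proof.
  intros hs hE delta eps hd he. destruct (hE delta eps hd he) as (U & r & h1 & h2 & h3 & h4).
  exists (fun i x => match i with O => x = p | S j => U j x end).
  exists (fun i => match i with O => 0 | S j => r j end).
  split; [| split; [| split]].
  - intros [| i]; [lra | apply h1].
  - intros [| i] x y; [| apply h2]. intros -> ->. rewrite Rminus_diag, Rabs_R0. lra.
  - intros x [hx | hx]; [| now exists 0%nat].
    destruct (h3 x hx) as [i hi]. now exists (S i).
  - assert (h0 : rpow 0 s = 0) by (unfold rpow; destruct (Rle_dec 0 0); lra).
    intros [| n]; [simpl; lra |].
    rewrite decomp_sum by lia. simpl pred. rewrite h0, Rplus_0_l. apply h4.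
Qed.

(** A closed variant of the uniform condition, as compactness requires: integer scales and a weak
    inequality. The strict [n < m] pays for the weak inequality when returning to real [Q]. *)
Definition closed_uniform_set (tau theta : R) (m0 : nat) (y : R) : Prop :=
  0 <= y <= 1 /\ forall m, (m0 < m)%nat ->
    exists n, (1 <= n < m)%nat /\ distZ (INR n * theta - y) <= Rpower (INR m) (- tau).

(** For a given [m] only finitely many [n] compete, so if all of them fail at [x] they fail by a
    common positive margin, hence also near [x]. *)
Lemma closed_uniform_set_closed tau theta m0 x :
  (forall eps, 0 < eps -> exists y, closed_uniform_set tau theta m0 y /\ Rabs (y - x) < eps) ->
  closed_uniform_set tau theta m0 x.
Proof.
  intros h. split.
  - split; apply le_epsilon; intros eps he; destruct (h eps he) as [y [[hy _] hyx]];
      apply Rabs_def2 in hyx; lra.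
  - intros m hm. apply NNPP. intros hno.
    set (g := fun n => if Rlt_dec (Rpower (INR m) (- tau)) (distZ (INR n * theta - x))
                       then distZ (INR n * theta - x) - Rpower (INR m) (- tau) else 1).
    destruct (finite_positive_min g m) as [eta [h1 h2]].
    { intros i. unfold g. destruct (Rlt_dec _ _); lra. }
    destruct (h eta h1) as [y [[_ hy] hyx]].
    destruct (hy m hm) as [n [hn hn']]. specialize (h2 n ltac:(lia)). unfold g in h2.
    destruct (Rlt_dec _ _) as [hlt | hge].
    + pose proof (distZ_triang (INR n * theta) y x) as h3.
      pose proof (distZ_le_abs (y - x)). lra.
    + apply hno. exists n. split; [exact hn | lra].
Qed.

(** Apply the closed condition at [m = floor Q + 1]: then [n < m] means [n <= Q], and [m > Q] makes
    the inequality strict. *)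
Lemma closed_uniform_set_subset tau theta m0 y : 0 < tau ->
  closed_uniform_set tau theta m0 y -> U_set tau theta y \/ y = 1.
Proof.
  intros ht [h01 h]. destruct (Req_dec y 1) as [-> | hne]; [now right | left].
  split; [lra |]. exists (INR m0 + 1). intros Q hQ.
  pose proof (pos_INR m0) as hm0.
  destruct (nat_floor Q) as [k [hk1 hk2]]; [lra |].
  destruct (h (S k)) as [n [hn1 hn2]].
  { apply INR_lt. rewrite S_INR. lra. }
  exists n. split; [lia |]. split.
  - eapply Rle_trans; [apply le_INR | exact hk1]. lia.
  - eapply Rle_lt_trans; [exact hn2 |]. rewrite !Rpower_Ropp.
    apply Rinv_lt_contravar; [apply Rmult_lt_0_compat; apply Rpower_pos |].
    apply Rlt_Rpower_l; [exact ht |]. rewrite S_INR. lra.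
Qed.

(** * Trees of finite sums and their uniform distributions *)

Fixpoint offsets (inc : nat -> list nat) (i j : nat) : list nat :=
  match j with
  | O => 0%nat :: nil
  | S j' => flat_map (fun c => map (Nat.add c) (offsets inc (S i) j')) (inc i)
  end.

Lemma in_offsets_S inc i j c : In c (offsets inc i (S j)) <->
  exists c1 c2, In c1 (inc i) /\ In c2 (offsets inc (S i) j) /\ c = (c1 + c2)%nat.
Proof.
  simpl. rewrite in_flat_map. split.
  - intros [c1 [h1 h2]]. apply in_map_iff in h2. destruct h2 as [c2 [h2 h3]].
    exists c1, c2. auto.
  - intros (c1 & c2 & h1 & h2 & ->). exists c1. split; [exact h1 |].
    apply in_map_iff. now exists c2.
Qed.

Lemma map_add_flat_map (c : nat) (O L : list nat) :
  map (Nat.add c) (flat_map (fun b => map (Nat.add b) O) L)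
    = flat_map (fun b => map (Nat.add b) O) (map (Nat.add c) L).
Proof.
  induction L as [| b L IH]; [reflexivity |].
  simpl. rewrite map_app, IH, map_map. f_equal. apply map_ext. intros x. lia.
Qed.

Lemma offsets_add inc i j k : offsets inc i (j + k) =
  flat_map (fun c => map (Nat.add c) (offsets inc (i + j) k)) (offsets inc i j).
Proof.
  revert i. induction j as [| j IH]; intros i.
  - simpl. rewrite app_nil_r, Nat.add_0_r. symmetry. apply map_id.
  - simpl. rewrite IH. replace (S i + j)%nat with (i + S j)%nat by lia.
    set (O := offsets inc (i + S j) k).
    induction (inc i) as [| c L IHL]; [reflexivity |].
    simpl. rewrite flat_map_app, IHL, map_add_flat_map. reflexivity.
Qed.

Lemma length_flat_map_const {A B : Type} (f : A -> list B) (K : nat) (L : list A) :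
  (forall x, length (f x) = K) -> length (flat_map f L) = (length L * K)%nat.
Proof. intros h. induction L as [| x L IH]; [reflexivity |]. simpl. rewrite length_app, h, IH. reflexivity. Qed.

Lemma length_offsets_add inc i j k :
  length (offsets inc i (j + k)) = (length (offsets inc i j) * length (offsets inc (i + j) k))%nat.
Proof. rewrite offsets_add. apply length_flat_map_const. intros c. apply length_map. Qed.

Lemma length_offsets_1 inc i : length (offsets inc i 1) = length (inc i).
Proof. simpl. rewrite (length_flat_map_const _ 1); [lia |]. reflexivity. Qed.

Lemma length_offsets_pos inc i j : (forall i, (1 <= length (inc i))%nat) ->
  (1 <= length (offsets inc i j))%nat.
Proof.
  intros h. revert i. induction j as [| j IH]; intros i; [simpl; lia |].
  change (S j) with (1 + j)%nat. rewrite length_offsets_add, length_offsets_1.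
  specialize (h i). specialize (IH (i + 1)%nat). nia.
Qed.

Lemma NoDup_sums (L O : list nat) : NoDup L -> NoDup O ->
  (forall c c' b b', In c L -> In c' L -> In b O -> In b' O -> (c + b = c' + b')%nat -> c = c') ->
  NoDup (flat_map (fun c => map (Nat.add c) O) L).
Proof.
  intros hL hO h. induction hL as [| c L hc hL IH]; [constructor |].
  simpl. apply NoDup_app.
  - apply Injective_map_NoDup; [| exact hO]. intros x y hxy. lia.
  - apply IH. intros c1 c2 b b' h1 h2 h3 h4 h5. apply (h c1 c2 b b'); simpl; auto.
  - intros x hx hx'. apply in_map_iff in hx. destruct hx as [b [hb1 hb2]].
    apply in_flat_map in hx'. destruct hx' as [c' [hc' hx']].
    apply in_map_iff in hx'. destruct hx' as [b' [hb1' hb2']].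
    apply hc. replace c with c'; [exact hc' |]. symmetry.
    apply (h c c' b b'); simpl; auto. lia.
Qed.

Lemma NoDup_offsets inc i : (forall i, NoDup (inc i)) ->
  (forall i c c' b b', In c (offsets inc 0 i) -> In c' (offsets inc 0 i) ->
     In b (inc i) -> In b' (inc i) -> (c + b = c' + b')%nat -> c = c') ->
  NoDup (offsets inc 0 i).
Proof.
  intros h1 h2. induction i as [| i IH].
  - simpl. constructor; [easy | constructor].
  - replace (S i) with (i + 1)%nat by lia. rewrite offsets_add.
    assert (h3 : forall b, In b (offsets inc (0 + i) 1) -> In b (inc i)).
    { intros b hb. apply in_offsets_S in hb. destruct hb as (c1 & c2 & hb1 & hb2 & ->).
      simpl in hb2. destruct hb2 as [<- | []]. now rewrite Nat.add_0_r. }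
    assert (h4 : NoDup (offsets inc (0 + i) 1)).
    { simpl. specialize (h1 i). revert h1. clear. intros h. induction h as [| x l hx hl IH]; [constructor |].
      simpl. constructor; [| exact IH]. intros hin. apply hx. apply in_flat_map in hin.
      destruct hin as [y [hy1 hy2]]. simpl in hy2. destruct hy2 as [hy2 | []].
      replace x with y by lia. exact hy1. }
    apply NoDup_sums; [exact IH | exact h4 |].
    intros c c' b b' hc hc' hb hb'. apply (h2 i); auto.
Qed.

(** Used to count the leaves near a point through their ancestors near it, each ancestor having the
    same number [K] of descendants. *)
Lemma filter_flat_map_le {A B : Type} (f : A -> list B) (K : nat) (P : A -> bool) (P' : B -> bool) (L : list A) :
  (forall x, length (f x) = K) ->
  (forall x y, In x L -> In y (f x) -> P' y = true -> P x = true) ->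
  (length (filter P' (flat_map f L)) <= length (filter P L) * K)%nat.
Proof.
  intros hK h. induction L as [| x L IH]; [simpl; lia |].
  simpl. rewrite filter_app, length_app.
  assert (h1 : (length (filter P' (flat_map f L)) <= length (filter P L) * K)%nat).
  { apply IH. intros z y hz hy hy'. apply (h z y); simpl; auto. }
  destruct (P x) eqn:e.
  - simpl. pose proof (filter_length_le P' (f x)). rewrite hK in H. lia.
  - assert (h2 : filter P' (f x) = nil).
    { destruct (filter P' (f x)) as [| y l] eqn:e'; [reflexivity |]. exfalso.
      assert (hy : In y (filter P' (f x))) by (rewrite e'; now left).
      apply filter_In in hy. rewrite (h x y) in e; [easy | now left | apply hy | apply hy]. }
    rewrite h2. simpl. exact h1.
Qed.

(** Signed displacements from [x] lie in an interval of length [2 rho]; cut it into cells of length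
    [delta / 2]. Two points in one cell would be closer than [delta]. *)
Lemma circle_packing (f : nat -> R) (L : list nat) (delta rho x : R) : 0 < delta -> 0 <= rho ->
  NoDup L -> (forall n n', In n L -> In n' L -> n <> n' -> delta <= distZ (f n - f n')) ->
  (forall n, In n L -> distZ (f n - x) <= rho) ->
  INR (length L) <= 4 * rho / delta + 1.
Proof.
  intros hd hr hL hsep hnear.
  assert (Hv : forall n, exists v, In n L -> Rabs v <= rho /\ exists k : Z, f n - x = v + IZR k).
  { intros n. destruct (distZ_attained (f n - x)) as [k hk].
    exists (f n - x - IZR k). intros hn. specialize (hnear n hn). split; [lra |].
    exists k. ring. }
  apply choice in Hv. destruct Hv as [v hv].
  set (g := fun n => (v n + rho) / (delta / 2)).
  assert (hg : forall n, In n L -> 0 <= g n <= 4 * rho / delta).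
  { intros n hn. destruct (hv n hn) as [h _].
    pose proof (Rle_abs (v n)). pose proof (Rle_abs (- v n)) as h'. rewrite Rabs_Ropp in h'.
    unfold g. split.
    - apply Rmult_le_pos; [lra | left; apply Rinv_0_lt_compat; lra].
    - replace (4 * rho / delta) with (2 * rho / (delta / 2)) by (field; lra).
      apply Rmult_le_compat_r; [left; apply Rinv_0_lt_compat; lra | lra]. }
  assert (Hc : forall n, exists c, In n L -> INR c <= g n < INR c + 1).
  { intros n. destruct (classic (In n L)) as [hn | hn].
    - destruct (nat_floor (g n)) as [c hc]; [now apply hg |]. now exists c.
    - now exists 0%nat. }
  apply choice in Hc. destruct Hc as [cell hcell].
  destruct (nat_floor (4 * rho / delta)) as [K [hK1 hK2]].
  { apply Rmult_le_pos; [lra | left; now apply Rinv_0_lt_compat]. }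
  assert (hnd : NoDup (map cell L)).
  { clear hK1 hK2 K hnear. induction hL as [| n L hn hL IH]; [constructor |].
    simpl. constructor.
    - intros hin. apply in_map_iff in hin. destruct hin as [n' [h1 h2]].
      assert (hne : n <> n') by (intros ->; contradiction).
      specialize (hsep n n' (or_introl eq_refl) (or_intror h2) hne).
      destruct (hcell n (or_introl eq_refl)) as [h3 h4].
      destruct (hcell n' (or_intror h2)) as [h5 h6]. rewrite h1 in h5, h6.
      destruct (hv n (or_introl eq_refl)) as [_ [k hk]].
      destruct (hv n' (or_intror h2)) as [_ [k' hk']].
      assert (h7 : distZ (f n - f n') <= Rabs (v n - v n')).
      { replace (f n - f n') with (v n - v n' + IZR (k - k')) by (rewrite minus_IZR; lra).
        rewrite distZ_addZ. apply distZ_le_abs. }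
      assert (h8 : v n - v n' = (g n - g n') * (delta / 2)) by (unfold g; field; lra).
      assert (h9 : Rabs (v n - v n') < delta); [| lra].
      rewrite h8. apply Rabs_def1; nra.
    - apply IH; intros; [apply hsep | apply hv | apply hg | apply hcell]; simpl; auto. }
  assert (hincl : incl (map cell L) (seq 0 (S K))).
  { intros c hc. apply in_map_iff in hc. destruct hc as [n [<- hn]].
    apply in_seq. specialize (hg n hn). destruct (hcell n hn) as [h1 _].
    assert (h2 : INR (cell n) < INR (S K)) by (rewrite S_INR; lra).
    apply INR_lt in h2. lia. }
  pose proof (NoDup_incl_length hnd hincl) as h. rewrite length_map, length_seq in h.
  apply le_INR in h. rewrite S_INR in h. lra.
Qed.

Lemma discrete_crossing (P : nat -> Prop) (n : nat) : ~ P 0%nat -> P n ->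
  exists i, (i < n)%nat /\ ~ P i /\ P (S i).
Proof.
  intros h0. induction n as [| n IH]; intros hn; [contradiction |].
  destruct (classic (P n)) as [h | h].
  - destruct (IH h) as [i [h1 h2]]. exists i. split; [lia | exact h2].
  - exists n. split; [lia | tauto].
Qed.

Lemma frac_part_eq (t : R) : frac_part t = t + IZR (- Int_part t).
Proof. unfold frac_part. rewrite opp_IZR. ring. Qed.

Lemma filter_map_length {A B : Type} (f : A -> B) (P : B -> bool) (L : list A) :
  length (filter P (map f L)) = length (filter (fun x => P (f x)) L).
Proof. induction L as [| x L IH]; [reflexivity |]. simpl. destruct (P (f x)); simpl; now rewrite IH. Qed.

Lemma in_offsets_split inc n c i : (i < n)%nat -> In c (offsets inc 0 n) ->
  exists c1 b rest, In c1 (offsets inc 0 i) /\ In b (inc i) /\ In rest (offsets inc (S i) (n - i - 1)) /\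
    c = (c1 + b + rest)%nat.
Proof.
  intros hi hc. replace n with (i + S (n - i - 1))%nat in hc by lia.
  rewrite offsets_add in hc. apply in_flat_map in hc. destruct hc as [c1 [h1 h2]].
  apply in_map_iff in h2. destruct h2 as [c2 [<- h2]].
  apply in_offsets_S in h2. destruct h2 as (b & rest & h3 & h4 & ->).
  exists c1, b, rest. repeat split; auto. lia.
Qed.

(* The tree of the sums [N0 + c_0 + ... + c_(n-1)], with stage [i] resolved at scale [1 / Qs i]:
   descendants of a node of stage [i] stay within [ell i] of it. *)
Theorem tree_not_null (theta tau s kap : R) (inc : nat -> list nat) (Qs : nat -> nat) (ell : nat -> R)
  (N0 : nat) :
  0 < tau -> 0 < s <= 1 -> 0 < kap ->
  (forall i, (1 <= length (inc i))%nat) -> (forall i, NoDup (inc i)) ->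
  (forall i c, In c (offsets inc 0 i) -> (1 <= N0 + c <= Qs i)%nat) ->
  (forall i n n', (1 <= n <= Qs i)%nat -> (1 <= n' <= Qs i)%nat -> n <> n' ->
     / (2 * INR (Qs i)) <= distZ (INR n * theta - INR n' * theta)) ->
  (forall i c c' b b', In c (offsets inc 0 i) -> In c' (offsets inc 0 i) ->
     In b (inc i) -> In b' (inc i) -> (c + b = c' + b')%nat -> c = c') ->
  (forall i j c, In c (offsets inc i j) -> distZ (INR c * theta) <= ell i) ->
  (forall i, 0 < ell i) ->
  (forall eps, 0 < eps -> exists n, ell n < eps) ->
  (forall i, kap <= INR (length (offsets inc 0 i)) * Rpower (ell i) s) ->
  (forall i, kap * INR (length (offsets inc 0 i)) * (ell i * INR (Qs (S i)))
             <= INR (length (offsets inc 0 (S i)))) ->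
  (forall i j c b rest m, In c (offsets inc 0 i) -> In b (inc i) -> In rest (offsets inc (S i) j) ->
     (Qs i < m <= Qs (S i))%nat ->
     exists n, (1 <= n < m)%nat /\
       distZ (INR n * theta - INR (N0 + c + b + rest) * theta) <= Rpower (INR m) (- tau)) ->
  ~ hausdorff_null s (U_set tau theta).
Proof.
  intros ht [hs0 hs1] hk hne hnd hnode hsep hinj htail hell hell0 hM1 hM2 hloc hnull.
  assert (hND : forall i, NoDup (offsets inc 0 i)) by (intros i; now apply NoDup_offsets).
  set (M := fun i => INR (length (offsets inc 0 i))).
  assert (hM : forall i, 1 <= M i).
  { intros i. apply (le_INR 1). now apply length_offsets_pos. }
  assert (hQ : forall i, 1 <= INR (Qs i)).
  { intros i. apply (le_INR 1). pose proof (length_offsets_pos inc 0 i hne) as h.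
    destruct (offsets inc 0 i) as [| c l] eqn:e; [simpl in h; lia |].
    specialize (hnode i c). rewrite e in hnode. specialize (hnode (or_introl eq_refl)). lia. }
  assert (hloc' : forall n c, In c (offsets inc 0 n) ->
    closed_uniform_set tau theta (Qs 0%nat) (frac_part (INR (N0 + c) * theta))).
  { intros n c hc. split.
    - pose proof (base_fp (INR (N0 + c) * theta)). lra.
    - intros m hm. rewrite frac_part_eq. set (z := (- Int_part (INR (N0 + c) * theta))%Z).
      assert (hz : forall k, distZ (INR k * theta - (INR (N0 + c) * theta + IZR z))
                             = distZ (INR k * theta - INR (N0 + c) * theta)).
      { intros k. rewrite <- (distZ_addZ (INR k * theta - INR (N0 + c) * theta) (- z)), opp_IZR.
        f_equal. ring. }
      destruct (Nat.lt_ge_cases (Qs n) m) as [hlt | hge].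
      (* Beyond the last stage the point is itself an admissible multiple, with error zero. *)
      + exists (N0 + c)%nat. specialize (hnode n c hc). split; [lia |].
        rewrite hz, Rminus_diag, distZ_0. left. apply Rpower_pos.
      + destruct (discrete_crossing (fun i => (m <= Qs i)%nat) n) as (i & hi1 & hi2 & hi3); [lia | exact hge |].
        destruct (in_offsets_split inc n c i hi1 hc) as (c1 & b & rest & h1 & h2 & h3 & ->).
        destruct (hloc i _ c1 b rest m h1 h2 h3) as [k [hk1 hk2]]; [lia |].
        exists k. split; [exact hk1 |]. rewrite hz.
        replace (N0 + (c1 + b + rest))%nat with (N0 + c1 + b + rest)%nat by lia. exact hk2. }
  (* The first summand pays for the packing term [16 r Q], the second for the additional 1 in the
     packing bound. *)
  apply (not_null_of_uniform_points s (16 / (kap * kap) + / kap) (closed_uniform_set tau theta (Qs 0%nat))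
    (fun n => map (fun c => frac_part (INR (N0 + c) * theta)) (offsets inc 0 n)) ell).
  - exact hs0.
  - assert (0 < / kap) by now apply Rinv_0_lt_compat.
    assert (0 < 16 / (kap * kap)) by (apply Rdiv_lt_0_compat; nra). lra.
  - intros x. apply closed_uniform_set_closed.
  - intros x hx. apply hx.
  - intros n p hp. apply in_map_iff in hp. destruct hp as [c [<- hc]]. now apply (hloc' n).
  - intros n. rewrite length_map. now apply length_offsets_pos.
  - exact hell0.
  - intros n x r hr hrn. rewrite length_map, filter_map_length. fold (M n).
    assert (hinv : 0 < / kap) by now apply Rinv_0_lt_compat.
    pose proof (Rpower_pos r s) as hrs.
    destruct (Rle_dec (ell 0%nat) r) as [h0 | h0].
    + assert (h1 : INR (length (filter (fun c => Rleb (Rabs (frac_part (INR (N0 + c) * theta) - x)) r)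
         (offsets inc 0 n))) <= M n) by (apply le_INR, filter_length_le).
      eapply Rle_trans; [exact h1 |].
      assert (h2 : kap <= Rpower r s).
      { eapply Rle_trans; [apply (hM1 0%nat) |]. simpl. rewrite Rmult_1_l.
        apply Rle_Rpower_l; [lra | split; [apply hell | exact h0]]. }
      assert (h3 : 1 <= (16 / (kap * kap) + / kap) * Rpower r s).
      { assert (0 < 16 / (kap * kap)) by (apply Rdiv_lt_0_compat; nra).
        assert (/ kap * kap = 1) by (field; lra). nra. }
      specialize (hM n). nra.
    + destruct (discrete_crossing (fun i => ell i <= r) n) as (i & hi1 & hi2 & hi3); [exact h0 | exact hrn |].
      apply Rnot_le_lt in hi2.
      assert (hn : n = (S i + (n - S i))%nat) by lia.
      set (K := length (offsets inc (S i) (n - S i))).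
      (* The ancestors are taken at the first resolved stage, [ell (S i) <= r < ell i]. A descendant
         is within [ell (S i) <= r] of its ancestor, hence the radius [2 r]. *)
      set (near := filter (fun c => Rleb (distZ (INR (N0 + c) * theta - x)) (2 * r)) (offsets inc 0 (S i))).
      assert (h1 : (length (filter (fun c => Rleb (Rabs (frac_part (INR (N0 + c) * theta) - x)) r)
         (offsets inc 0 n)) <= length near * K)%nat).
      { rewrite hn at 1. rewrite offsets_add. apply filter_flat_map_le.
        - intros c. apply length_map.
        - intros c y hc hy hy'. apply in_map_iff in hy. destruct hy as [b [<- hb]].
          apply Rleb_true in hy'. apply Rleb_true.
          assert (h2 : distZ (INR (N0 + (c + b)) * theta - x) <= r).
          { eapply Rle_trans; [| exact hy']. rewrite frac_part_eq.
            rewrite <- (distZ_addZ _ (- Int_part (INR (N0 + (c + b)) * theta))).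
            eapply Rle_trans; [apply distZ_le_abs |]. right. f_equal. ring. }
          replace (INR (N0 + c) * theta - x)
            with ((INR (N0 + (c + b)) * theta - x) - INR b * theta) by (rewrite !plus_INR; ring).
          eapply Rle_trans; [apply distZ_sub |].
          pose proof (htail (S i) _ b hb). lra. }
      assert (hMn : M n = M (S i) * INR K).
      { unfold M, K. rewrite hn at 1. rewrite length_offsets_add, mult_INR. reflexivity. }
      assert (h2 : INR (length near) <= 16 * r * INR (Qs (S i)) + 1).
      { assert (hq := hQ (S i)).
        replace (16 * r * INR (Qs (S i)) + 1) with (4 * (2 * r) / / (2 * INR (Qs (S i))) + 1) by (field; lra).
        apply (circle_packing (fun c => INR (N0 + c) * theta) near _ _ x).
        - apply Rinv_0_lt_compat. lra.
        - lra.
        - apply NoDup_filter, hND.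
        - intros c c' hc hc' hcc. apply filter_In in hc, hc'. apply hsep.
          + now apply hnode.
          + now apply hnode.
          + lia.
        - intros c hc. apply filter_In in hc. now apply Rleb_true. }
      apply le_INR in h1. rewrite mult_INR in h1.
      eapply Rle_trans; [exact h1 |].
      rewrite hMn. pose proof (pos_INR K) as hK.
      rewrite <- Rmult_assoc, (Rmult_comm _ (M (S i))).
      replace (M (S i) * (16 / (kap * kap) + / kap) * INR K * Rpower r s)
        with (M (S i) * (16 / (kap * kap) + / kap) * Rpower r s * INR K) by ring.
      replace ((16 / (kap * kap) + / kap) * (M (S i) * INR K) * Rpower r s)
        with (M (S i) * (16 / (kap * kap) + / kap) * Rpower r s * INR K) by ring.
      apply Rmult_le_compat_r; [exact hK |].
      eapply Rle_trans; [exact h2 |].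
      assert (h3 : 1 <= M (S i) * / kap * Rpower r s).
      { assert (h4 : kap <= M (S i) * Rpower r s).
        { eapply Rle_trans; [apply (hM1 (S i)) |]. apply Rmult_le_compat_l; [specialize (hM (S i)); fold (M (S i)); lra |].
          apply Rle_Rpower_l; [lra | split; [apply hell | exact hi3]]. }
        apply (Rmult_le_compat_l (/ kap)) in h4; [| lra]. rewrite Rinv_l in h4 by lra. lra. }
      (* Between two stages the count grows linearly in [r]. Since [s <= 1] and [r < ell i], one has
         [r / ell i <= (r / ell i)^s], so the bounds at stage [i] and on the branching
         interpolate. *)
      assert (h4 : 16 * r * INR (Qs (S i)) <= M (S i) * (16 / (kap * kap)) * Rpower r s).
      {
        assert (hx : r / ell i <= Rpower (r / ell i) s).
        { rewrite <- (Rpower_1 (r / ell i)) at 1 by now apply Rdiv_lt_0_compat.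
          apply Rpower_ln_le. rewrite ln_div by lra.
          assert (ln r < ln (ell i)) by (apply ln_increasing; lra). nra. }
        assert (hy : Rpower (r / ell i) s * Rpower (ell i) s = Rpower r s).
        { rewrite Rpower_mult_distr; [f_equal; field; lra | now apply Rdiv_lt_0_compat | lra]. }
        assert (h5 := hM1 i). fold (M i) in h5.
        assert (h6 := hM2 i). fold (M i) (M (S i)) in h6.
        pose proof (hQ (S i)) as hQi. pose proof (Rpower_pos (ell i) s) as hls.
        assert (h7 : kap * r <= M i * ell i * Rpower r s).
        { assert (h8 : r * Rpower (ell i) s <= ell i * Rpower r s).
          { rewrite <- hy. apply (Rmult_le_compat_r (ell i * Rpower (ell i) s)) in hx; [| nra].
            replace (r / ell i * (ell i * Rpower (ell i) s)) with (r * Rpower (ell i) s) in hx by (field; lra).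
            lra. }
          apply Rle_trans with (M i * Rpower (ell i) s * r); nra. }
        assert (h8 : kap * kap * (r * INR (Qs (S i))) <= M (S i) * Rpower r s).
        { apply Rle_trans with (kap * M i * (ell i * INR (Qs (S i))) * Rpower r s); [| nra].
          apply (Rmult_le_compat_r (kap * INR (Qs (S i)))) in h7; [| nra]. lra. }
        apply (Rmult_le_compat_l (16 / (kap * kap))) in h8.
        2:{ left. apply Rdiv_lt_0_compat; nra. }
        replace (16 / (kap * kap) * (kap * kap * (r * INR (Qs (S i))))) with (16 * r * INR (Qs (S i))) in h8 by (field; lra).
        lra. }
      lra.
  - apply hausdorff_null_subset with (fun x => U_set tau theta x \/ x = 1).
    + intros x. now apply closed_uniform_set_subset.
    + now apply hausdorff_null_add_point.
Qed.

(** * Signed positions of multiples relative to a convergent *)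

Section SignedPosition.

Context {theta : R} {Hth : irrational01 theta}.

Notation D := (cfD theta).
Notation Q := (cfQ theta).
Notation qR k := (INR (cfQ theta (S k))).
Notation a := (cfa theta).

(* [c theta] lies at signed distance [x] from an integer, measured in the direction of
   [q_k theta - p_k], whose sign is [(-1) ^ k]. *)
Definition signed_pos (theta : R) (k c : nat) (x : R) : Prop :=
  exists p : Z, INR c * theta = IZR p + (-1) ^ k * x.

Lemma signed_pos_0 k : signed_pos theta k 0 0.
Proof. exists 0%Z. simpl. ring. Qed.

Lemma signed_pos_add k c c' x x' : signed_pos theta k c x -> signed_pos theta k c' x' ->
  signed_pos theta k (c + c') (x + x').
Proof.
  intros [p hp] [p' hp']. exists (p + p')%Z. rewrite plus_INR, plus_IZR. lra.
Qed.

Lemma signed_pos_q k : signed_pos theta k (Q (S k)) (D (S k)).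
Proof. exists (cfP theta (S k)). apply cfQ_theta. Qed.

Lemma signed_pos_mul_q k b : signed_pos theta k (b * Q (S k)) (INR b * D (S k)).
Proof.
  induction b as [| b IH]; [simpl; rewrite Rmult_0_l; apply signed_pos_0 |].
  rewrite S_INR, Nat.mul_succ_l, Rmult_plus_distr_r, Rmult_1_l.
  apply signed_pos_add; [exact IH | apply signed_pos_q].
Qed.

Lemma signed_pos_flip k c x : signed_pos theta (S k) c x -> signed_pos theta k c (- x).
Proof. intros [p hp]. exists p. rewrite hp. simpl. ring. Qed.

Lemma signed_pos_SS k c x : signed_pos theta (S (S k)) c x -> signed_pos theta k c x.
Proof. intros [p hp]. exists p. rewrite hp. simpl. ring. Qed.

Lemma signed_pos_distZ k c x : signed_pos theta k c x -> distZ (INR c * theta) <= Rabs x.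
Proof.
  intros [p ->]. rewrite Rplus_comm, distZ_addZ. eapply Rle_trans; [apply distZ_le_abs |].
  rewrite Rabs_pow_m1. lra.
Qed.

Lemma signed_pos_distZ_sub k c c' x x' : signed_pos theta k c x -> signed_pos theta k c' x' ->
  distZ (INR c * theta - INR c' * theta) <= Rabs (x' - x).
Proof.
  intros [p ->] [p' ->].
  replace (IZR p + (-1) ^ k * x - (IZR p' + (-1) ^ k * x')) with ((-1) ^ k * (x - x') + IZR (p - p'))
    by (rewrite minus_IZR; ring).
  rewrite distZ_addZ. eapply Rle_trans; [apply distZ_le_abs |].
  rewrite Rabs_pow_m1, Rabs_minus_sym. lra.
Qed.

Lemma signed_pos_exists (alpha : R) k c : exists x, signed_pos alpha k c x.
Proof.
  exists ((-1) ^ k * (INR c * alpha)). exists 0%Z.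
  destruct (pow_m1_cases k) as [-> | ->]; ring.
Qed.

Lemma signed_pos_sub_qprev k c x : (Q k <= c)%nat -> signed_pos theta k c x ->
  signed_pos theta k (c - Q k) (x + D k).
Proof.
  intros hle [p hp]. destruct (cf_invariant k) as (_ & _ & h & _).
  exists (p - cfP theta k)%Z. rewrite minus_INR, minus_IZR by exact hle. lra.
Qed.

End SignedPosition.

(** * The case [tau = 1] *)

(* For [a = 3] the digit [sqrt (a + 1) = 2] is not usable; the block [(3, 1)] gets its third choice
   from the increment [q_(k+1)] instead. *)
Definition max_digit (a : nat) : nat :=
  if (a <=? 1)%nat then 0%nat else if (a <=? 3)%nat then 1%nat else Nat.sqrt (a + 1).

Lemma max_digit_ge4 a : (4 <= a)%nat -> max_digit a = Nat.sqrt (a + 1).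
Proof.
  intros h. unfold max_digit. destruct (Nat.leb_spec a 1); [lia |]. destruct (Nat.leb_spec a 3); [lia | reflexivity].
Qed.

Lemma max_digit_cases a : (2 <= a)%nat ->
  (a <= 3 /\ max_digit a = 1)%nat \/
  (4 <= a /\ max_digit a * max_digit a <= a + 1 < S (max_digit a) * S (max_digit a))%nat.
Proof.
  intros h. destruct (Nat.le_gt_cases a 3) as [h3 | h3].
  - left. split; [exact h3 |]. unfold max_digit.
    destruct (Nat.leb_spec a 1); [lia |]. destruct (Nat.leb_spec a 3); lia.
  - right. split; [lia |]. rewrite max_digit_ge4 by lia.
    pose proof (Nat.sqrt_spec (a + 1)). lia.
Qed.

Lemma max_digit_lt a : (2 <= a)%nat -> (max_digit a + 1 <= a)%nat.
Proof. intros h. destruct (max_digit_cases a h) as [[h1 ->] | [h1 [h2 h3]]]; nia. Qed.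

(** This is what a digit may use up if the ratio 4/7 in [node] is to be preserved. *)
Lemma max_digit_7 a : (2 <= a)%nat -> (7 * max_digit a <= 4 * a)%nat.
Proof.
  intros h. destruct (max_digit_cases a h) as [[h1 ->] | [h1 [h2 h3]]]; [lia |].
  destruct (Nat.le_gt_cases (max_digit a) 2) as [h4 | h4]; nia.
Qed.

(** The two bounds match the growth of denominators: by at most [a + 1] over the block [(a)] and at
    most [a + 2] over [(a, 1)]. Only [a = 3] misses the second, 4 against 5. *)
Lemma max_digit_square a : (2 <= a)%nat ->
  (a + 1 <= (max_digit a + 1) * (max_digit a + 1))%nat /\
  (a <> 3%nat -> a + 2 <= (max_digit a + 1) * (max_digit a + 1))%nat.
Proof.
  intros h. destruct (max_digit_cases a h) as [[h1 ->] | [h1 [h2 h3]]]; lia.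
Qed.

(* Here [q d + q' d'] in the form [(a q + q') d + q d'] equals one in the application. *)
Lemma digit_inequality (a b j : nat) (q q' d d' v N : R) : (2 <= a)%nat -> (b <= max_digit a)%nat ->
  (j < b)%nat -> 0 <= q' <= q -> 0 < d -> 0 < d' -> 0 <= N <= q -> 7 * N <= 4 * (q + q') ->
  v <= d' -> 3 * v <= 2 * d ->
  (INR (b - j) * d + v) * (N + INR (j + 1) * q) <= (INR a * q + q') * d + q * d'.
Proof.
  intros ha hb hj hq hd hd' hN hN7 hv hv3.
  assert (hp : (1 <= b - j)%nat) by lia.
  set (w := Rmax v 0).
  assert (hw : 0 <= w /\ v <= w /\ w <= d' /\ 3 * w <= 2 * d).
  { unfold w, Rmax. destruct (Rle_dec v 0); lra. }
  destruct hw as (hw0 & hw1 & hw2 & hw3). clearbody w.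
  assert (hL : 0 <= N + INR (j + 1) * q).
  { pose proof (pos_INR (j + 1)). nra. }
  apply Rle_trans with ((INR (b - j) * d + w) * (N + INR (j + 1) * q)).
  { apply Rmult_le_compat_r; [exact hL | lra]. }
  assert (hwq : w * q <= q * d') by nra.
  assert (hNw : 3 * (w * N) <= 2 * (d * N)) by nra.
  assert (hdq : 0 <= d * q') by nra.
  assert (hdq2 : d * q' <= d * q) by nra.
  assert (hdN : d * N <= d * q) by nra.
  assert (hdN0 : 0 <= d * N) by nra.
  assert (hdN7 : 7 * (d * N) <= 4 * (d * q + d * q')) by nra.
  assert (hwq3 : 3 * (w * q) <= 2 * (d * q)) by nra.
  assert (hsmall : b = 1%nat \/ (b = 2%nat /\ (4 <= a)%nat) \/ ((3 <= b)%nat /\ (b * b <= a + 1)%nat)).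
  { destruct (max_digit_cases a ha) as [[h1 h2] | [h1 [h2 h3]]]; [lia |].
    destruct (Nat.le_gt_cases b 2); [lia |]. right; right. split; [lia | nia]. }
  destruct hsmall as [-> | [[-> ha4] | [hb3 hba]]].
  (* The tightest case is [a = 2]. It works because [(1 + 2/3) * (4/7) = 20/21 < 1]: the factors are
     the bounds [3 v <= 2 d] and [7 N <= 4 (q + q')]. *)
  - replace j with 0%nat by lia. simpl INR.
    apply le_INR in ha. simpl in ha. nra.
  - apply le_INR in ha4. simpl in ha4.
    assert (hj2 : j = 0%nat \/ j = 1%nat) by lia.
    destruct hj2 as [-> | ->]; simpl INR; nra.
  (* This is [(b - j + 2/3) (j + 2) <= a]. From [b = 3] on there is room for the crude bounds
     [N <= q] and [w <= (2/3) d]. *)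
  - assert (hnat : (3 * (b - j) * (j + 2) + 2 * (j + 2) <= 3 * a)%nat).
    { assert (h1 : (3 * (b - j) * (j + 2) + 2 * (j + 2) + 3 <= 3 * (b * b))%nat); [| lia].
      set (p := (b - j)%nat) in *. assert (hbp : b = (p + j)%nat) by (unfold p; lia).
      clearbody p. subst b. destruct (Nat.eq_dec (p + j) 3) as [e | e].
      - assert (h : p = 1%nat /\ j = 2%nat \/ p = 2%nat /\ j = 1%nat \/ p = 3%nat /\ j = 0%nat) by lia.
        destruct h as [[-> ->] | [[-> ->] | [-> ->]]]; simpl; lia.
      - assert (4 <= p + j)%nat by lia. nia. }
    apply le_INR in hnat. rewrite plus_INR, !mult_INR, !plus_INR in hnat. simpl (INR 3) in hnat. simpl (INR 2) in hnat.
    rewrite plus_INR. simpl (INR 1). set (p := INR (b - j)) in *.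
    pose proof (pos_INR j) as hj0.
    assert (hp1 : 1 <= p) by (unfold p; apply (le_INR 1); exact hp).
    assert (h1 : (p * d + w) * (N + (INR j + 1) * q) <= (p + 2 / 3) * (INR j + 2) * (d * q)).
    { apply Rle_trans with (((p + 2 / 3) * d) * ((INR j + 2) * q)); [| right; ring].
      apply Rmult_le_compat; nra. }
    assert (h2 : (p + 2 / 3) * (INR j + 2) * (d * q) <= INR a * (d * q)).
    { apply Rmult_le_compat_r; nra. }
    nra.
Qed.

Section LocalApproximation.

Context {theta : R} {Hth : irrational01 theta}.

Notation D := (cfD theta).
Notation Q := (cfQ theta).
Notation qR k := (INR (cfQ theta (S k))).
Notation a := (cfa theta).

Lemma le_inv_of_mul (x y m : R) : 0 < m -> m <= y -> 0 <= x -> x * y <= 1 -> x <= / m.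
Proof.
  intros h1 h2 h3 h4. apply Rmult_le_reg_r with m; [exact h1 |]. rewrite Rinv_l by lra. nra.
Qed.

Lemma inv_D_bound k (m : nat) : (1 <= m <= Q (S (S k)))%nat -> D (S k) <= / INR m.
Proof.
  intros hm. apply le_inv_of_mul with (qR (S k)).
  - apply lt_0_INR. lia.
  - apply le_INR. lia.
  - left. apply cfD_pos.
  - rewrite Rmult_comm. apply cfQ_D_le1.
Qed.

(** If the node [N + b q_k] is below [m], it serves, with error at most [d_k]. Otherwise take the
    last [N + j q_k] below [m]: the error is [(b - j) d_k + v] while [m <= N + (j + 1) q_k], and
    [digit_inequality] bounds the product by 1. *)
Lemma digit_level k N b rest v m : (1 <= N <= Q (S k))%nat -> (7 * N <= 4 * (Q (S k) + Q k))%nat ->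
  (b <= max_digit (a k))%nat -> signed_pos theta k rest v -> - D (S k) <= v ->
  v <= D (S (S k)) -> 3 * v <= 2 * D (S k) -> (Q (S k) < m <= Q (S (S k)))%nat ->
  exists n, (1 <= n < m)%nat /\
    distZ (INR n * theta - INR (N + b * Q (S k) + rest) * theta) <= / INR m.
Proof.
  intros hN hN7 hb hrest hv1 hv2 hv3 hm.
  pose proof (cfD_pos (S k)) as hd. pose proof (cfD_pos (S (S k))) as hd'.
  destruct (signed_pos_exists theta k N) as [x hx].
  assert (ht : signed_pos theta k (N + b * Q (S k) + rest) (x + INR b * D (S k) + v)).
  { repeat apply signed_pos_add; auto. apply signed_pos_mul_q. }
  destruct (Nat.lt_ge_cases (N + b * Q (S k)) m) as [hlt | hge].
  - exists (N + b * Q (S k))%nat. split; [lia |].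
    eapply Rle_trans; [apply (signed_pos_distZ_sub k _ _ (x + INR b * D (S k)) (x + INR b * D (S k) + v)) |].
    + apply signed_pos_add; [exact hx | apply signed_pos_mul_q].
    + exact ht.
    + apply Rle_trans with (D (S k)); [| apply inv_D_bound; lia].
      replace (x + INR b * D (S k) + v - (x + INR b * D (S k))) with v by ring.
      apply Rabs_le. lra.
  - set (j := ((m - 1 - N) / Q (S k))%nat).
    assert (hj1 : (N + j * Q (S k) < m <= N + (j + 1) * Q (S k))%nat).
    { pose proof (Nat.div_mod (m - 1 - N) (Q (S k)) ltac:(lia)) as h1. fold j in h1.
      pose proof (Nat.mod_upper_bound (m - 1 - N) (Q (S k)) ltac:(lia)) as h2. nia. }
    assert (hj2 : (j < b)%nat) by nia.
    assert (ha : (2 <= a k)%nat).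
    { destruct (Nat.le_gt_cases 2 (a k)) as [h | h]; [exact h |].
      unfold max_digit in hb. destruct (Nat.leb_spec (a k) 1); lia. }
    exists (N + j * Q (S k))%nat. split; [lia |].
    eapply Rle_trans; [apply (signed_pos_distZ_sub k _ _ (x + INR j * D (S k)) (x + INR b * D (S k) + v)) |].
    + apply signed_pos_add; [exact hx | apply signed_pos_mul_q].
    + exact ht.
    + replace (x + INR b * D (S k) + v - (x + INR j * D (S k))) with (INR (b - j) * D (S k) + v)
        by (rewrite minus_INR by lia; ring).
      assert (h1 : 1 <= INR (b - j)) by (apply (le_INR 1); lia).
      rewrite Rabs_right by nra.
      apply le_inv_of_mul with (INR N + INR (j + 1) * qR k).
      * apply lt_0_INR. lia.
      * rewrite <- mult_INR, <- plus_INR. apply le_INR. lia.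
      * nra.
      * rewrite <- (cfQ_D (S k)), cfQ_rec, (plus_INR (_ * _)), mult_INR.
        apply digit_inequality; auto.
        -- split; [apply pos_INR | apply le_INR, cfQ_mono_S].
        -- split; [apply pos_INR | apply le_INR; lia].
        -- apply le_INR in hN7. rewrite !mult_INR, plus_INR in hN7. simpl in hN7. lra.
Qed.

(* The two neighbours of the point are [N theta] and, on the other side, [(N - q_(k-1)) theta] or
   [(N + q_k - q_(k-1)) theta]; the nearer one is at most half a gap away. *)
Lemma one_level k N rest v m : a k = 1%nat -> (1 <= N <= Q (S k))%nat ->
  signed_pos theta k rest v -> - D (S k) <= v <= D (S (S k)) ->
  (Q (S k) < m)%nat -> (m <= Q (S (S k)) \/ m <= N + Q (S k))%nat ->
  exists n, (1 <= n < m)%nat /\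
    distZ (INR n * theta - INR (N + Q (S k) + rest) * theta) <= / INR m.
Proof.
  intros ha hN hrest hv hm hm2.
  pose proof (cfD_pos (S k)) as hd. pose proof (cfD_pos (S (S k))) as hd'.
  pose proof (cfQ_D (S k)) as hone. pose proof (cfD_rec k) as hDr.
  pose proof (cfQ_rec theta k) as hQr. rewrite ha in hDr, hQr. simpl in hDr. rewrite Nat.mul_1_l in hQr.
  pose proof (cfQ_mono_S k) as hqq.
  destruct (signed_pos_exists theta k N) as [x hx].
  pose proof (signed_pos_q k) as hsq.
  assert (ht : signed_pos theta k (N + Q (S k) + rest) (x + D (S k) + v)).
  { repeat apply signed_pos_add; auto. }
  rewrite hQr, plus_INR in hone.
  apply le_INR in hqq. pose proof (pos_INR (Q k)) as hq0.
  destruct (Nat.lt_ge_cases (N + Q (S k)) m) as [hlt | hge].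
  - exists (N + Q (S k))%nat. split; [lia |].
    eapply Rle_trans; [apply (signed_pos_distZ_sub k _ _ (x + D (S k)) (x + D (S k) + v)) |].
    + now apply signed_pos_add.
    + exact ht.
    + apply Rle_trans with (D (S k)); [| apply inv_D_bound; lia].
      replace (x + D (S k) + v - (x + D (S k))) with v by ring.
      apply Rabs_le. pose proof (cfD_decr (S k)). lra.
  - destruct (Nat.lt_ge_cases (Q k) N) as [hNq | hNq].
    (* Here the two errors sum to [d_(k-1)], so the smaller one times [2 q_k] is at most
       [q_k d_(k-1) <= 1]. *)
    + assert (hm3 : INR m <= 2 * qR k).
      { replace (2 * qR k) with (INR (2 * Q (S k))) by (rewrite mult_INR; simpl; ring).
        apply le_INR. lia. }
      destruct (Rle_dec (D (S k) + v) (D (S (S k)) - v)) as [hc | hc].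
      * exists N. split; [lia |].
        eapply Rle_trans; [apply (signed_pos_distZ_sub k _ _ x _ hx ht) |].
        replace (x + D (S k) + v - x) with (D (S k) + v) by ring. rewrite Rabs_right by lra.
        apply le_inv_of_mul with (2 * qR k); [apply lt_0_INR; lia | exact hm3 | lra | nra].
      * exists (N - Q k)%nat. split; [lia |].
        eapply Rle_trans; [apply (signed_pos_distZ_sub k _ _ (x + D k) (x + D (S k) + v)) |].
        -- apply signed_pos_sub_qprev; [lia | exact hx].
        -- exact ht.
        -- replace (x + D (S k) + v - (x + D k)) with (- (D (S (S k)) - v)) by lra.
           rewrite Rabs_Ropp, Rabs_right by lra.
           apply le_inv_of_mul with (2 * qR k); [apply lt_0_INR; lia | exact hm3 | lra | nra].
    (* Now the errors sum to [d_(k-1) + d_k]. By rearrangement, [(q_k + q_(k-1)) (d_(k-1) + d_k) <=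
       2 (q_k d_(k-1) + q_(k-1) d_k) = 2]. *)
    + assert (hm3 : INR m <= qR k + INR (Q k)) by (rewrite <- plus_INR; apply le_INR; lia).
      destruct (Rle_dec (D (S k) + v) (D (S k) + D (S (S k)) - v)) as [hc | hc].
      * exists N. split; [lia |].
        eapply Rle_trans; [apply (signed_pos_distZ_sub k _ _ x _ hx ht) |].
        replace (x + D (S k) + v - x) with (D (S k) + v) by ring. rewrite Rabs_right by lra.
        apply le_inv_of_mul with ((qR k) + INR (Q k)); [apply lt_0_INR; lia | exact hm3 | lra | nra].
      * exists (N + Q (S k) - Q k)%nat. split; [pose proof (cfQ_mono_S k); lia |].
        eapply Rle_trans; [apply (signed_pos_distZ_sub k _ _ (x + D (S k) + D k) (x + D (S k) + v)) |].
        -- apply signed_pos_sub_qprev; [pose proof (cfQ_mono_S k); lia | now apply signed_pos_add].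
        -- exact ht.
        -- replace (x + D (S k) + v - (x + D (S k) + D k)) with (- (D (S k) + D (S (S k)) - v)) by lra.
           rewrite Rabs_Ropp, Rabs_right by lra.
           apply le_inv_of_mul with ((qR k) + INR (Q k)); [apply lt_0_INR; lia | exact hm3 | lra | nra].
Qed.

End LocalApproximation.

(* The maximal block of partial quotients equal to one starting at level [k] is finite of odd length. *)
Inductive odd_run (theta : R) : nat -> Prop :=
  | odd_run_one k : cfa theta k = 1%nat -> cfa theta (S k) <> 1%nat -> odd_run theta k
  | odd_run_step k : cfa theta k = 1%nat -> cfa theta (S k) = 1%nat ->
      odd_run theta (S (S k)) -> odd_run theta k.

Lemma odd_run_first theta k : odd_run theta k -> cfa theta k = 1%nat.
Proof. now destruct 1. Qed.

Lemma odd_run_not_succ theta k : odd_run theta k -> ~ odd_run theta (S k).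
Proof.
  induction 1 as [k h1 h2 | k h1 h2 h3 IH]; intros h.
  - now apply odd_run_first in h.
  - inversion h as [k' h4 h5 | k' h4 h5 h6]; subst; [| contradiction].
    now apply odd_run_first in h3.
Qed.

(** Ones are consumed in pairs. The first one of an odd run is attached to the partial quotient
    before it, so that no block starts at an odd run. An infinite run of ones is not an [odd_run]
    and is simply cut into pairs. *)
Definition next_level (theta : R) (k : nat) : nat :=
  if (cfa theta k =? 1)%nat then S (S k)
  else if excluded_middle_informative (odd_run theta (S k)) then S (S k) else S k.

Definition increments (theta : R) (k : nat) : list nat :=
  if (cfa theta k =? 1)%nat then 0%nat :: cfQ theta (S k) :: nil
  else if excluded_middle_informative (odd_run theta (S k) /\ cfa theta k = 3%nat)
  then 0%nat :: cfQ theta (S k) :: cfQ theta (S (S k)) :: nil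
  else map (fun b => (b * cfQ theta (S k))%nat) (seq 0 (max_digit (cfa theta k) + 1)).

(* The four kinds of blocks of levels: [(a)], [(a, 1)] with [a <> 3], [(3, 1)] and [(1, 1)]. *)
Lemma block_cases (theta : R) (k : nat) : (1 <= cfa theta k)%nat -> ~ odd_run theta k ->
  ~ odd_run theta (next_level theta k) /\
  ((next_level theta k = S k /\ (2 <= cfa theta k)%nat /\
      increments theta k = map (fun b => (b * cfQ theta (S k))%nat) (seq 0 (max_digit (cfa theta k) + 1))) \/
   (next_level theta k = S (S k) /\ (2 <= cfa theta k)%nat /\ cfa theta k <> 3%nat /\ cfa theta (S k) = 1%nat /\
      increments theta k = map (fun b => (b * cfQ theta (S k))%nat) (seq 0 (max_digit (cfa theta k) + 1))) \/
   (next_level theta k = S (S k) /\ cfa theta k = 3%nat /\ cfa theta (S k) = 1%nat /\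
      increments theta k = 0%nat :: cfQ theta (S k) :: cfQ theta (S (S k)) :: nil) \/
   (next_level theta k = S (S k) /\ cfa theta k = 1%nat /\ cfa theta (S k) = 1%nat /\
      increments theta k = 0%nat :: cfQ theta (S k) :: nil)).
Proof.
  intros ha hk. unfold next_level, increments.
  destruct (Nat.eqb_spec (cfa theta k) 1) as [e | e].
  - assert (h1 : cfa theta (S k) = 1%nat).
    { apply NNPP. intros h. apply hk. now apply odd_run_one. }
    split; [intros h; apply hk; now apply odd_run_step |]. right; right; right. auto.
  - destruct (excluded_middle_informative (odd_run theta (S k))) as [h | h].
    + split; [now apply odd_run_not_succ |].
      pose proof (odd_run_first _ _ h) as h1.
      destruct (excluded_middle_informative _) as [h2 | h2].
      * right; right; left. tauto.
      * right; left. repeat split; auto; lia || tauto.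
    + split; [exact h |]. left.
      destruct (excluded_middle_informative _) as [h2 | h2]; [tauto |]. repeat split; auto. lia.
Qed.

Ltac block_split k hk :=
  destruct (block_cases _ k (cfa_pos k) hk)
    as [_ [(hn & ha & hi) | [(hn & ha & ha3 & h1 & hi) | [(hn & ha & h1 & hi) | (hn & ha & h1 & hi)]]]].

Section Blocks.

Context {theta : R} {Hth : irrational01 theta}.

Notation D := (cfD theta).
Notation Q := (cfQ theta).
Notation qR k := (INR (cfQ theta (S k))).
Notation a := (cfa theta).
Notation next := (next_level theta).

(** The ratio 4/7 comes from the block [(3, 1)]: if only [q_(k-1) <= q_k] is known, the step adding
    [q_(k+1)] preserves [N <= c (q_k + q_(k-1))] exactly when [7 c >= 4]. *)
Definition node (theta : R) (k N : nat) : Prop :=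
  (1 <= N <= cfQ theta (S k))%nat /\ (7 * N <= 4 * (cfQ theta (S k) + cfQ theta k))%nat.

(** The window for what later blocks can still add, seen from level [k]. The refinement by 2/3
    supplies the hypothesis [3 v <= 2 d] of the digit estimate; it is imposed on both sides because
    passing to an adjacent level reverses the sign. *)
Definition digit_tail (theta : R) (k c : nat) : Prop :=
  exists x, signed_pos theta k c x /\ - cfD theta (S k) <= x <= cfD theta k /\
    - (2 * cfD theta k) <= 3 * x <= 2 * (cfD theta k + cfD theta (S k)).

Lemma in_digit_multiples k c :
  In c (map (fun b => (b * Q (S k))%nat) (seq 0 (max_digit (a k) + 1))) <->
  exists b, (b <= max_digit (a k))%nat /\ c = (b * Q (S k))%nat.
Proof.
  rewrite in_map_iff. split.
  - intros [b [<- hb]]. apply in_seq in hb. exists b. split; [lia | reflexivity].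
  - intros [b [hb ->]]. exists b. split; [reflexivity | apply in_seq; lia].
Qed.

Lemma block_node k N c : ~ odd_run theta k -> node theta k N -> In c (increments theta k) ->
  node theta (next k) (N + c).
Proof.
  intros hk [hN hN7] hc.
  pose proof (cfQ_rec theta k) as hr. pose proof (cfQ_rec theta (S k)) as hr'.
  block_split k hk; rewrite hn; rewrite hi in hc; unfold node.
  - apply in_digit_multiples in hc. destruct hc as [b [hb ->]].
    pose proof (max_digit_7 _ ha). rewrite hr. split; nia.
  - apply in_digit_multiples in hc. destruct hc as [b [hb ->]].
    pose proof (max_digit_lt _ ha). rewrite hr', h1, hr. split; nia.
  - rewrite hr', h1, hr, ha. destruct hc as [<- | [<- | [<- | []]]]; rewrite ?hr, ?ha; split; nia.
  - rewrite hr', h1, hr, ha. destruct hc as [<- | [<- | []]]; split; nia.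
Qed.

Lemma tail_0 k : digit_tail theta k 0.
Proof.
  exists 0. pose proof (cfD_pos k). pose proof (cfD_pos (S k)). split; [apply signed_pos_0 | lra].
Qed.

Lemma tail_prev k r : digit_tail theta (S k) r ->
  exists x, signed_pos theta k r x /\ - D (S k) <= x <= D (S (S k)) /\ 3 * x <= 2 * D (S k).
Proof.
  intros (x & h1 & h2 & h3). exists (- x). split; [now apply signed_pos_flip |]. lra.
Qed.

Lemma tail_prev2 k r : a (S k) = 1%nat -> digit_tail theta (S (S k)) r ->
  exists x, signed_pos theta k r x /\ - D (S (S (S k))) <= x <= D (S (S k)) /\ 3 * x <= 2 * D (S k).
Proof.
  intros ha (x & h1 & h2 & h3). exists x. split; [now apply signed_pos_SS |].
  pose proof (cfD_rec (S k)) as h. rewrite ha in h. simpl in h. lra.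
Qed.

Lemma block_tail k c r : ~ odd_run theta k -> In c (increments theta k) -> digit_tail theta (next k) r ->
  digit_tail theta k (c + r) /\
  distZ (INR (c + r) * theta) <= INR (length (increments theta k)) * D (S k).
Proof.
  intros hk hc hr.
  pose proof (cfD_pos (S (S (S k)))) as hd3.
  pose proof (cfD_decr (S k)) as hdd1. pose proof (cfD_decr (S (S k))) as hdd2.
  pose proof (cfD_rec k) as hDr.
  assert (key : forall x n, signed_pos theta k (c + r) x -> - D (S k) <= x <= D k ->
     - (2 * D k) <= 3 * x <= 2 * (D k + D (S k)) -> length (increments theta k) = n -> x <= INR n * D (S k) ->
     1 <= INR n ->
     digit_tail theta k (c + r) /\ distZ (INR (c + r) * theta) <= INR (length (increments theta k)) * D (S k)).
  { intros x n h1 h2 h3 -> h4 h5. split; [exists x; auto |].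
    eapply Rle_trans; [apply (signed_pos_distZ k _ _ h1) |]. apply Rabs_le. nra. }
  assert (hdig : forall b x, (b <= max_digit (a k))%nat -> (2 <= a k)%nat -> c = (b * Q (S k))%nat ->
     increments theta k = map (fun b => (b * Q (S k))%nat) (seq 0 (max_digit (a k) + 1)) ->
     signed_pos theta k r x -> - D (S k) <= x <= D (S (S k)) ->
     digit_tail theta k (c + r) /\ distZ (INR (c + r) * theta) <= INR (length (increments theta k)) * D (S k)).
  { intros b x hb ha -> hi hx hx1.
    pose proof (max_digit_lt _ ha) as hlt.
    assert (hb7 : (7 * b <= 4 * a k)%nat) by (pose proof (max_digit_7 _ ha); lia).
    apply le_INR in hb7. rewrite !mult_INR in hb7. simpl (INR 7) in hb7. simpl (INR 4) in hb7.
    apply le_INR in hb, ha, hlt. rewrite plus_INR in hlt. simpl in hlt, ha.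
    pose proof (pos_INR b) as hb0.
    assert (h7 : 0 <= INR b * D (S k)) by nra.
    assert (h8 : (INR b + 1) * D (S k) <= INR (a k) * D (S k)) by (apply Rmult_le_compat_r; lra).
    assert (h9 : 2 * D (S k) <= INR (a k) * D (S k)) by (apply Rmult_le_compat_r; lra).
    assert (h10 : 7 * (INR b * D (S k)) <= 4 * (INR (a k) * D (S k))) by nra.
    apply (key (INR b * D (S k) + x) (max_digit (a k) + 1)%nat).
    - apply signed_pos_add; [apply signed_pos_mul_q | exact hx].
    - lra.
    - lra.
    - rewrite hi, length_map, length_seq. reflexivity.
    - rewrite plus_INR. simpl (INR 1). nra.
    - rewrite plus_INR. simpl (INR 1). lra. }
  block_split k hk; rewrite hn in hr; rewrite hi in hc.
  - apply in_digit_multiples in hc. destruct hc as [b [hb hcb]].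
    destruct (tail_prev k r hr) as (x & hx & hx1 & hx2). apply (hdig b x); auto.
  - apply in_digit_multiples in hc. destruct hc as [b [hb hcb]].
    destruct (tail_prev2 k r h1 hr) as (x & hx & hx1 & hx2). apply (hdig b x); auto. lra.
  - destruct (tail_prev2 k r h1 hr) as (x & hx & hx1 & hx2).
    pose proof (cfD_rec (S k)) as hDr'. rewrite h1 in hDr'. rewrite ha in hDr. simpl in hDr, hDr'.
    destruct hc as [<- | [<- | [<- | []]]].
    + apply (key (0 + x) 3%nat); try lra; [apply signed_pos_add; [apply signed_pos_0 | exact hx] | now rewrite hi | simpl; lra ..].
    + apply (key (D (S k) + x) 3%nat); try lra; [apply signed_pos_add; [apply signed_pos_q | exact hx] | now rewrite hi | simpl; lra ..].
    (* Seen from level [k], the increment [q_(k+1)] moves backwards, by [d_(k+1)]. *)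
    + apply (key (- D (S (S k)) + x) 3%nat); try lra;
        [apply signed_pos_add; [apply signed_pos_flip, signed_pos_q | exact hx] | now rewrite hi | simpl; lra ..].
  - destruct (tail_prev2 k r h1 hr) as (x & hx & hx1 & hx2).
    pose proof (cfD_rec (S k)) as hDr'. rewrite h1 in hDr'. rewrite ha in hDr. simpl in hDr, hDr'.
    destruct hc as [<- | [<- | []]].
    + apply (key (0 + x) 2%nat); try lra; [apply signed_pos_add; [apply signed_pos_0 | exact hx] | now rewrite hi | simpl; lra ..].
    + apply (key (D (S k) + x) 2%nat); try lra; [apply signed_pos_add; [apply signed_pos_q | exact hx] | now rewrite hi | simpl; lra ..].
Qed.

Lemma near_node_approx k M rest v m : signed_pos theta k rest v -> Rabs v <= / INR m ->
  (1 <= M < m)%nat ->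
  exists n, (1 <= n < m)%nat /\ distZ (INR n * theta - INR (M + rest) * theta) <= / INR m.
Proof.
  intros h1 h2 hM. exists M. split; [exact hM |].
  replace (INR M * theta - INR (M + rest) * theta) with (- (INR rest * theta)) by (rewrite plus_INR; ring).
  rewrite distZ_opp. eapply Rle_trans; [apply (signed_pos_distZ k _ _ h1) | exact h2].
Qed.

(** For [m <= q_(k+1)] the digit at level [k] decides. In a block of two levels and beyond
    [q_(k+1)], usually [N + c] is already below [m] and the tail is within [d_(k+1)] of it; the
    exceptions are treated by [one_level]. *)
Lemma block_local k N c r m : ~ odd_run theta k -> node theta k N -> In c (increments theta k) ->
  digit_tail theta (next k) r -> (Q (S k) < m <= Q (S (next k)))%nat ->
  exists n, (1 <= n < m)%nat /\ distZ (INR n * theta - INR (N + c + r) * theta) <= / INR m.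
Proof.
  intros hk [hN hN7] hc hr hm.
  pose proof (cfD_decr (S k)) as hdd1. pose proof (cfD_decr (S (S k))) as hdd2.
  pose proof (cfQ_rec theta k) as hQr.
  pose proof (cfQ_mono_S (S k)) as hqm'.
  block_split k hk; rewrite hn in hr, hm; rewrite hi in hc.
  - apply in_digit_multiples in hc. destruct hc as [b [hb ->]].
    destruct (tail_prev k r hr) as (x & hx & hx1 & hx2).
    apply (digit_level k N b r x m); auto; lra.
  - apply in_digit_multiples in hc. destruct hc as [b [hb ->]].
    destruct (tail_prev2 k r h1 hr) as (x & hx & hx1 & hx2).
    destruct (Nat.le_gt_cases m (Q (S (S k)))) as [hm1 | hm1].
    + apply (digit_level k N b r x m); auto; try lra. lia.
    + apply (near_node_approx k _ r x m hx).
      * apply Rle_trans with (D (S (S k))); [apply Rabs_le; lra | apply inv_D_bound; lia].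
      * pose proof (max_digit_lt _ ha). nia.
  - destruct (tail_prev2 k r h1 hr) as (x & hx & hx1 & hx2).
    pose proof (cfD_rec (S k)) as hDr'. rewrite h1 in hDr'. simpl in hDr'.
    rewrite ha in hQr.
    destruct hc as [<- | [<- | [<- | []]]].
    + rewrite Nat.add_0_r.
      apply (near_node_approx k _ r x m hx); [| lia].
      destruct (Nat.le_gt_cases m (Q (S (S k)))) as [hm1 | hm1].
      * apply Rle_trans with (D (S k)); [apply Rabs_le; lra | apply inv_D_bound; lia].
      * apply Rle_trans with (D (S (S k))); [apply Rabs_le; lra | apply inv_D_bound; lia].
    + destruct (Nat.le_gt_cases m (Q (S (S k)))) as [hm1 | hm1].
      * replace (N + Q (S k) + r)%nat with (N + 1 * Q (S k) + r)%nat by lia.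
        apply (digit_level k N 1 r x m); auto; try lra; [| lia]. rewrite ha. unfold max_digit. simpl. lia.
      * apply (near_node_approx k _ r x m hx); [| lia].
        apply Rle_trans with (D (S (S k))); [apply Rabs_le; lra | apply inv_D_bound; lia].
    + destruct (Nat.le_gt_cases m (Q (S (S k)))) as [hm1 | hm1].
      * rewrite <- Nat.add_assoc. apply (near_node_approx k _ _ (- D (S (S k)) + x) m); [| | lia].
        -- apply signed_pos_add; [apply signed_pos_flip, signed_pos_q | exact hx].
        -- apply Rle_trans with (D (S k)); [apply Rabs_le; lra | apply inv_D_bound; lia].
      (* The third choice of the block [(3, 1)] is the digit 1 at level [k + 1], whose partial
         quotient is one. *)
      * destruct (tail_prev (S k) r hr) as (x' & hx' & hx1' & hx2').
        apply (one_level (S k) N r x' m); auto; lia.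
  - destruct (tail_prev2 k r h1 hr) as (x & hx & hx1 & hx2).
    destruct hc as [<- | [<- | []]].
    + rewrite Nat.add_0_r.
      apply (near_node_approx k _ r x m hx); [| lia].
      destruct (Nat.le_gt_cases m (Q (S (S k)))) as [hm1 | hm1].
      * apply Rle_trans with (D (S k)); [apply Rabs_le; lra | apply inv_D_bound; lia].
      * apply Rle_trans with (D (S (S k))); [apply Rabs_le; lra | apply inv_D_bound; lia].
    (* The node [N + q_k] may exceed [q_(k+1)]; for [m] in between, the second alternative of
       [one_level] applies. *)
    + destruct (Nat.le_gt_cases m (Q (S (S k)))) as [hm1 | hm1];
        [| destruct (Nat.le_gt_cases m (N + Q (S k))) as [hm2 | hm2]].
      * apply (one_level k N r x m); auto; lra || lia.
      * apply (one_level k N r x m); auto; lra || lia.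
      * apply (near_node_approx k _ r x m hx); [| lia].
        apply Rle_trans with (D (S (S k))); [apply Rabs_le; lra | apply inv_D_bound; lia].
Qed.

(** Distinct increments of a block differ by at least [q_k], whereas the nodes lie in [1 .. q_k]. *)
Lemma block_injective k N N' c c' : ~ odd_run theta k -> node theta k N -> node theta k N' ->
  In c (increments theta k) -> In c' (increments theta k) -> (N + c = N' + c')%nat -> N = N'.
Proof.
  intros hk [hN _] [hN' _] hc hc' heq.
  pose proof (cfQ_rec theta k) as hQr.
  assert (hdig : In c (map (fun b => (b * Q (S k))%nat) (seq 0 (max_digit (a k) + 1))) ->
                 In c' (map (fun b => (b * Q (S k))%nat) (seq 0 (max_digit (a k) + 1))) -> N = N').
  { rewrite !in_digit_multiples. intros [b [_ ->]] [b' [_ ->]].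
    destruct (Nat.lt_trichotomy b b') as [h | [h | h]]; nia. }
  block_split k hk; rewrite hi in hc, hc'; auto.
  - rewrite ha in hQr. simpl in hc, hc'. intuition lia.
  - simpl in hc, hc'. intuition lia.
Qed.

Lemma increments_NoDup k : ~ odd_run theta k -> NoDup (increments theta k).
Proof.
  intros hk. pose proof (cfQ_pos k) as hq. pose proof (cfQ_rec theta k) as hQr.
  assert (hdig : NoDup (map (fun b => (b * Q (S k))%nat) (seq 0 (max_digit (a k) + 1)))).
  { apply Injective_map_NoDup; [| apply seq_NoDup]. intros x y hxy. nia. }
  block_split k hk; rewrite hi; auto.
  - rewrite ha in hQr. repeat constructor; simpl; lia.
  - repeat constructor; simpl; lia.
Qed.

Lemma increments_growth k : ~ odd_run theta k ->
  (Q (S (next k)) <= length (increments theta k) * length (increments theta k) * Q (S k))%nat /\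
  (2 <= length (increments theta k))%nat /\
  (Q (S (next k)) <= 2 * Q (S (S k)))%nat /\ (k < next k)%nat.
Proof.
  intros hk. pose proof (cfQ_rec theta k) as hQr.
  pose proof (cfQ_rec theta (S k)) as hQr'. pose proof (cfQ_mono_S k) as hqm.
  pose proof (cfQ_mono_S (S k)) as hqm'.
  block_split k hk; rewrite hn, hi.
  - rewrite length_map, length_seq. pose proof (max_digit_square _ ha) as [h _].
    assert (hm2 : (1 <= max_digit (a k))%nat) by nia. repeat split; try lia.
    rewrite hQr. nia.
  - rewrite length_map, length_seq. pose proof (max_digit_square _ ha) as [_ h].
    assert (hm2 : (1 <= max_digit (a k))%nat) by nia.
    rewrite h1 in hQr'. repeat split; try lia.
    rewrite hQr', hQr. nia.
  - rewrite h1 in hQr'. rewrite ha in hQr. cbn [length]. repeat split; lia.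
  - rewrite h1 in hQr'. rewrite ha in hQr. cbn [length]. repeat split; lia.
Qed.

End Blocks.

Lemma ln_ge0 (x : R) : 1 <= x -> 0 <= ln x.
Proof. intros h. rewrite <- ln_1. apply ln_Rle; lra. Qed.

Lemma in_offsets_last inc i c : In c (offsets inc 0 (S i)) ->
  exists c1 b, In c1 (offsets inc 0 i) /\ In b (inc i) /\ c = (c1 + b)%nat.
Proof.
  intros h. destruct (in_offsets_split inc (S i) c i) as (c1 & b & rest & h1 & h2 & h3 & ->); [lia | exact h |].
  replace (S i - i - 1)%nat with 0%nat in h3 by lia. destruct h3 as [<- | []].
  exists c1, b. repeat split; auto.
Qed.

Lemma length_offsets_S inc i : length (offsets inc 0 (S i)) = (length (offsets inc 0 i) * length (inc i))%nat.
Proof. replace (S i) with (i + 1)%nat by lia. rewrite length_offsets_add, length_offsets_1. reflexivity. Qed.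

Section TauOne.

Context {theta : R} {Hth : irrational01 theta}.

Notation D := (cfD theta).
Notation Q := (cfQ theta).
Notation qR k := (INR (cfQ theta (S k))).
Notation next := (next_level theta).

Lemma cfD_small eps : 0 < eps -> exists k0, forall k, (k0 <= k)%nat -> D k < eps.
Proof.
  intros he. destruct (exists_nat_gt (/ eps)) as [n hn]. exists n. intros k hk.
  pose proof (cfQ_D_le1 k) as h1. pose proof (le_INR _ _ (cfQ_ge k)) as h2.
  apply le_INR in hk.
  assert (h4 : / eps < qR k) by lra.
  apply (Rmult_lt_compat_r eps) in h4; [| exact he]. rewrite Rinv_l in h4 by lra.
  apply Rnot_le_lt. intros hle.
  assert ((qR k) * eps <= qR k * D k) by (apply Rmult_le_compat_l; [apply pos_INR | exact hle]).
  lra.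
Qed.

Fixpoint block_start (theta : R) (k0 i : nat) : nat :=
  match i with O => k0 | S j => next_level theta (block_start theta k0 j) end.

Lemma block_start_not_odd k0 i : ~ odd_run theta k0 -> ~ odd_run theta (block_start theta k0 i).
Proof.
  intros h. induction i as [| i IH]; [exact h |]. simpl. now apply block_cases; [apply cfa_pos |].
Qed.

Lemma block_start_ge k0 i : ~ odd_run theta k0 -> (k0 + i <= block_start theta k0 i)%nat.
Proof.
  intros h. induction i as [| i IH]; simpl; [lia |].
  pose proof (increments_growth _ (block_start_not_odd k0 i h)). lia.
Qed.

Lemma increments_length_D k : ~ odd_run theta k ->
  INR (length (increments theta k)) * D (S k) <= 2 * D k.
Proof.
  intros hk. pose proof (cfD_rec k) as hr. pose proof (cfD_pos k). pose proof (cfD_pos (S k)). pose proof (cfD_pos (S (S k))).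
  block_split k hk; rewrite hi.
  - rewrite length_map, length_seq. pose proof (Rmult_le_compat_r (D (S k)) _ _ ltac:(lra) (le_INR _ _ (max_digit_lt _ ha))). lra.
  - rewrite length_map, length_seq. pose proof (Rmult_le_compat_r (D (S k)) _ _ ltac:(lra) (le_INR _ _ (max_digit_lt _ ha))). lra.
  - rewrite ha in hr. simpl in *. lra.
  - rewrite ha in hr. simpl in *. lra.
Qed.

(** The number of nodes at each stage is at least the square root of [q_k / q_k0], with no constant
    lost along the way; the scale of a stage is its number of choices times [d_k]. *)
Theorem U_set_one_not_null (s w c0 : R) (k1 : nat) : 0 < s -> 0 < w -> s * (1 + w) <= 1 -> 0 < c0 ->
  (forall k, (k1 <= k)%nat -> c0 * Rpower (qR k) (- w) <= D (S k)) ->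
  ~ hausdorff_null s (U_set 1 theta).
Proof.
  intros hs hw hsw hc0 hD.
  (* Two consecutive levels cannot both start an odd run. From [k0 >= 2] follows [q_k0 >= 2], which
     makes 1 a node. *)
  assert (hk0 : exists k0, (k1 <= k0)%nat /\ (2 <= k0)%nat /\ ~ odd_run theta k0).
  { destruct (classic (odd_run theta (k1 + 2))) as [h | h].
    - exists (S (k1 + 2)). repeat split; try lia. now apply odd_run_not_succ.
    - exists (k1 + 2)%nat. repeat split; auto; lia. }
  destruct hk0 as (k0 & hk1 & hk2 & hodd).
  set (lev := block_start theta k0).
  set (inc := fun i => increments theta (lev i)).
  assert (hlev : forall i, ~ odd_run theta (lev i)) by (intros i; now apply block_start_not_odd).
  assert (hlevge : forall i, (k0 + i <= lev i)%nat) by (intros i; now apply block_start_ge).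
  assert (hnode : forall i c, In c (offsets inc 0 i) -> node theta (lev i) (1 + c)).
  { induction i as [| i IH]; intros c hc.
    - destruct hc as [<- | []]. unfold node, lev. simpl block_start.
      pose proof (cfQ_ge k0). lia.
    - destruct (in_offsets_last inc i c hc) as (c1 & b & h1 & h2 & ->).
      rewrite Nat.add_assoc. apply block_node; auto. }
  assert (htail : forall j i c, In c (offsets inc i j) -> digit_tail theta (lev i) c).
  { induction j as [| j IH]; intros i c hc.
    - destruct hc as [<- | []]. apply tail_0.
    - apply in_offsets_S in hc. destruct hc as (c1 & c2 & h1 & h2 & ->).
      exact (proj1 (block_tail (lev i) c1 c2 (hlev i) h1 (IH (S i) c2 h2))). }
  assert (hM : forall i, (qR (lev i)) <=
     INR (length (offsets inc 0 i)) * INR (length (offsets inc 0 i)) * qR k0).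
  { induction i as [| i IH].
    - unfold lev. simpl. lra.
    - rewrite length_offsets_S, mult_INR.
      destruct (increments_growth _ (hlev i)) as (h1 & _).
      apply le_INR in h1. rewrite !mult_INR in h1.
      change (lev (S i)) with (next (lev i)). unfold inc at 2 4.
      eapply Rle_trans; [exact h1 |].
      set (m := INR (length (increments theta (lev i)))) in *.
      apply Rle_trans with (m * m * (INR (length (offsets inc 0 i)) * INR (length (offsets inc 0 i)) * qR k0)).
      + apply Rmult_le_compat_l; [nra | exact IH].
      + right. ring. }
  assert (hlen : forall i, (1 <= length (inc i))%nat).
  { intros i. destruct (increments_growth _ (hlev i)) as (_ & h1 & _). unfold inc. lia. }
  assert (hM1 : forall i, 1 <= INR (length (offsets inc 0 i))).
  { intros i. apply (le_INR 1). now apply length_offsets_pos. }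
  set (C0 := ln (qR k0)).
  assert (hm : forall i, 1 <= INR (length (inc i))) by (intros i; apply (le_INR 1), hlen).
  assert (hDp : forall i, 0 < D (S (lev i))) by (intros; apply cfD_pos).
  (* The first entry serves the branching condition, where [d_k] times the next denominator is at
     most 2; the second is what the mass bound leaves. *)
  set (kap := Rmin (/ 2) (exp (- (C0 / 2) - s * ln 2 + s * ln c0 / 2))).
  assert (hkap : 0 < kap /\ kap <= / 2 /\ kap <= exp (- (C0 / 2) - s * ln 2 + s * ln c0 / 2)).
  { unfold kap. repeat split; [apply Rmin_glb_lt; [lra | apply exp_pos] | apply Rmin_l | apply Rmin_r]. }
  apply (tree_not_null theta 1 s kap inc (fun i => Q (S (lev i)))
    (fun i => INR (length (inc i)) * D (S (lev i))) 1).
  - lra.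
  - nra.
  - apply hkap.
  - exact hlen.
  - intros i. exact (increments_NoDup (lev i) (hlev i)).
  - intros i c hc. apply (hnode i c hc).
  - intros i n n' hn hn' hne. eapply Rle_trans; [| now apply (cf_separated (lev i))].
    pose proof (cfQ_D_ge_half (lev i)) as h1.
    assert (h2 : 0 < qR (lev i)) by (apply lt_0_INR; pose proof (cfQ_pos (lev i)); lia).
    apply Rmult_le_reg_l with (2 * qR (lev i)); [lra |]. rewrite Rinv_r by lra. lra.
  - intros i c c' b b' hc hc' hb hb' heq.
    assert (h : (1 + c = 1 + c')%nat); [| lia].
    apply (block_injective (lev i) (1 + c) (1 + c') b b'); auto. lia.
  - intros i [| j] c hc.
    + destruct hc as [<- | []]. simpl (INR 0). rewrite Rmult_0_l, distZ_0.
      specialize (hm i). specialize (hDp i). nra.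
    + apply in_offsets_S in hc. destruct hc as (c1 & c2 & h1 & h2 & ->).
      exact (proj2 (block_tail (lev i) c1 c2 (hlev i) h1 (htail j (S i) c2 h2))).
  - intros i. specialize (hm i). specialize (hDp i). nra.
  - intros eps he. destruct (cfD_small (eps / 2)) as [n hn]; [lra |]. exists n.
    pose proof (increments_length_D (lev n) (hlev n)) as h1. fold (inc n) in h1.
    pose proof (hlevge n) as h2. specialize (hn (lev n) ltac:(lia)). lra.
  - intros i. eapply Rle_trans; [apply hkap |].
    specialize (hM1 i). specialize (hm i). specialize (hDp i).
    pose proof (hM (S i)) as hMS. rewrite length_offsets_S, mult_INR in hMS.
    pose proof (hM i) as hMi.
    destruct (increments_growth _ (hlev i)) as (_ & _ & _ & hgt).
    assert (hlev1 : (lev i < lev (S i))%nat) by exact hgt.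
    set (M := INR (length (offsets inc 0 i))) in *. set (m := INR (length (inc i))) in *.
    set (k := lev i) in *.
    assert (hQk : 1 <= qR k) by (apply (le_INR 1), cfQ_pos).
    assert (hQk0 : 1 <= qR k0) by (apply (le_INR 1), cfQ_pos).
    assert (hQ1 : 1 <= qR (S k)) by (apply (le_INR 1), cfQ_pos).
    assert (hQ2 : (qR (S k)) <= M * m * (M * m) * qR k0).
    { eapply Rle_trans; [| exact hMS]. apply le_INR, cfQ_mono. lia. }
    apply ln_Rle in hMi; [| lra]. apply ln_Rle in hQ2; [| lra].
    rewrite !ln_mult in hMi by (repeat apply Rmult_lt_0_compat; lra).
    rewrite !ln_mult in hQ2 by (repeat apply Rmult_lt_0_compat; lra). fold C0 in hMi, hQ2.
    assert (hDk : - ln 2 - ln (qR (S k)) <= ln (D (S k))).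
    { pose proof (cfQ_D_ge_half (S k)) as h1. apply ln_Rle in h1; [| lra].
      assert (h2 : 0 < qR (S k) * D (S k)) by (apply Rmult_lt_0_compat; lra).
      rewrite ln_1, !ln_mult in h1 by lra. lra. }
    assert (hDk' : ln c0 - w * ln (qR k) <= - ln (qR (S k))).
    { pose proof (hD k ltac:(unfold k; specialize (hlevge i); lia)) as h1.
      apply ln_Rle in h1; [| apply Rmult_lt_0_compat; [lra | apply Rpower_pos]].
      rewrite ln_mult, ln_Rpower in h1 by (try lra; apply Rpower_pos).
      pose proof (cfQ_D_le1 (S k)) as h2. apply ln_Rle in h2; [| nra].
      rewrite ln_mult, ln_1 in h2 by lra. lra. }
    assert (hA : 0 <= ln (qR k)) by now apply ln_ge0.
    rewrite <- (exp_ln (M * Rpower (m * D (S k)) s)).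
    2:{ apply Rmult_lt_0_compat; [lra | apply Rpower_pos]. }
    (* Write [M (m d_k)^s] as [M^(1-s) (M m)^s d_k^s]. Up to constants this is at least
       [q_k^((1-s)/2) q_(k+1)^(-s/2)], hence at least [q_k^((1 - s (1+w))/2)]. *)
    assert (hgoal : - (C0 / 2) - s * ln 2 + s * ln c0 / 2 <= ln (M * Rpower (m * D (S k)) s)).
    { rewrite ln_mult, ln_Rpower, ln_mult by (try lra; apply Rpower_pos).
      assert (h0 : 0 < s * w) by (apply Rmult_lt_0_compat; lra).
      assert (h1 : 0 <= 1 - s) by lra.
      apply (Rmult_le_compat_l (1 - s)) in hMi; [| exact h1].
      apply (Rmult_le_compat_l s) in hQ2, hDk, hDk'; [| lra ..].
      assert (h2 : 0 <= (1 - s * (1 + w)) * ln (qR k)) by (apply Rmult_le_pos; lra).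
      lra. }
    destruct hgoal as [h | h]; [left; now apply exp_increasing | right; now rewrite h].
  - intros i. rewrite length_offsets_S, mult_INR.
    destruct (increments_growth _ (hlev i)) as (_ & _ & h1 & _).
    apply le_INR in h1. rewrite mult_INR in h1. simpl (INR 2) in h1.
    change (lev (S i)) with (next (lev i)).
    pose proof (cfQ_D_le1 (S (lev i))) as h2. specialize (hM1 i). specialize (hm i). specialize (hDp i).
    set (M := INR (length (offsets inc 0 i))) in *. set (m := INR (length (inc i))) in *.
    assert (h3 : D (S (lev i)) * qR (next (lev i)) <= 2) by nra.
    apply Rle_trans with (M * m * (kap * (D (S (lev i)) * qR (next (lev i))))); [right; ring |].
    assert (h4 : kap * (D (S (lev i)) * qR (next (lev i))) <= 1).
    { apply Rle_trans with (kap * 2); [apply Rmult_le_compat_l; lra | lra]. }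
    assert (0 < M * m) by nra. nra.
  - intros i j c b rest m h1 h2 h3 hm'.
    rewrite (Rpower_Ropp (INR m) 1), Rpower_1 by (apply lt_0_INR; lia).
    apply (block_local (lev i) (1 + c) b rest m); auto.
    apply (htail j (S i)). exact h3.
Qed.

End TauOne.

(** * The case [tau < 1] *)

Section Density.

Context {theta : R} {Hth : irrational01 theta}.

Notation D := (cfD theta).
Notation Q := (cfQ theta).
Notation qR k := (INR (cfQ theta (S k))).

(* [n theta] is within [1 / q_k] of [n p_k / q_k], and [p_k] is invertible modulo [q_k]. *)
Lemma cf_density k y : exists n, (1 <= n <= Q (S k))%nat /\
  distZ (INR n * theta - y) <= 2 / qR k.
Proof.
  pose proof (cf_det theta k) as hdet. set (e := ((-1) ^ Z.of_nat k)%Z) in *.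
  assert (he : (e * e = 1)%Z) by apply sign_square.
  pose proof (cfQ_theta k) as hq. pose proof (cfQ_pos k) as hqp.
  pose proof (cfD_pos (S k)) as hd. pose proof (cfQ_D_le1 (S k)) as hd1.
  pose proof (le_INR _ _ (cfQ_mono_S (S k))) as hqm.
  set (q := Q (S k)) in *. set (p := cfP theta (S k)) in *.
  assert (hqr : 1 <= INR q) by (apply (le_INR 1); exact hqp).
  set (rho := Int_part (INR q * y)).
  destruct (base_Int_part (INR q * y)) as [hr1 hr2]. fold rho in hr1, hr2.
  (* By the determinant identity [- e q_(k-1)] inverts [p_k] modulo [q_k]. Subtracting 1 here and
     adding it back after the reduction puts [n] in [1 .. q_k] instead of [0 .. q_k - 1]. *)
  set (x := (- e * rho * Z.of_nat (Q k) - 1)%Z).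
  pose proof (Z.mod_pos_bound x (Z.of_nat q) ltac:(lia)) as hx.
  pose proof (Z.div_mod x (Z.of_nat q) ltac:(lia)) as hx2.
  set (n := Z.to_nat (x mod Z.of_nat q + 1)).
  assert (hn : Z.of_nat n = (x mod Z.of_nat q + 1)%Z) by (unfold n; lia).
  exists n. split; [lia |].
  set (z := (- e * rho * cfP theta k - x / Z.of_nat q * p)%Z).
  assert (hnp : (Z.of_nat n * p = rho + z * Z.of_nat q)%Z).
  { assert (h1 : Z.of_nat n = (- e * rho * Z.of_nat (Q k) - x / Z.of_nat q * Z.of_nat q)%Z).
    { rewrite hn. unfold x in hx2 |- *. lia. }
    assert (h2 : (p * Z.of_nat (Q k) = cfP theta k * Z.of_nat q - e)%Z) by lia.
    transitivity (- e * rho * (p * Z.of_nat (Q k)) - x / Z.of_nat q * p * Z.of_nat q)%Z.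
    { rewrite h1. ring. }
    rewrite h2. unfold z.
    transitivity (e * e * rho + (- e * rho * cfP theta k - x / Z.of_nat q * p) * Z.of_nat q)%Z; [ring |].
    rewrite he. ring. }
  apply (f_equal IZR) in hnp. rewrite plus_IZR, !mult_IZR, <- !INR_IZR_INZ in hnp.
  assert (hnth : INR n * theta - y = (IZR rho - INR q * y) / INR q + INR n / INR q * ((-1) ^ k * D (S k)) + IZR z).
  { apply (Rmult_eq_reg_l (INR q)); [| lra].
    replace (INR q * (INR n * theta - y)) with (INR n * (INR q * theta) - INR q * y) by ring.
    rewrite hq. field_simplify; [| lra]. rewrite hnp. ring. }
  rewrite hnth, distZ_addZ.
  eapply Rle_trans; [apply distZ_le_abs |]. eapply Rle_trans; [apply Rabs_triang |].
  assert (hnq : 0 <= INR n / INR q <= 1).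
  { assert (h1 : INR n <= INR q) by (apply le_INR; lia). pose proof (pos_INR n).
    split; [apply Rmult_le_pos; [lra | left; apply Rinv_0_lt_compat; lra] |].
    apply Rmult_le_reg_r with (INR q); [lra |]. unfold Rdiv. rewrite Rmult_assoc, Rinv_l; lra. }
  assert (h1 : Rabs ((IZR rho - INR q * y) / INR q) <= 1 / INR q).
  { unfold Rdiv. rewrite Rabs_mult, (Rabs_right (/ INR q)) by (apply Rle_ge; left; apply Rinv_0_lt_compat; lra).
    apply Rmult_le_compat_r; [left; apply Rinv_0_lt_compat; lra | apply Rabs_le; lra]. }
  assert (h2 : Rabs (INR n / INR q * ((-1) ^ k * D (S k))) <= 1 / INR q).
  { rewrite Rabs_mult, Rabs_pow_m1, (Rabs_right (INR n / INR q)), (Rabs_right (D (S k))) by lra.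
    apply Rle_trans with (1 * D (S k)); [apply Rmult_le_compat_r; lra |].
    apply Rmult_le_reg_l with (INR q); [lra |]. replace (INR q * (1 / INR q)) with 1 by (field; lra).
    rewrite Rmult_1_l. nra. }
  replace (2 / INR q) with (1 / INR q + 1 / INR q) by (field; lra). lra.
Qed.

(* Near each of the points [8 i / q_k] there is a multiple [n theta] with [n <= q_k]; replacing [n] by
   [q_k - n] when needed, one gets [n <= q_k / 2] and [||n theta||] still nearly [8 i / q_k]. *)
Lemma many_small_returns k delta : 0 < delta <= / 2 ->
  exists L, NoDup L /\ (forall c, In c L -> (2 * c <= Q (S k))%nat /\ distZ (INR c * theta) <= delta / 8) /\
    (1 <= length L)%nat /\ delta * qR k <= 128 * INR (length L).
Proof.
  intros hdel. pose proof (cfQ_pos k) as hqp.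
  pose proof (cf_distZ k) as hdz.
  assert (hqr : 1 <= qR k) by (apply (le_INR 1); exact hqp).
  assert (hDq : D (S k) <= / qR k).
  { apply inv_D_bound. pose proof (cfQ_mono_S (S k)). lia. }
  set (q := Q (S k)) in *.
  assert (hiq : 0 < / INR q) by (apply Rinv_0_lt_compat; lra).
  (* Targets are spaced by [8/q] and met within [3/q], so they stay distinct; for [1 <= i <= Rn] the
     distance is at most [11 i / q <= 11 delta / 128 < delta / 8]. *)
  destruct (nat_floor (delta * INR q / 128)) as [Rn [hR1 hR2]].
  { apply Rmult_le_pos; [nra | lra]. }
  (* Index 0 is sent to [c = 0] exactly, so the list is nonempty and correct even when [3/q] exceeds
     [delta / 8]. *)
  assert (Hf : forall i, exists c, (2 * c <= q)%nat /\
     ((i <= Rn)%nat -> Rabs (distZ (INR c * theta) - 8 * INR i * / INR q) <= 3 * / INR q) /\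
     (i = 0%nat -> c = 0%nat)).
  { intros [| i].
    - exists 0%nat. split; [lia |]. split; [| auto]. intros _. simpl (INR 0).
      rewrite Rmult_0_l, distZ_eq_abs, Rabs_R0 by (rewrite Rabs_R0; lra).
      rewrite Rmult_0_r, Rmult_0_l, Rminus_0_r, Rabs_R0. lra.
    - destruct (cf_density k (8 * INR (S i) * / INR q)) as [n [hn1 hn2]]. fold q in hn1, hn2.
      replace (2 / INR q) with (2 * / INR q) in hn2 by (field; lra).
      assert (hy : (S i <= Rn)%nat -> distZ (8 * INR (S i) * / INR q) = 8 * INR (S i) * / INR q).
      { intros hi. apply le_INR in hi. pose proof (pos_INR (S i)) as h0.
        assert (h1 : 0 <= 8 * INR (S i) * / INR q <= / 2).
        { split; [apply Rmult_le_pos; lra |].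
          apply Rmult_le_reg_r with (INR q); [lra |]. rewrite Rmult_assoc, Rinv_l by lra. nra. }
        rewrite distZ_eq_abs, Rabs_right; try lra. rewrite Rabs_right; lra. }
      assert (hclose : (S i <= Rn)%nat -> Rabs (distZ (INR n * theta) - 8 * INR (S i) * / INR q) <= 2 * / INR q).
      { intros hi. rewrite <- (hy hi).
        pose proof (distZ_add (INR n * theta - 8 * INR (S i) * / INR q) (8 * INR (S i) * / INR q)) as h1.
        pose proof (distZ_add (8 * INR (S i) * / INR q - INR n * theta) (INR n * theta)) as h2.
        rewrite distZ_sym in h2.
        replace (INR n * theta - 8 * INR (S i) * / INR q + 8 * INR (S i) * / INR q) with (INR n * theta) in h1 by ring.
        replace (8 * INR (S i) * / INR q - INR n * theta + INR n * theta) with (8 * INR (S i) * / INR q) in h2 by ring.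
        apply Rabs_le. lra. }
      destruct (Nat.le_gt_cases (2 * n) q) as [hle | hgt].
      + exists n. split; [exact hle |]. split; [| lia]. intros hi. specialize (hclose hi). lra.
      + exists (q - n)%nat. split; [lia |]. split; [| lia]. intros hi. specialize (hclose hi).
        rewrite minus_INR by lia.
        pose proof (distZ_sub (INR q * theta) (INR n * theta)) as h1.
        pose proof (distZ_sub (INR q * theta) ((INR q - INR n) * theta)) as h2.
        replace (INR q * theta - (INR q - INR n) * theta) with (INR n * theta) in h2 by ring.
        replace (INR q * theta - INR n * theta) with ((INR q - INR n) * theta) in h1 by ring.
        revert hclose. unfold Rabs. destruct (Rcase_abs _), (Rcase_abs _); lra. }
  apply choice in Hf. destruct Hf as [f hf].
  exists (map f (seq 0 (S Rn))).
  split; [| split; [| split]].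
  - assert (hinj : forall i j, (i <= Rn)%nat -> (j <= Rn)%nat -> f i = f j -> (i <= j)%nat).
    { intros i j hi hj hij. apply Nat.nlt_ge. intros hlt.
      destruct (hf i) as (_ & h1 & _). destruct (hf j) as (_ & h2 & _).
      specialize (h1 hi). specialize (h2 hj). rewrite hij in h1.
      apply le_INR in hlt. rewrite S_INR in hlt.
      assert (h3 : 8 * / INR q <= 8 * INR i * / INR q - 8 * INR j * / INR q) by nra.
      revert h1 h2. unfold Rabs. destruct (Rcase_abs _), (Rcase_abs _); lra. }
    apply NoDup_map_NoDup_ForallPairs; [| apply seq_NoDup].
    intros i j hi hj hij. apply in_seq in hi, hj.
    pose proof (hinj i j ltac:(lia) ltac:(lia) hij).
    pose proof (hinj j i ltac:(lia) ltac:(lia) (eq_sym hij)). lia.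
  - intros c hc. apply in_map_iff in hc. destruct hc as [i [<- hi]]. apply in_seq in hi.
    destruct (hf i) as (h1 & h2 & h3). split; [exact h1 |].
    destruct (Nat.eq_dec i 0) as [e | e].
    + rewrite (h3 e). simpl (INR 0). rewrite Rmult_0_l, distZ_0. lra.
    + specialize (h2 ltac:(lia)).
      assert (hi1 : 1 <= INR i) by (apply (le_INR 1); lia).
      assert (hi2 : INR i <= INR Rn) by (apply le_INR; lia).
      assert (h4 : INR i * / INR q <= delta / 128).
      { apply Rmult_le_reg_r with (INR q); [lra |]. rewrite Rmult_assoc, Rinv_l by lra. lra. }
      revert h2. unfold Rabs. destruct (Rcase_abs _); nra.
  - rewrite length_map, length_seq. lia.
  - rewrite length_map, length_seq, S_INR. lra.
Qed.

End Density.

Lemma first_from (P : nat -> Prop) (n : nat) : (exists k, (n <= k)%nat /\ P k) ->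
  exists k, (n <= k)%nat /\ P k /\ forall j, (n <= j < k)%nat -> ~ P j.
Proof.
  intros [k [hk hP]]. revert hP. remember (k - n)%nat as d eqn:hd. revert n hk hd.
  induction d as [| d IH]; intros n hk hd hP.
  - exists n. replace n with k by lia. repeat split; auto; lia.
  - destruct (classic (P n)) as [h | h].
    + exists n. repeat split; auto; lia.
    + destruct (IH (S n)) as (k' & h1 & h2 & h3); try lia; auto.
      exists k'. split; [lia |]. split; [exact h2 |]. intros j hj.
      destruct (Nat.eq_dec j n) as [-> | hne]; [exact h | apply h3; lia].
Qed.

Section TauLessOne.

Context {theta : R} {Hth : irrational01 theta}.

Notation D := (cfD theta).
Notation Q := (cfQ theta).
Notation qR k := (INR (cfQ theta (S k))).

Lemma signed_pos_of_distZ k c : exists x, signed_pos theta k c x /\ Rabs x = distZ (INR c * theta).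
Proof.
  destruct (distZ_attained (INR c * theta)) as [p hp].
  exists ((-1) ^ k * (INR c * theta - IZR p)). split.
  - exists p. destruct (pow_m1_cases k) as [-> | ->]; ring.
  - now rewrite Rabs_pow_m1.
Qed.

Lemma cfQ_ln_large x : exists k0, forall k, (k0 <= k)%nat -> x <= ln (qR k).
Proof.
  destruct (exists_nat_gt (exp x)) as [n hn]. exists n. intros k hk.
  rewrite <- (ln_exp x). apply ln_Rle; [apply exp_pos |].
  pose proof (le_INR _ _ (cfQ_ge k)). apply le_INR in hk. lra.
Qed.

(* Only at these levels does the condition defining [U_set tau theta] restrict the point. *)
Definition constraint (tau theta : R) (k : nat) : Prop :=
  INR (cfQ theta (S k)) < 2 * Rpower (INR (cfQ theta (S (S k)))) tau.

Lemma lnQ_ge0 k : 0 <= ln (qR k).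
Proof. apply ln_ge0. apply (le_INR 1), cfQ_pos. Qed.

Lemma lnQ_lnD k : ln (qR k) + ln (D k) <= 0 /\ 0 <= ln 2 + ln (qR k) + ln (D k).
Proof.
  pose proof (cfQ_ge1 k) as hq.
  pose proof (cfD_pos k) as hd.
  assert (hp : 0 < qR k * D k) by (apply Rmult_lt_0_compat; lra).
  pose proof (ln_Rle _ _ hp (cfQ_D_le1 k)) as h1.
  pose proof (ln_Rle 1 _ ltac:(lra) (cfQ_D_ge_half k)) as h2.
  rewrite !ln_mult in h2 by lra. rewrite ln_mult in h1 by lra. rewrite ln_1 in *. lra.
Qed.

(* The digits [b] at a constraint level [k], up to about [(d_k q_k^tau) ^ (- 1 / (1 + tau))]. *)
Lemma constraint_digit_bound tau k : 0 < tau < 1 -> constraint tau theta k ->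
  ln 16 + ln 2 / tau <= (1 / tau - 1) * ln (qR k) ->
  exists B : nat,
    - ln 32 - / (1 + tau) * (ln (D (S k)) + tau * ln (qR k)) <= ln (INR (B + 1)) /\
    INR (B + 1) * D (S k) * qR k <= / 8 /\
    ((1 <= B)%nat -> INR (B + 1) * D (S k) <= Rpower (INR (B + 1) * qR k) (- tau)).
Proof.
  intros ht hc hlarge.
  pose proof (lnQ_lnD (S k)) as [hl1 hl2].
  pose proof (cfD_pos (S k)) as hd.
  pose proof (cfQ_ge1 k) as hq.
  assert (hcl : ln (qR k) <= ln 2 + tau * ln (qR (S k))).
  { unfold constraint in hc. apply Rlt_le, ln_Rle in hc; [| lra].
    rewrite ln_mult, ln_Rpower in hc by (try lra; apply Rpower_pos). exact hc. }
  set (A := ln (qR k)) in *. set (A1 := ln (qR (S k))) in *. set (d := ln (D (S k))) in *.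
  set (X := exp (- ln 32 - / (1 + tau) * (d + tau * A))).
  assert (hX : 0 < X) by apply exp_pos.
  destruct (nat_floor X) as [B [hB1 hB2]]; [lra |].
  assert (hln32 : ln 32 = 2 * ln 4 + ln 2).
  { replace 32 with (4 * 4 * 2) by ring. rewrite !ln_mult by lra. ring. }
  assert (hln16 : ln 16 = 2 * ln 4).
  { replace 16 with (4 * 4) by ring. rewrite !ln_mult by lra. ring. }
  assert (hln4 : ln 4 = 2 * ln 2).
  { replace 4 with (2 * 2) by ring. rewrite !ln_mult by lra. ring. }
  assert (hln2 : 0 < ln 2) by (rewrite <- ln_1; apply ln_increasing; lra).
  assert (hti : 0 < / (1 + tau) < 1).
  { split; [apply Rinv_0_lt_compat; lra |]. rewrite <- Rinv_1. apply Rinv_lt_contravar; lra. }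
  exists B. split; [| split].
  - rewrite plus_INR. simpl (INR 1). rewrite <- (ln_exp (- ln 32 - _)). fold X. apply ln_Rle; lra.
  - (* [X d_k q_k <= 1/16] since [d_k^tau q_k < 2], and [d_k q_k <= 1/16]. *)
    assert (h1 : X * (D (S k) * qR k) <= / 16).
    { assert (h0 : 0 < D (S k) * qR k) by (apply Rmult_lt_0_compat; lra).
      apply ln_Rle_inv; [apply Rmult_lt_0_compat; lra | lra |].
      rewrite !ln_mult by lra. unfold X. rewrite ln_exp, ln_Rinv by lra. fold d A.
      assert (h2 : tau * d + A <= ln 2) by nra.
      replace (- ln 32 - / (1 + tau) * (d + tau * A) + (d + A))
        with (- ln 32 + / (1 + tau) * (tau * d + A)) by (field; lra).
      nra. }
    assert (h2 : D (S k) * qR k <= / 16).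
    { apply ln_Rle_inv; [apply Rmult_lt_0_compat; lra | lra |].
      rewrite !ln_mult, ln_Rinv by lra. fold d A.
      assert (h3 : / tau * A <= / tau * ln 2 + A1).
      { replace A1 with (/ tau * (tau * A1)) by (field; lra).
        rewrite <- Rmult_plus_distr_l. apply Rmult_le_compat_l; [left; apply Rinv_0_lt_compat; lra | exact hcl]. }
      unfold Rdiv in hlarge. lra. }
    rewrite plus_INR. simpl (INR 1). nra.
  (* Once [B >= 1], rounding costs at most a factor 2, as [B + 1 <= 2 X]. For [B = 0] the only digit
     is 0 and nothing has to be approximated. *)
  - intros hB. apply (le_INR 1) in hB. simpl (INR 1) in hB.
    assert (hB' : 0 < INR (B + 1) <= 2 * X) by (rewrite plus_INR; simpl (INR 1); lra).
    apply ln_Rle_inv; [apply Rmult_lt_0_compat; lra | apply Rpower_pos |].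
    rewrite ln_Rpower, !ln_mult by lra. fold d A.
    assert (h1 : ln (INR (B + 1)) <= ln 2 + (- ln 32 - / (1 + tau) * (d + tau * A))).
    { rewrite <- (ln_exp (- ln 32 - _)), <- ln_mult by (try lra; apply exp_pos). fold X. apply ln_Rle; lra. }
    apply (Rmult_le_compat_l (1 + tau)) in h1; [| lra].
    replace ((1 + tau) * (ln 2 + (- ln 32 - / (1 + tau) * (d + tau * A))))
      with ((1 + tau) * (ln 2 - ln 32) - (d + tau * A)) in h1 by (field; lra).
    nra.
Qed.

(** Up to [q_(k+1)] the digit bound does the work, as at [tau = 1] but with the crude error
    [(B + 1) d_k]. Further on, all levels are unconstrained and density of the multiples
    suffices. *)
Lemma stage_local tau k k' B N b rest m : 0 < tau < 1 -> (k < k')%nat ->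
  (forall j, (S k <= j < k')%nat -> ~ constraint tau theta j) ->
  ((1 <= B)%nat -> INR (B + 1) * D (S k) <= Rpower (INR (B + 1) * qR k) (- tau)) ->
  (1 <= N <= Q (S k))%nat -> (b <= B)%nat -> distZ (INR rest * theta) <= D (S k) / 2 ->
  (Q (S k) < m <= Q (S k'))%nat -> ((B + 1) * Q (S k) <= Q (S (S k)))%nat ->
  exists n, (1 <= n < m)%nat /\
    distZ (INR n * theta - INR (N + b * Q (S k) + rest) * theta) <= Rpower (INR m) (- tau).
Proof.
  intros ht hkk hfree hB hN hb hrest hm hBQ.
  pose proof (cfD_pos (S k)) as hd.
  assert (hm1 : 1 < INR m) by (apply (lt_INR 1); lia).
  destruct (Nat.le_gt_cases m (Q (S (S k)))) as [hle | hgt].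
  - destruct (signed_pos_of_distZ k rest) as (v & hv & hv2).
    destruct (signed_pos_exists theta k N) as [x hx].
    assert (ht' : signed_pos theta k (N + b * Q (S k) + rest) (x + INR b * D (S k) + v)).
    { repeat apply signed_pos_add; auto. apply signed_pos_mul_q. }
    destruct (Nat.lt_ge_cases (N + b * Q (S k)) m) as [hlt | hge].
    + exists (N + b * Q (S k))%nat. split; [lia |].
      eapply Rle_trans; [apply (signed_pos_distZ_sub k _ _ (x + INR b * D (S k)) (x + INR b * D (S k) + v)) |].
      * apply signed_pos_add; [exact hx | apply signed_pos_mul_q].
      * exact ht'.
      * replace (x + INR b * D (S k) + v - (x + INR b * D (S k))) with v by ring.
        apply Rle_trans with (/ INR m).
        -- apply Rle_trans with (D (S k)); [lra | apply inv_D_bound; lia].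
        -- rewrite Rpower_Ropp. apply Rinv_le_contravar; [apply Rpower_pos |].
           rewrite <- (Rpower_1 (INR m)) at 2 by lra. apply Rle_Rpower; lra.
    + set (j := ((m - 1 - N) / Q (S k))%nat).
      assert (hj1 : (N + j * Q (S k) < m <= N + (j + 1) * Q (S k))%nat).
      { pose proof (Nat.div_mod (m - 1 - N) (Q (S k)) ltac:(lia)) as h1. fold j in h1.
        pose proof (Nat.mod_upper_bound (m - 1 - N) (Q (S k)) ltac:(lia)) as h2. nia. }
      assert (hj2 : (j < b)%nat) by nia.
      exists (N + j * Q (S k))%nat. split; [lia |].
      eapply Rle_trans; [apply (signed_pos_distZ_sub k _ _ (x + INR j * D (S k)) (x + INR b * D (S k) + v)) |].
      * apply signed_pos_add; [exact hx | apply signed_pos_mul_q].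
      * exact ht'.
      * replace (x + INR b * D (S k) + v - (x + INR j * D (S k))) with ((INR b - INR j) * D (S k) + v) by ring.
        assert (hjr : INR j < INR b) by (apply lt_INR; lia).
        assert (hbr : INR b <= INR B) by (apply le_INR; lia).
        pose proof (pos_INR j) as hj0.
        apply Rle_trans with (INR (B + 1) * D (S k)).
        -- eapply Rle_trans; [apply Rabs_triang |]. rewrite Rabs_right by nra.
           rewrite plus_INR. simpl (INR 1). nra.
        -- eapply Rle_trans; [apply hB; lia |]. rewrite !Rpower_Ropp.
           apply Rinv_le_contravar; [apply Rpower_pos |].
           apply Rle_Rpower_l; [lra |]. split; [lra |].
           rewrite <- mult_INR. apply le_INR. nia.
  (* Locate [m] in [(q_j, q_(j+1)]]. Failure of the constraint at [j] reads
     [2 / q_j <= q_(j+1)^(-tau) <= m^(-tau)], and [2 / q_j] is the density radius. *)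
  - destruct (discrete_crossing (fun i => (m <= Q (S (S k + i)))%nat) (k' - S k)) as (i & hi1 & hi2 & hi3).
    + rewrite Nat.add_0_r. lia.
    + replace (S k + (k' - S k))%nat with k' by lia. lia.
    + replace (S k + S i)%nat with (S (S k + i)) in hi3 by lia.
      set (j := (S k + i)%nat) in *.
      destruct (cf_density j (INR (N + b * Q (S k) + rest) * theta)) as (n & hn1 & hn2).
      exists n. split; [lia |]. eapply Rle_trans; [exact hn2 |].
      pose proof (hfree j ltac:(lia)) as hf. unfold constraint in hf. apply Rnot_lt_le in hf.
      assert (hqj : 0 < qR j) by (apply lt_0_INR; pose proof (cfQ_pos j); lia).
      assert (hpm : Rpower (INR m) tau <= Rpower (qR (S j)) tau).
      { apply Rle_Rpower_l; [lra |]. split; [lra | apply le_INR; exact hi3]. }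
      rewrite Rpower_Ropp. pose proof (Rpower_pos (INR m) tau) as hp.
      apply Rmult_le_reg_r with ((qR j) * Rpower (INR m) tau).
      { apply Rmult_lt_0_compat; lra. }
      replace (2 / qR j * ((qR j) * Rpower (INR m) tau)) with (2 * Rpower (INR m) tau) by (field; lra).
      replace (/ Rpower (INR m) tau * ((qR j) * Rpower (INR m) tau)) with (qR j) by (field; lra).
      lra.
Qed.

End TauLessOne.

Fixpoint iterate_level (nxt : nat -> nat) (k0 i : nat) : nat :=
  match i with O => nxt k0 | S j => nxt (S (iterate_level nxt k0 j)) end.

Lemma ln2_pos : 0 < ln 2.
Proof. rewrite <- ln_1. apply ln_increasing; lra. Qed.

(* With [A = ln q_k], [d = ln d_k] and [A' = ln q_k'] the logarithms at successive constraint levels: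
   the expression is linear in [d], hence minimal at one end of [- w A <= d <= - A]. *)
Lemma growth_exponent (t w beta : R) : 0 < t -> 2 * t < 1 -> 0 <= beta < 1 ->
  0 < (beta - t) + (1 - beta - t) * w ->
  exists g, 0 < g /\ forall A d A' c, 0 <= A -> A <= - d -> - d <= w * A + c -> - d - ln 2 <= A' -> 0 <= c ->
    g * A - c - ln 2 <= (beta - t) * A + t * d + (1 - beta) * A'.
Proof.
  intros ht ht2 hb hg. pose proof ln2_pos as hln2.
  exists (Rmin (1 - 2 * t) ((beta - t) + (1 - beta - t) * w)).
  split; [apply Rmin_glb_lt; lra |].
  intros A d A' c hA h1 h2 h3 hc.
  assert (hm1 := Rmin_l (1 - 2 * t) ((beta - t) + (1 - beta - t) * w)).
  assert (hm2 := Rmin_r (1 - 2 * t) ((beta - t) + (1 - beta - t) * w)).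
  set (g := Rmin _ _) in *.
  apply (Rmult_le_compat_r A) in hm1, hm2; [| exact hA ..].
  apply (Rmult_le_compat_l (1 - beta)) in h3; [| lra].
  assert (h4 : 0 <= beta * ln 2) by (apply Rmult_le_pos; lra).
  destruct (Rle_dec 0 (1 - beta - t)) as [h | h].
  - apply (Rmult_le_compat_l (1 - beta - t)) in h1; [| exact h]. lra.
  - apply (Rmult_le_compat_l (beta + t - 1)) in h2; [| lra].
    assert (h5 : (beta + t - 1) * c <= 1 * c) by (apply Rmult_le_compat_r; lra). lra.
Qed.

Section TauLessOneTree.

Context {theta : R} {Hth : irrational01 theta}.

Notation D := (cfD theta).
Notation Q := (cfQ theta).
Notation qR k := (INR (cfQ theta (S k))).

(** A stage leads from one constraint level to the next. There are at least about [q_k^beta] nodes,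
    and the scale [(B + 1) d_k] is at least about [(d_k/q_k)^t], that is [q_k^(-(1+w) t)] up to
    constants; [beta = s t (1+w)] makes nodes times scale to the power [s] bounded below. *)
Theorem U_set_lt_one_not_null (tau s w c0 : R) (k1 : nat) : 0 < tau < 1 -> 1 < tau * w -> 0 < s ->
  s * (tau * (w * w - 1)) < w - tau -> 0 < c0 ->
  (forall k, (k1 <= k)%nat -> c0 * Rpower (qR k) (- w) <= D (S k)) ->
  (forall n, exists k, (n <= k)%nat /\ constraint tau theta k) ->
  ~ hausdorff_null s (U_set tau theta).
Proof.
  intros ht htw hs hsw hc0 hD hinf.
  pose proof ln2_pos as hln2.
  assert (hw : 1 < w) by nra.
  set (t := tau / (1 + tau)).
  assert (htdef : t * (1 + tau) = tau) by (unfold t; field; lra).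
  assert (htt : 0 < t) by (unfold t; apply Rdiv_lt_0_compat; lra).
  assert (ht2 : 2 * t < 1) by nra.
  set (beta := s * t * (1 + w)).
  assert (hbeta0 : 0 < beta) by (unfold beta; apply Rmult_lt_0_compat; [now apply Rmult_lt_0_compat | lra]).
  assert (hbw : beta * ((1 + tau) * (w - 1)) = s * (tau * (w * w - 1))).
  { unfold beta. replace (s * t * (1 + w) * ((1 + tau) * (w - 1)))
      with (s * ((t * (1 + tau)) * (w * w - 1))) by ring.
    now rewrite htdef. }
  assert (hbeta1 : beta < 1).
  { apply Rmult_lt_reg_r with ((1 + tau) * (w - 1)); [apply Rmult_lt_0_compat; lra |]. rewrite hbw. lra. }
  assert (hs1 : s < 1).
  { apply Rmult_lt_reg_r with (tau * (w * w - 1)); [apply Rmult_lt_0_compat; nra |]. nra. }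
  assert (hg : 0 < (beta - t) + (1 - beta - t) * w).
  { apply Rmult_lt_reg_r with (1 + tau); [lra |]. rewrite Rmult_0_l.
    replace ((beta - t + (1 - beta - t) * w) * (1 + tau))
      with (w * (1 + tau) - (1 + w) * (t * (1 + tau)) - beta * ((1 + tau) * (w - 1))) by ring.
    rewrite hbw, htdef. lra. }
  destruct (growth_exponent t w beta htt ht2 ltac:(lra) hg) as (g & hg0 & hgrowth).
  set (cc := Rmax 0 (- ln c0)).
  assert (hcc : 0 <= cc /\ - ln c0 <= cc) by (unfold cc; split; [apply Rmax_l | apply Rmax_r]).
  destruct (cfQ_ln_large ((ln 16 + ln 2 / tau) / (1 / tau - 1))) as [k2 hk2].
  (* From here on the gain [g ln q_k] beats all losses of a stage: [4096 = 32 * 128], a factor 32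
     from counting digits and 128 from counting small returns. *)
  destruct (cfQ_ln_large ((cc + ln 2 + ln 4096) / g)) as [k3 hk3].
  set (k0 := (k1 + k2 + k3)%nat).
  assert (Hn : forall n, exists k, (n <= k)%nat /\ constraint tau theta k /\
     forall j, (n <= j < k)%nat -> ~ constraint tau theta j).
  { intros n. apply first_from, hinf. }
  apply choice in Hn. destruct Hn as [nxt hnxt].
  set (lev := iterate_level nxt k0).
  assert (hlevS : forall i, lev (S i) = nxt (S (lev i))) by reflexivity.
  assert (hlev : forall i, (k0 + i <= lev i)%nat).
  { induction i as [| i IH]; [unfold lev; simpl; destruct (hnxt k0); lia |].
    rewrite hlevS. destruct (hnxt (S (lev i))). lia. }
  assert (hlt : forall i, (lev i < lev (S i))%nat).
  { intros i. rewrite hlevS. destruct (hnxt (S (lev i))). lia. }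
  assert (hcon : forall i, constraint tau theta (lev i)).
  { intros [| i]; [apply (hnxt k0) | rewrite hlevS; apply hnxt]. }
  assert (hfree : forall i j, (S (lev i) <= j < lev (S i))%nat -> ~ constraint tau theta j).
  { intros i j. rewrite hlevS. apply hnxt. }
  clearbody lev. clear hlevS hnxt nxt.
  assert (HB : forall i, exists B, - ln 32 - / (1 + tau) * (ln (D (S (lev i))) + tau * ln (qR (lev i))) <= ln (INR (B + 1)) /\
    INR (B + 1) * D (S (lev i)) * qR (lev i) <= / 8 /\
    ((1 <= B)%nat -> INR (B + 1) * D (S (lev i)) <= Rpower (INR (B + 1) * qR (lev i)) (- tau))).
  { intros i. apply constraint_digit_bound; auto.
    specialize (hk2 (lev i) ltac:(specialize (hlev i); unfold k0 in *; lia)).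
    assert (h1 : 0 < 1 / tau - 1).
    { assert (1 < 1 / tau); [| lra]. apply Rmult_lt_reg_r with tau; [lra |].
      replace (1 / tau * tau) with 1 by (field; lra). lra. }
    apply (Rmult_le_compat_l (1 / tau - 1)) in hk2; [| lra].
    replace ((1 / tau - 1) * ((ln 16 + ln 2 / tau) / (1 / tau - 1))) with (ln 16 + ln 2 / tau) in hk2; [exact hk2 |].
    field. split; lra. }
  apply choice in HB. destruct HB as [B hB].
  assert (hq1 : forall i, 1 <= qR (lev i)) by (intros i; apply (le_INR 1), cfQ_pos).
  assert (hdp : forall i, 0 < D (S (lev i))) by (intros i; apply cfD_pos).
  assert (hBr : forall i, 1 <= INR (B i + 1)).
  { intros i. apply (le_INR 1). lia. }
  assert (hell : forall i, D (S (lev i)) <= INR (B i + 1) * D (S (lev i)) /\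
     INR (B i + 1) * D (S (lev i)) <= / 8 * / qR (lev i)).
  { intros i. destruct (hB i) as (_ & h & _). specialize (hq1 i). specialize (hdp i). specialize (hBr i).
    split; [nra |]. apply Rmult_le_reg_r with (qR (lev i)); [lra |].
    rewrite (Rmult_assoc (/ 8)), Rinv_l; lra. }
  assert (hq8 : forall i, / qR (lev i) <= 1).
  { intros i. rewrite <- Rinv_1. apply Rinv_le_contravar; [lra | apply hq1]. }
  assert (HL : forall i, exists L, NoDup L /\
    (forall c, In c L -> (2 * c <= Q (S (lev (S i))))%nat /\ distZ (INR c * theta) <= D (S (lev i)) / 8) /\
    (1 <= length L)%nat /\ D (S (lev i)) * qR (lev (S i)) <= 128 * INR (length L)).
  { intros i. apply many_small_returns. specialize (hdp i). specialize (hell i). specialize (hq8 i). lra. }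
  apply choice in HL. destruct HL as [L hL].
  assert (hBQ : forall i, (4 * ((B i + 1) * Q (S (lev i))) <= Q (S (S (lev i))))%nat).
  { intros i. apply INR_le. rewrite !mult_INR. simpl (INR 4).
    destruct (hB i) as (_ & h & _). pose proof (cfQ_D_ge_half (S (lev i))) as h1. specialize (hdp i).
    apply Rmult_le_reg_r with (D (S (lev i))); [exact hdp |]. lra. }
  assert (hQQ : forall i, (Q (S (S (lev i))) <= Q (S (lev (S i))))%nat).
  { intros i. apply cfQ_mono. specialize (hlt i). lia. }
  set (digits := fun i => map (fun b => (b * Q (S (lev i)))%nat) (seq 0 (B i + 1))).
  (* A digit of level [k] is followed by a small return, which spreads the node over about
     [d_k q_k'] positions within [d_k / 8], where [k'] is the next constraint level. *)
  set (inc := fun i => flat_map (fun c => map (Nat.add c) (L i)) (digits i)).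
  assert (hdig : forall i c, In c (digits i) -> exists b, (b <= B i)%nat /\ c = (b * Q (S (lev i)))%nat).
  { intros i c hc. apply in_map_iff in hc. destruct hc as [b [<- hb]]. apply in_seq in hb.
    exists b. split; [lia | reflexivity]. }
  assert (hinc : forall i c, In c (inc i) -> exists b c', (b <= B i)%nat /\ In c' (L i) /\ c = (b * Q (S (lev i)) + c')%nat).
  { intros i c hc. apply in_flat_map in hc. destruct hc as [c1 [h1 h2]].
    apply in_map_iff in h2. destruct h2 as [c' [<- h2]].
    destruct (hdig i c1 h1) as [b [hb ->]]. exists b, c'. auto. }
  assert (hlen : forall i, length (inc i) = ((B i + 1) * length (L i))%nat).
  { intros i. unfold inc. rewrite (length_flat_map_const _ (length (L i))) by (intros; apply length_map).
    unfold digits. rewrite length_map, length_seq. reflexivity. }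
  set (ell := fun i => INR (B i + 1) * D (S (lev i))).
  assert (hellS : forall i, ell (S i) <= D (S (lev i)) / 4).
  { intros i. unfold ell. destruct (hell (S i)) as [_ h]. eapply Rle_trans; [exact h |].
    pose proof (cfQ_D_ge_half (S (lev i))) as h1. specialize (hdp i).
    pose proof (le_INR _ _ (hQQ i)) as h2. specialize (hq1 (S i)).
    apply Rmult_le_reg_r with (qR (lev (S i))); [lra |]. rewrite Rmult_assoc, Rinv_l by lra. nra. }
  assert (htail : forall j i c, In c (offsets inc i j) -> distZ (INR c * theta) <= ell i).
  { induction j as [| j IH]; intros i c hc.
    - destruct hc as [<- | []]. simpl (INR 0). rewrite Rmult_0_l, distZ_0. unfold ell.
      specialize (hBr i). specialize (hdp i). nra.
    - apply in_offsets_S in hc. destruct hc as (c1 & c2 & h1 & h2 & ->).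
      destruct (hinc i c1 h1) as (b & c' & hb & hc' & ->).
      specialize (IH (S i) c2 h2). specialize (hellS i).
      destruct (hL i) as (_ & h3 & _). destruct (h3 c' hc') as [_ h4].
      rewrite !plus_INR, mult_INR.
      replace ((INR b * qR (lev i) + INR c' + INR c2) * theta)
        with (INR b * ((qR (lev i)) * theta) + (INR c' * theta + INR c2 * theta)) by ring.
      eapply Rle_trans; [apply distZ_add |].
      pose proof (distZ_add (INR c' * theta) (INR c2 * theta)) as h5.
      pose proof (distZ_nmul b ((qR (lev i)) * theta)) as h6.
      pose proof (cf_distZ (lev i)) as h7. apply (Rmult_le_compat_l (INR b)) in h7; [| apply pos_INR].
      apply le_INR in hb. unfold ell. rewrite plus_INR. simpl (INR 1). specialize (hdp i).
      apply (Rmult_le_compat_r (D (S (lev i)))) in hb; lra. }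
  (* Distinct points [(N + b q_k) theta] are [d_k] apart, further than the small returns reach. *)
  assert (hsepA : forall i X X' c c', (1 <= X <= (B i + 1) * Q (S (lev i)))%nat ->
     (1 <= X' <= (B i + 1) * Q (S (lev i)))%nat -> In c (L i) -> In c' (L i) -> (X + c = X' + c')%nat -> X = X').
  { intros i X X' c c' hX hX' hc hc' heq. apply NNPP. intros hne.
    destruct (hL i) as (_ & h3 & _). destruct (h3 c hc) as [_ h4]. destruct (h3 c' hc') as [_ h5].
    specialize (hBQ i).
    pose proof (cf_separated (S (lev i)) X X' ltac:(lia) ltac:(lia) hne) as h6.
    assert (h7 : INR X * theta - INR X' * theta = INR c' * theta - INR c * theta).
    { apply (f_equal INR) in heq. rewrite !plus_INR in heq.
      replace (INR X) with (INR X' + INR c' - INR c) by lra. ring. }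
    rewrite h7 in h6. pose proof (distZ_sub (INR c' * theta) (INR c * theta)) as h8. specialize (hdp i). lra. }
  assert (hnode : forall i c, In c (offsets inc 0 i) -> (1 <= 1 + c <= Q (S (lev i)))%nat).
  { induction i as [| i IH]; intros c hc.
    - destruct hc as [<- | []]. pose proof (cfQ_pos (lev 0%nat)). lia.
    - destruct (in_offsets_last inc i c hc) as (c1 & c2 & h1 & h2 & ->).
      destruct (hinc i c2 h2) as (b & c' & hb & hc' & ->).
      specialize (IH c1 h1). destruct (hL i) as (_ & h3 & _). destruct (h3 c' hc') as [h4 _].
      specialize (hBQ i). specialize (hQQ i). nia. }
  set (mu := fun i => ln (INR (length (offsets inc 0 i)))).
  assert (hlnD : forall i, - ln (D (S (lev i))) <= w * ln (qR (lev i)) + cc).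
  { intros i. pose proof (hD (lev i) ltac:(specialize (hlev i); unfold k0 in *; lia)) as h1.
    apply ln_Rle in h1; [| apply Rmult_lt_0_compat; [lra | apply Rpower_pos]].
    rewrite ln_mult, ln_Rpower in h1 by (try lra; apply Rpower_pos). lra. }
  assert (hBln : forall i, - ln 32 - ln (D (S (lev i))) + t * ln (D (S (lev i))) - t * ln (qR (lev i))
     <= ln (INR (B i + 1))).
  { intros i. destruct (hB i) as (h & _). eapply Rle_trans; [| exact h]. right. unfold t. field. lra. }
  assert (hlenp : forall i, (1 <= length (inc i))%nat).
  { intros i. rewrite hlen. destruct (hL i) as (_ & _ & h & _). nia. }
  assert (hMp : forall i, 1 <= INR (length (offsets inc 0 i))).
  { intros i. apply (le_INR 1). now apply length_offsets_pos. }
  (* Digits and returns multiply the count by about [d_k^t q_k^(-t) q_k']; [growth_exponent] says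
     that this carries [q_k^beta] to at least [q_k'^beta]. *)
  assert (hmu : forall i, beta * ln (qR (lev i)) - beta * ln (qR (lev 0%nat)) <= mu i).
  { induction i as [| i IH]; [unfold mu; simpl; rewrite ln_1; lra |].
    assert (hmuS : mu (S i) = mu i + ln (INR (B i + 1)) + ln (INR (length (L i)))).
    { unfold mu. rewrite length_offsets_S, hlen, !mult_INR.
      destruct (hL i) as (_ & _ & h & _). apply (le_INR 1) in h. simpl (INR 1) in h.
      specialize (hMp i). specialize (hBr i). rewrite !ln_mult; try lra. apply Rmult_lt_0_compat; lra. }
    rewrite hmuS.
    destruct (hL i) as (_ & _ & h1 & h2). apply (le_INR 1) in h1. simpl (INR 1) in h1.
    pose proof (hdp i) as hd. pose proof (hq1 i) as hqi. pose proof (hq1 (S i)) as hqi1.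
    apply ln_Rle in h2; [| apply Rmult_lt_0_compat; lra]. rewrite !ln_mult in h2 by lra.
    specialize (hBln i).
    assert (h4096 : ln 4096 = ln 32 + ln 128) by (rewrite <- ln_mult by lra; f_equal; ring).
    pose proof (hk3 (lev i) ltac:(specialize (hlev i); unfold k0 in *; lia)) as h3.
    apply (Rmult_le_compat_l g) in h3; [| lra].
    replace (g * ((cc + ln 2 + ln 4096) / g)) with (cc + ln 2 + ln 4096) in h3 by (field; lra).
    pose proof (hgrowth (ln (qR (lev i))) (ln (D (S (lev i)))) (ln (qR (lev (S i)))) cc) as h4.
    pose proof (lnQ_lnD (S (lev i))) as [h5 h6].
    assert (h7 : ln (qR (lev i)) <= ln (qR (S (lev i)))).
    { apply ln_Rle; [lra | apply le_INR, cfQ_mono_S]. }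
    assert (h8 : ln (qR (S (lev i))) <= ln (qR (lev (S i)))).
    { apply ln_Rle; [apply lt_0_INR; pose proof (cfQ_pos (S (lev i))); lia | apply le_INR, hQQ]. }
    specialize (h4 (lnQ_ge0 _) ltac:(lra) (hlnD i) ltac:(lra) ltac:(lra)).
    lra. }
  set (c1 := exp (- (beta * ln (qR (lev 0%nat))) - s * ln 32 - s * t * cc)).
  assert (hc1 : 0 < c1) by apply exp_pos.
  set (kap := Rmin (/ 128) c1).
  assert (hkap : 0 < kap /\ kap <= / 128 /\ kap <= c1).
  { unfold kap. repeat split; [apply Rmin_glb_lt; lra | apply Rmin_l | apply Rmin_r]. }
  apply (tree_not_null theta tau s kap inc (fun i => Q (S (lev i))) ell 1).
  - lra.
  - lra.
  - apply hkap.
  - exact hlenp.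
  - intros i. unfold inc. destruct (hL i) as (h1 & _). apply NoDup_sums; [| exact h1 |].
    + unfold digits. apply Injective_map_NoDup; [| apply seq_NoDup].
      pose proof (cfQ_pos (lev i)). intros x y hxy. nia.
    + intros c c' b b' hc hc' hb hb' heq.
      destruct (hdig i c hc) as [e [he ->]]. destruct (hdig i c' hc') as [e' [he' ->]].
      pose proof (cfQ_pos (lev i)).
      assert (h : (1 + e * Q (S (lev i)) = 1 + e' * Q (S (lev i)))%nat); [| lia].
      apply (hsepA i _ _ b b'); auto; nia.
  - exact hnode.
  - intros i n n' hn hn' hne. eapply Rle_trans; [| now apply (cf_separated (lev i))].
    pose proof (cfQ_D_ge_half (lev i)) as h1. specialize (hq1 i).
    apply Rmult_le_reg_l with (2 * qR (lev i)); [lra |]. rewrite Rinv_r by lra. lra.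
  - intros i c c' b b' hc hc' hb hb' heq.
    destruct (hinc i b hb) as (e & r & he & hr & ->). destruct (hinc i b' hb') as (e' & r' & he' & hr' & ->).
    pose proof (hnode i c hc) as h1. pose proof (hnode i c' hc') as h2.
    assert (h : (1 + c + e * Q (S (lev i)) = 1 + c' + e' * Q (S (lev i)))%nat).
    { apply (hsepA i _ _ r r'); auto; nia. }
    destruct (Nat.lt_trichotomy e e') as [h3 | [h3 | h3]]; nia.
  - intros i j. apply htail.
  - intros i. unfold ell. specialize (hBr i). specialize (hdp i). nra.
  - intros eps he. destruct (cfD_small eps he) as [n hn]. exists n.
    specialize (hn (lev n) ltac:(specialize (hlev n); lia)).
    pose proof (cfQ_D_ge_half (lev n)) as h1. destruct (hell n) as [_ h2]. specialize (hq1 n).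
    unfold ell.
    assert (h4 : / qR (lev n) <= 2 * D (lev n)).
    { apply Rmult_le_reg_r with (qR (lev n)); [lra |]. rewrite Rinv_l; lra. }
    lra.
  - intros i. apply Rle_trans with c1; [apply hkap |].
    specialize (hMp i). specialize (hmu i). specialize (hBln i). specialize (hlnD i).
    assert (hep : 0 < ell i) by (unfold ell; specialize (hBr i); specialize (hdp i); nra).
    rewrite <- (exp_ln (INR (length (offsets inc 0 i)) * Rpower (ell i) s)).
    2:{ apply Rmult_lt_0_compat; [lra | apply Rpower_pos]. }
    rewrite ln_mult, ln_Rpower by (try lra; apply Rpower_pos). fold (mu i).
    assert (hle : ln (ell i) = ln (INR (B i + 1)) + ln (D (S (lev i)))).
    { unfold ell. specialize (hBr i). specialize (hdp i). apply ln_mult; lra. }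
    rewrite hle.
    assert (h : - (beta * ln (qR (lev 0%nat))) - s * ln 32 - s * t * cc
       <= mu i + s * (ln (INR (B i + 1)) + ln (D (S (lev i))))).
    { apply (Rmult_le_compat_l s) in hBln; [| lra].
      apply (Rmult_le_compat_l (s * t)) in hlnD; [| nra].
      unfold beta in hmu |- *. lra. }
    destruct h as [h | h]; [left; now apply exp_increasing | right; unfold c1; now rewrite h].
  - intros i. rewrite length_offsets_S, mult_INR, hlen, mult_INR.
    destruct (hL i) as (_ & _ & h1 & h2). specialize (hMp i). specialize (hBr i).
    set (M := INR (length (offsets inc 0 i))) in *. set (b := INR (B i + 1)) in *.
    set (l := INR (length (L i))) in *.
    assert (h3 : kap * (D (S (lev i)) * qR (lev (S i))) <= l).
    { assert (h4 : 0 <= D (S (lev i)) * qR (lev (S i))).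
      { apply Rmult_le_pos; [left; apply hdp | apply pos_INR]. }
      apply Rle_trans with (/ 128 * (D (S (lev i)) * qR (lev (S i)))); [| lra].
      apply Rmult_le_compat_r; lra. }
    unfold ell. fold b.
    replace (kap * M * (b * D (S (lev i)) * qR (lev (S i))))
      with (M * b * (kap * (D (S (lev i)) * qR (lev (S i))))) by ring.
    rewrite <- (Rmult_assoc M b l). apply Rmult_le_compat_l; [apply Rmult_le_pos; lra | exact h3].
  - intros i j c b rest m h1 h2 h3 hm.
    destruct (hinc i b h2) as (e & r & he & hr & ->).
    specialize (hBQ i). specialize (hellS i). specialize (hdp i).
    replace (1 + c + (e * Q (S (lev i)) + r) + rest)%nat with (1 + c + e * Q (S (lev i)) + (r + rest))%nat by lia.
    apply (stage_local tau (lev i) (lev (S i)) (B i) (1 + c) e (r + rest) m); auto.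
    + apply hfree.
    + apply hB.
    + rewrite plus_INR, Rmult_plus_distr_r. eapply Rle_trans; [apply distZ_add |].
      destruct (hL i) as (_ & h4 & _). destruct (h4 r hr) as [_ h5].
      pose proof (htail j (S i) rest h3) as h6. lra.
    + lia.
Qed.

End TauLessOneTree.

(** * The upper bound for [tau > 1] *)

Lemma circle_cover_mono F l r r' : r <= r' -> circle_cover F l r -> circle_cover F l r'.
Proof. intros h hc y hy. destruct (hc y hy) as [c [h1 h2]]. exists c. split; [exact h1 | lra]. Qed.

Lemma circle_cover_split F l r K : 0 < r -> (1 <= K)%nat -> circle_cover F l r ->
  exists l', length l' = (length l * K)%nat /\ circle_cover F l' (r / INR K).
Proof.
  intros hr hK hc.
  assert (hKr : 1 <= INR K) by (apply (le_INR 1); exact hK).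
  exists (flat_map (fun c => map (fun i => c - r + (2 * INR i + 1) * (r / INR K)) (seq 0 K)) l).
  split.
  - apply length_flat_map_const. intros c. now rewrite length_map, length_seq.
  - intros y hy. destruct (hc y hy) as [c [h1 h2]].
    destruct (distZ_attained (y - c)) as [p hp]. rewrite hp in h2.
    set (v := y - c - IZR p) in *.
    pose proof (Rle_abs v). pose proof (Rle_abs (- v)) as h'. rewrite Rabs_Ropp in h'.
    set (u := r / INR K). assert (hu : 0 < u) by (apply Rdiv_lt_0_compat; lra).
    assert (huK : u * INR K = r) by (unfold u; field; lra).
    assert (Hi : exists i, (i < K)%nat /\ Rabs (v + r - (2 * INR i + 1) * u) <= u).
    { destruct (Rle_dec (2 * r) (v + r)) as [h3 | h3].
      - exists (K - 1)%nat. split; [lia |]. rewrite minus_INR by exact hK. simpl (INR 1).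
        apply Rabs_le. nra.
      - destruct (nat_floor ((v + r) / (2 * u))) as [i [hi1 hi2]].
        { apply Rmult_le_pos; [lra | left; apply Rinv_0_lt_compat; lra]. }
        assert (h4 : v + r = (v + r) / (2 * u) * (2 * u)) by (field; lra).
        set (z := (v + r) / (2 * u)) in *.
        exists i. split; [| apply Rabs_le; nra].
        apply INR_lt. apply Rmult_lt_reg_r with (2 * u); nra. }
    destruct Hi as [i [hi1 hi2]].
    exists (c - r + (2 * INR i + 1) * u). split.
    + apply in_flat_map. exists c. split; [exact h1 |]. apply in_map_iff. exists i.
      split; [reflexivity | apply in_seq; lia].
    + eapply Rle_trans; [apply (distZ_le_Rabs _ p) |].
      replace (y - (c - r + (2 * INR i + 1) * u) - IZR p) with (v + r - (2 * INR i + 1) * u) by (unfold v; ring).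
      exact hi2.
Qed.

(* An arc so short that it meets the neighbourhood of at most one of the separated points can be
   replaced by that neighbourhood. *)
Lemma circle_cover_refine F l r theta rho delta (P : nat -> Prop) :
  circle_cover F l r ->
  (forall y, F y -> exists n, P n /\ distZ (y - INR n * theta) <= rho) ->
  (forall n n', P n -> P n' -> n <> n' -> delta <= distZ (INR n * theta - INR n' * theta)) ->
  2 * (r + rho) < delta ->
  exists l', length l' = length l /\ circle_cover F l' rho.
Proof.
  intros hc hP hsep hdel.
  (* Each arc gets the unique index it can see. An arc that sees none gets the harmless default
     0. *)
  assert (Hg : forall c, exists m, forall n y, P n -> F y -> distZ (y - c) <= r ->
     distZ (y - INR n * theta) <= rho -> n = m).
  { intros c.
    destruct (classic (exists n y, P n /\ F y /\ distZ (y - c) <= r /\ distZ (y - INR n * theta) <= rho))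
      as [(n0 & y0 & h1 & h2 & h3 & h4) | hno].
    - exists n0. intros n y g1 g2 g3 g4. apply NNPP. intros hne.
      pose proof (hsep n n0 g1 h1 hne) as h5.
      pose proof (distZ_triang (INR n * theta) y (INR n0 * theta)) as h6.
      pose proof (distZ_triang y c (INR n0 * theta)) as h7.
      pose proof (distZ_triang c y0 (INR n0 * theta)) as h8.
      rewrite (distZ_sym (INR n * theta) y) in h6. rewrite (distZ_sym c y0) in h8. lra.
    - exists 0%nat. intros n y g1 g2 g3 g4. exfalso. apply hno. exists n, y. auto. }
  apply choice in Hg. destruct Hg as [g hg].
  exists (map (fun c => INR (g c) * theta) l). split; [apply length_map |].
  intros y hy. destruct (hc y hy) as [c [h1 h2]]. destruct (hP y hy) as [n [h3 h4]].
  exists (INR (g c) * theta). split; [apply in_map_iff; now exists c |].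
  now rewrite <- (hg c n y).
Qed.

(** With [a = ln q_k], [x = ln X], [d = ln d_k], this is a linear programme. Eliminating [d] leaves
    [(beta - t) a + (1 - t) e]. If [beta <= t], the extreme is the smallest [a] allowed by
    [e <= w a + const], with slope [lam < beta]; if [beta > t], it is [a = x / tau], with slope
    [beta / tau]. *)
Lemma covering_exponent (tau w beta c8 cc : R) : 1 < tau <= w -> 0 < beta ->
  w - tau < beta * ((1 + tau) * (w - 1)) -> 0 <= cc + c8 ->
  exists g C0, 0 < g /\ g <= beta * (1 - / tau) /\ 0 <= C0 /\
    forall a x e d, 0 <= x -> tau * a <= x -> e <= x -> d <= c8 - e -> - d <= w * a + cc ->
    beta * a + tau / (1 + tau) * (d - a) + e <= (beta - g) * x + C0.
Proof.
  intros ht hb hbw hcc.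
  set (t := tau / (1 + tau)).
  assert (htdef : t * (1 + tau) = tau) by (unfold t; field; lra).
  assert (htt : 0 < t < 1).
  { split; [unfold t; apply Rdiv_lt_0_compat; lra | nra]. }
  assert (ht1 : 1 - t = t * / tau) by (unfold t; field; lra).
  assert (hti : 0 < / tau < 1).
  { split; [apply Rinv_0_lt_compat; lra |]. rewrite <- Rinv_1. apply Rinv_lt_contravar; lra. }
  set (g1 := beta * (1 - / tau)).
  assert (hg1 : 0 < g1) by (unfold g1; apply Rmult_lt_0_compat; lra).
  set (lam := 1 - t - (t - beta) * / w).
  assert (hwi : 0 < / w) by (apply Rinv_0_lt_compat; lra).
  assert (hww : / w * w = 1) by (field; lra).
  assert (hlam : lam < beta).
  { apply Rmult_lt_reg_r with ((1 + tau) * w); [apply Rmult_lt_0_compat; lra |].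
    unfold lam.
    replace ((1 - t - (t - beta) * / w) * ((1 + tau) * w))
      with ((1 + tau) * w - (t * (1 + tau)) * w - (t * (1 + tau) - beta * (1 + tau)) * (/ w * w)) by ring.
    rewrite htdef, hww. lra. }
  clearbody t.
  exists (Rmin g1 (beta - lam)), (t * Rabs c8 + (cc + c8) * Rabs ((t - beta) * / w)).
  pose proof (Rmin_l g1 (beta - lam)) as hm1. pose proof (Rmin_r g1 (beta - lam)) as hm2.
  assert (hgp : 0 < Rmin g1 (beta - lam)) by (apply Rmin_glb_lt; lra).
  set (g := Rmin _ _) in *.
  pose proof (Rabs_pos c8) as ha1. pose proof (Rabs_pos ((t - beta) * / w)) as ha2.
  pose proof (Rle_abs c8) as ha3. pose proof (Rle_abs ((t - beta) * / w)) as ha4.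
  split; [exact hgp |]. split; [exact hm1 |]. split; [nra |].
  intros a x e d hx h1 h2 h3 h4.
  assert (h5 : t * d <= t * (Rabs c8 - e)) by (apply Rmult_le_compat_l; lra).
  assert (ha5 : 0 <= (cc + c8) * Rabs ((t - beta) * / w)) by (apply Rmult_le_pos; lra).
  apply (Rmult_le_compat_r x) in hm1, hm2; [| exact hx ..].
  destruct (Rle_dec beta t) as [hbt | hbt].
  - assert (h6 : e <= w * a + (cc + c8)) by lra.
    set (z := (t - beta) * / w) in *.
    assert (hz : 0 <= z) by (unfold z; apply Rmult_le_pos; lra).
    assert (hzw : z * w = t - beta) by (unfold z; rewrite Rmult_assoc, hww; ring).
    assert (hl0 : 0 <= lam).
    { unfold lam. fold z.
      assert (h7 : z <= t * / w) by (unfold z; apply Rmult_le_compat_r; lra).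
      assert (h8 : t * / w <= t * / tau).
      { apply Rmult_le_compat_l; [lra | apply Rinv_le_contravar; lra]. }
      lra. }
    apply (Rmult_le_compat_l lam) in h2; [| exact hl0].
    apply (Rmult_le_compat_l z) in h6; [| exact hz].
    replace (z * (w * a + (cc + c8))) with ((z * w) * a + (cc + c8) * z) in h6 by ring. rewrite hzw in h6.
    assert (h9 : (cc + c8) * z <= (cc + c8) * Rabs z) by (apply Rmult_le_compat_l; lra).
    assert (h10 : lam = 1 - t - z) by reflexivity. rewrite h10 in h2, hm2.
    lra.
  - assert (h6 : a <= / tau * x).
    { apply Rmult_le_reg_l with tau; [lra |]. rewrite <- Rmult_assoc, Rinv_r by lra. lra. }
    apply (Rmult_le_compat_l (beta - t)) in h6; [| lra].
    apply (Rmult_le_compat_l (1 - t)) in h2; [| lra].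
    rewrite ht1 in h2 at 2. unfold g1 in hm1. lra.
Qed.

Section TauGtOne.

Context {theta : R} {Hth : irrational01 theta}.

Notation D := (cfD theta).
Notation Q := (cfQ theta).
Notation qR k := (INR (cfQ theta (S k))).

(** Since [d_k <= 1/q_k], the radius [(d_k/q_k)^t] is at most [q_k^(-2t)], and [2t > 1] precisely
    because [tau > 1]. So the balls around the first [q_k] multiples become much smaller than their
    spacing. *)
Lemma radius_small tau Q0 : 1 < tau -> exists k0, forall k, (k0 <= k)%nat ->
  Q0 <= Rpower ((qR k) / D (S k)) (/ (1 + tau)) /\
  32 * Rpower (D (S k) / qR k) (tau / (1 + tau)) < / qR k.
Proof.
  intros ht. set (t := tau / (1 + tau)).
  assert (ht2 : 0 < 2 * t - 1).
  { replace (2 * t - 1) with ((tau - 1) / (1 + tau)) by (unfold t; field; lra).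
    apply Rdiv_lt_0_compat; lra. }
  set (Q1 := Rmax Q0 1).
  destruct (cfQ_ln_large ((1 + tau) * ln Q1)) as [k1 hk1].
  destruct (cfQ_ln_large ((ln 32 + 1) / (2 * t - 1))) as [k2 hk2].
  exists (k1 + k2)%nat. intros k hk. specialize (hk1 k ltac:(lia)). specialize (hk2 k ltac:(lia)).
  pose proof (cfQ_ge1 k) as hq.
  pose proof (cfD_pos (S k)) as hd.
  pose proof (lnQ_lnD (S k)) as [h1 _]. pose proof (lnQ_ge0 k) as h2.
  assert (h3 : ln (qR k) <= ln (qR (S k))).
  { apply ln_Rle; [lra | apply le_INR, cfQ_mono_S]. }
  split.
  - apply Rle_trans with Q1; [apply Rmax_l |].
    assert (hQ1 : 0 < Q1) by (unfold Q1; pose proof (Rmax_r Q0 1); lra).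
    apply ln_Rle_inv; [exact hQ1 | apply Rpower_pos |].
    rewrite ln_Rpower, ln_div by lra.
    apply Rmult_le_reg_l with (1 + tau); [lra |].
    rewrite <- Rmult_assoc, Rinv_r by lra. lra.
  - apply ln_lt_inv; [apply Rmult_lt_0_compat; [lra | apply Rpower_pos] | apply Rinv_0_lt_compat; lra |].
    rewrite ln_mult, ln_Rpower, ln_div, ln_Rinv by (try lra; apply Rpower_pos). fold t.
    apply (Rmult_le_compat_l (2 * t - 1)) in hk2; [| lra].
    replace ((2 * t - 1) * ((ln 32 + 1) / (2 * t - 1))) with (ln 32 + 1) in hk2 by (field; lra).
    assert (h4 : t * (ln (D (S k)) - ln (qR k)) <= t * (- 2 * ln (qR k))).
    { apply Rmult_le_compat_l; lra. }
    lra.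
Qed.

(** Pieces of radius [1/(16 q_k)] together with balls of radius below [1/(16 q_k)] are too short to
    join two points at least [1/(2 q_k)] apart; shrinking to the ball radius thus costs only the
    factor 16. *)
Lemma refine_at_denominator tau Q0 k l : 0 < tau ->
  Q0 <= Rpower ((qR k) / D (S k)) (/ (1 + tau)) ->
  32 * Rpower (D (S k) / qR k) (tau / (1 + tau)) < / qR k ->
  circle_cover (U_from tau theta Q0) l (/ qR k) ->
  exists l', length l' = (16 * length l)%nat /\
    circle_cover (U_from tau theta Q0) l' (2 * Rpower (D (S k) / qR k) (tau / (1 + tau))).
Proof.
  intros ht h1 h2 hc.
  pose proof (cfQ_ge1 k) as hq.
  pose proof (cfD_pos (S k)) as hd.
  assert (hiq : 0 < / qR k) by (apply Rinv_0_lt_compat; lra).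
  destruct (circle_cover_split _ _ _ 16 hiq ltac:(lia) hc) as [l1 [hl1 hc1]].
  destruct (optimal_Q tau (qR k) (D (S k)) ht ltac:(lra) hd) as [hQ1 hQ2].
  set (Qo := Rpower ((qR k) / D (S k)) (/ (1 + tau))) in *.
  rewrite <- hQ2 in h2 |- *.
  destruct (circle_cover_refine (U_from tau theta Q0) l1 (/ qR k / INR 16) theta
    (2 * Rpower Qo (- tau)) (D k) (fun n => (1 <= n <= Q (S k))%nat) hc1) as [l' [hl' hc']].
  - intros y hy. apply (U_from_near_multiples theta tau Q0 y Qo (Q (S k)) hy h1 (cfQ_pos k)).
    rewrite <- hQ1. apply Rmult_le_compat_l; [left; apply Rpower_pos | apply cf_distZ].
  - intros n n'. apply cf_separated.
  - pose proof (cfQ_D_ge_half k) as h3.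
    assert (h4 : / qR k <= 2 * D k).
    { apply Rmult_le_reg_l with (qR k); [lra |]. rewrite Rinv_r; lra. }
    replace (INR 16) with 16 by (simpl; ring). lra.
  - exists l'. split; [lia | exact hc'].
Qed.

(** Strong induction on [X]: take [q_k <= X^(1/tau) < q_(k+1)], start from the cover at scale
    [1/q_k], shrink it to the radius [rho] given by [q_k], and go on from there to [1/X]. *)
Lemma cover_count (tau w beta c0 Q0 : R) (k1 : nat) : 1 < tau <= w -> 0 < beta ->
  w - tau < beta * ((1 + tau) * (w - 1)) -> 0 < c0 ->
  (forall k, (k1 <= k)%nat -> c0 * Rpower (qR k) (- w) <= D (S k)) ->
  exists A, 0 < A /\ forall X, (1 <= X)%nat -> exists l,
    circle_cover (U_from tau theta Q0) l (/ INR X) /\ INR (length l) <= A * Rpower (INR X) beta.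
Proof.
  intros ht hb hbw hc0 hD.
  set (t := tau / (1 + tau)).
  assert (htt : 0 < t) by (unfold t; apply Rdiv_lt_0_compat; lra).
  destruct (radius_small tau Q0) as [k2 hk2]; [lra |].
  set (cc := Rmax 0 (- ln c0)).
  assert (hcc : 0 <= cc /\ - ln c0 <= cc) by (unfold cc; split; [apply Rmax_l | apply Rmax_r]).
  assert (hln8 : 0 < ln 8) by (rewrite <- ln_1; apply ln_increasing; lra).
  destruct (covering_exponent tau w beta (ln 8) cc ht hb hbw ltac:(lra)) as (g & C0 & hg0 & hg1 & hC0 & hexp).
  fold t in hexp.
  set (kmin := (k1 + k2)%nat).
  (* The first entry lets [g x] absorb the constants of a step; the second puts [X^(1/tau)] above
     [q_kmin] and [Q0]. Below [x0] the trivial cover by [X] arcs is enough. *)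
  set (x0 := Rmax ((ln 512 + C0) / g) (tau * (ln (qR kmin) + Rmax 0 (ln (Rmax Q0 1))) + 1)).
  destruct (exists_nat_gt (exp x0)) as [X0 hX0].
  exists (INR X0 + 1). split; [pose proof (pos_INR X0); lra |].
  intros X. induction X as [X IH] using lt_wf_ind. intros hX.
  assert (hXr : 1 <= INR X) by (apply (le_INR 1); exact hX).
  destruct (Nat.le_gt_cases X X0) as [hsmall | hbig].
  - destruct (circle_cover_split (U_from tau theta Q0) (0 :: nil) 1 X) as [l [hl1 hl2]]; [lra | exact hX | |].
    { intros y _. exists 0. split; [now left |]. pose proof (distZ_le_half (y - 0)). lra. }
    exists l. split.
    + replace (/ INR X) with (1 / INR X) by (field; lra). exact hl2.
    + rewrite hl1. simpl length. rewrite Nat.mul_1_l.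
      assert (h1 : 1 <= Rpower (INR X) beta).
      { rewrite <- (Rpower_O (INR X)) by lra. apply Rle_Rpower; lra. }
      apply le_INR in hsmall. nra.
  - assert (hx0 : x0 <= ln (INR X)).
    { rewrite <- (ln_exp x0). apply ln_Rle; [apply exp_pos |]. apply lt_INR in hbig. lra. }
    assert (hx1 := Rmax_l ((ln 512 + C0) / g) (tau * (ln (qR kmin) + Rmax 0 (ln (Rmax Q0 1))) + 1)).
    assert (hx2 := Rmax_r ((ln 512 + C0) / g) (tau * (ln (qR kmin) + Rmax 0 (ln (Rmax Q0 1))) + 1)).
    fold x0 in hx1, hx2.
    set (x := ln (INR X)) in *.
    set (Y := Rpower (INR X) (/ tau)).
    assert (hYx : tau * ln Y = x) by (unfold Y; rewrite ln_Rpower; fold x; field; lra).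
    assert (hYp : 0 < Y) by apply Rpower_pos.
    pose proof (lnQ_ge0 kmin) as hkm.
    assert (hm1 := Rmax_l 0 (ln (Rmax Q0 1))). assert (hm2 := Rmax_r 0 (ln (Rmax Q0 1))).
    assert (hYln : ln (qR kmin) + Rmax 0 (ln (Rmax Q0 1)) <= ln Y).
    { apply Rmult_le_reg_l with tau; lra. }
    assert (hYQ0 : Q0 <= Y).
    { apply Rle_trans with (Rmax Q0 1); [apply Rmax_l |].
      apply ln_Rle_inv; [pose proof (Rmax_r Q0 1); lra | exact hYp | lra]. }
    assert (hYq : (qR kmin) <= Y).
    { apply ln_Rle_inv; [apply lt_0_INR; pose proof (cfQ_pos kmin); lia | exact hYp | lra]. }
    destruct (cf_locate kmin Y hYq) as (k & hk & hkY1 & hkY2).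
    pose proof (cfQ_ge1 k) as hq.
    pose proof (cfD_pos (S k)) as hd.
    assert (hxp : 1 <= x).
    { assert (0 <= tau * (ln (qR kmin) + Rmax 0 (ln (Rmax Q0 1)))) by (apply Rmult_le_pos; lra). lra. }
    assert (hqx : tau * ln (qR k) <= x).
    { rewrite <- hYx. apply Rmult_le_compat_l; [lra | apply ln_Rle; lra]. }
    pose proof (lnQ_ge0 k) as hqln.
    assert (hqX : (Q (S k) < X)%nat).
    { apply INR_lt. apply ln_lt_inv; [lra | lra |]. fold x.
      destruct (Req_dec (ln (qR k)) 0) as [e | e]; [lra |]. nra. }
    destruct (IH (Q (S k)) hqX (cfQ_pos k)) as [l [hl1 hl2]].
    destruct (hk2 k ltac:(unfold kmin in hk; lia)) as [hr1 hr2].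
    destruct (refine_at_denominator tau Q0 k l ltac:(lra) hr1 hr2 hl1) as [l1 [hl3 hl4]].
    fold t in hr2, hl4.
    pose proof (Rpower_pos (D (S k) / qR k) t) as hrp.
    set (rho := 2 * Rpower (D (S k) / qR k) t) in *.
    assert (hrho : 0 < rho) by (unfold rho; lra).
    (* [E] is the resolution to which arcs must really be cut. If [X d_k <= 8], cut down to [1/X].
       Otherwise the multiples up to [Y = X^(1/tau) < q_(k+1)] are [d_k] apart, so cutting to
       [d_k / 8] is enough and the tolerance [Y^(-tau) = 1/X] does the rest. *)
    assert (hstep : exists l' E, circle_cover (U_from tau theta Q0) l' (/ INR X) /\ 0 < E /\ E <= INR X /\
       E * D (S k) <= 8 /\ INR (length l') <= INR (length l1) * (8 * rho * E + 1)).
    { destruct (Rle_dec (INR X * D (S k)) 8) as [hA | hB].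
      - destruct (nat_floor (rho * INR X)) as [K [hK1 hK2]]; [apply Rmult_le_pos; lra |].
        destruct (circle_cover_split _ _ _ (S K) hrho ltac:(lia) hl4) as [l2 [hl5 hl6]].
        exists l2, (INR X). split; [| split; [lra | split; [lra | split; [exact hA |]]]].
        + revert hl6. apply circle_cover_mono. pose proof (pos_INR K).
          rewrite S_INR. apply Rmult_le_reg_r with ((INR K + 1) * INR X); [apply Rmult_lt_0_compat; lra |].
          replace (rho / (INR K + 1) * ((INR K + 1) * INR X)) with (rho * INR X) by (field; lra).
          replace (/ INR X * ((INR K + 1) * INR X)) with (INR K + 1) by (field; lra). lra.
        + rewrite hl5, mult_INR, S_INR. apply Rmult_le_compat_l; [apply pos_INR |].
          assert (0 <= rho * INR X) by (apply Rmult_le_pos; lra). lra.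
      - apply Rnot_le_lt in hB.
        destruct (nat_floor (8 * rho * / D (S k))) as [K [hK1 hK2]].
        { apply Rmult_le_pos; [lra | left; now apply Rinv_0_lt_compat]. }
        destruct (circle_cover_split _ _ _ (S K) hrho ltac:(lia) hl4) as [l2 [hl5 hl6]].
        assert (hYX : Rpower Y (- tau) = / INR X).
        { unfold Y. rewrite Rpower_mult. replace (/ tau * - tau) with (- (1)) by (field; lra).
          rewrite Rpower_Ropp, Rpower_1; lra. }
        assert (hXd : / INR X < D (S k) / 8).
        { apply Rmult_lt_reg_l with (INR X); [lra |]. rewrite Rinv_r by lra. lra. }
        destruct (circle_cover_refine (U_from tau theta Q0) l2 (rho / INR (S K)) theta
          (/ INR X) (D (S k)) (fun n => (1 <= n)%nat /\ INR n <= Y) hl6) as [l3 [hl7 hl8]].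
        + intros y [_ hy]. destruct (hy Y hYQ0) as (n & hn1 & hn2 & hn3). exists n.
          split; [auto |]. rewrite distZ_sym, <- hYX. lra.
        + intros n n' [hn1 hn2] [hn1' hn2'] hne. apply cf_separated; [| | exact hne].
          * split; [exact hn1 |]. apply INR_le. lra.
          * split; [exact hn1' |]. apply INR_le. lra.
        + assert (h1 : rho / INR (S K) <= D (S k) / 8).
          { rewrite S_INR. pose proof (pos_INR K).
            apply (Rmult_lt_compat_r (D (S k))) in hK2; [| exact hd].
            rewrite Rmult_assoc, Rinv_l in hK2 by lra.
            apply Rmult_le_reg_r with (INR K + 1); [lra |].
            replace (rho / (INR K + 1) * (INR K + 1)) with rho by (field; lra). lra. }
          lra.
        + exists l3, (/ D (S k)).
          assert (hid : 0 < / D (S k)) by now apply Rinv_0_lt_compat.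
          split; [exact hl8 | split; [exact hid | split; [| split]]].
          * apply Rmult_le_reg_r with (D (S k)); [exact hd |]. rewrite Rinv_l; lra.
          * rewrite Rinv_l; lra.
          * rewrite hl7, hl5, mult_INR, S_INR. apply Rmult_le_compat_l; [apply pos_INR |]. lra. }
    destruct hstep as (l' & E & hE1 & hE2 & hE3 & hE4 & hE5).
    exists l'. split; [exact hE1 |].
    eapply Rle_trans; [exact hE5 |].
    rewrite hl3, mult_INR. replace (INR 16) with 16 by (simpl; ring).
    set (A := INR X0 + 1) in *.
    assert (hA : 0 < A) by (unfold A; pose proof (pos_INR X0); lra).
    assert (hgx : ln 512 + C0 <= g * x).
    { apply Rle_trans with (g * ((ln 512 + C0) / g)); [right; field; lra | apply Rmult_le_compat_l; lra]. }
    assert (hlE : ln E <= x) by (apply ln_Rle; lra).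
    assert (hlE2 : ln (D (S k)) <= ln 8 - ln E).
    { apply ln_Rle in hE4; [| apply Rmult_lt_0_compat; lra]. rewrite ln_mult in hE4 by lra. lra. }
    assert (hlD : - ln (D (S k)) <= w * ln (qR k) + cc).
    { pose proof (hD k ltac:(unfold kmin in hk; lia)) as h1.
      apply ln_Rle in h1; [| apply Rmult_lt_0_compat; [lra | apply Rpower_pos]].
      rewrite ln_mult, ln_Rpower in h1 by (try lra; apply Rpower_pos). lra. }
    specialize (hexp (ln (qR k)) x (ln E) (ln (D (S k))) ltac:(lra) hqx hlE hlE2 hlD).
    pose proof (Rpower_pos (qR k) beta) as hqb. pose proof (Rpower_pos (INR X) beta) as hXb.
    assert (hln512 : ln 512 = ln 8 + ln 32 + ln 2) by (rewrite <- !ln_mult by lra; f_equal; ring).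
    pose proof ln2_pos as hln2.
    (* The two summands of [8 rho E + 1] each get half of [X^beta]: the 1 through
       [g <= beta (1 - 1/tau)], the other through the exponent inequality. *)
    assert (hhalf1 : 32 * Rpower (qR k) beta <= Rpower (INR X) beta).
    { apply ln_Rle_inv; [lra | lra |]. rewrite ln_mult, !ln_Rpower by lra. fold x.
      assert (h1 : ln (qR k) <= / tau * x).
      { apply Rmult_le_reg_l with tau; [lra |]. rewrite <- Rmult_assoc, Rinv_r by lra. lra. }
      apply (Rmult_le_compat_l beta) in h1; [| lra].
      apply (Rmult_le_compat_r x) in hg1; [| lra]. lra. }
    assert (hhalf2 : 32 * Rpower (qR k) beta * (8 * rho * E) <= Rpower (INR X) beta).
    { assert (hdq : 0 < D (S k) / qR k) by (apply Rdiv_lt_0_compat; lra).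
      replace (32 * Rpower (qR k) beta * (8 * rho * E))
        with (512 * (Rpower (qR k) beta * (Rpower (D (S k) / qR k) t * E))) by (unfold rho; ring).
      assert (h1 : 0 < Rpower (D (S k) / qR k) t * E) by (apply Rmult_lt_0_compat; lra).
      assert (h2 : 0 < Rpower (qR k) beta * (Rpower (D (S k) / qR k) t * E)) by (apply Rmult_lt_0_compat; lra).
      apply ln_Rle_inv; [lra | lra |].
      rewrite !ln_mult, !ln_Rpower, ln_div by lra. fold x. lra. }
    assert (hfin : 16 * Rpower (qR k) beta * (8 * rho * E + 1) <= Rpower (INR X) beta) by lra.
    assert (hpos : 0 <= 8 * rho * E + 1).
    { assert (0 < rho * E) by (apply Rmult_lt_0_compat; lra). lra. }
    apply Rle_trans with (A * (16 * Rpower (qR k) beta * (8 * rho * E + 1))).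
    + replace (A * (16 * Rpower (qR k) beta * (8 * rho * E + 1)))
        with (16 * (A * Rpower (qR k) beta) * (8 * rho * E + 1)) by ring.
      apply Rmult_le_compat_r; [exact hpos |]. lra.
    + apply Rmult_le_compat_l; lra.
Qed.

(** The count [q_k^beta] holds at every level; at a well approximated one the arcs shrink further to
    length about [q_k^(-(1+v) t)]. The weight [q_k^(beta - s (1+v) t)] tends to zero. *)
Theorem U_set_null_gt_one (tau w beta c0 v s : R) (k1 : nat) : 1 < tau <= w -> 0 < beta ->
  w - tau < beta * ((1 + tau) * (w - 1)) -> 0 < c0 ->
  (forall k, (k1 <= k)%nat -> c0 * Rpower (qR k) (- w) <= D (S k)) ->
  0 < v -> 0 < s -> beta * (1 + tau) < s * (tau * (1 + v)) ->
  (forall n, exists k, (n <= k)%nat /\ D (S k) <= Rpower (qR k) (- v)) ->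
  hausdorff_null s (U_set tau theta).
Proof.
  intros ht hb hbw hc0 hD hv hs hsv hinf.
  apply hausdorff_null_of_circle_covers with (fun m => U_from tau theta (INR m)); [exact hs | | |].
  { intros x hx. now apply U_set_exhaust. }
  { intros m x hx. apply hx. }
  intros m delta eps hd he.
  set (t := tau / (1 + tau)).
  assert (htt : 0 < t) by (unfold t; apply Rdiv_lt_0_compat; lra).
  destruct (cover_count tau w beta c0 (INR m) k1 ht hb hbw hc0 hD) as (A & hA & hcov).
  destruct (radius_small tau (INR m)) as [k2 hk2]; [lra |].
  set (eta := s * ((1 + v) * t) - beta).
  assert (heta : 0 < eta).
  { unfold eta. apply Rmult_lt_reg_r with (1 + tau); [lra |].
    replace ((s * ((1 + v) * t) - beta) * (1 + tau)) with (s * (tau * (1 + v)) - beta * (1 + tau)) by (unfold t; field; lra).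
    lra. }
  pose proof (Rpower_pos 2 s) as h2s.
  destruct (Rpower_neg_small ((1 + v) * t) (delta / 2)) as (N1 & hN1 & hN1'); [| lra |].
  { apply Rmult_lt_0_compat; lra. }
  destruct (Rpower_neg_small eta (eps / (16 * A * Rpower 2 s))) as (N2 & hN2 & hN2'); [lra | |].
  { apply Rdiv_lt_0_compat; [lra |]. apply Rmult_lt_0_compat; lra. }
  destruct (exists_nat_gt (N1 + N2)) as [n hn].
  destruct (hinf (n + k2)%nat) as (k & hk & hDk).
  pose proof (le_INR _ _ (cfQ_ge k)) as hqk.
  assert (hnk : INR n <= INR k) by (apply le_INR; lia).
  pose proof (cfQ_ge1 k) as hq.
  pose proof (cfD_pos (S k)) as hdp.
  destruct (hcov (Q (S k)) (cfQ_pos k)) as (l & hl1 & hl2).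
  destruct (hk2 k ltac:(lia)) as [hr1 hr2].
  destruct (refine_at_denominator tau (INR m) k l ltac:(lra) hr1 hr2 hl1) as [l' [hl3 hl4]].
  fold t in hl4.
  assert (hr : Rpower (D (S k) / qR k) t <= Rpower (qR k) (- ((1 + v) * t))).
  { apply Rpower_ln_le. rewrite ln_div by lra.
    apply ln_Rle in hDk; [| exact hdp]. rewrite ln_Rpower in hDk.
    replace (- ((1 + v) * t) * ln (qR k)) with (t * (- v * ln (qR k) - ln (qR k))) by ring.
    apply Rmult_le_compat_l; lra. }
  pose proof (Rpower_pos (D (S k) / qR k) t) as hrp.
  exists l', (2 * Rpower (D (S k) / qR k) t). split; [| split; [exact hl4 |]].
  - split; [lra |]. assert (Rpower (qR k) (- ((1 + v) * t)) < delta / 2) by (apply hN1'; lra). lra.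
  - rewrite hl3, mult_INR. replace (INR 16) with 16 by (simpl; ring).
    rewrite <- Rpower_mult_distr by lra.
    assert (h1 : Rpower (Rpower (D (S k) / qR k) t) s <= Rpower (qR k) (- ((1 + v) * t) * s)).
    { rewrite <- Rpower_mult. apply Rle_Rpower_l; [lra | split; lra]. }
    assert (h2 : Rpower (qR k) beta * Rpower (qR k) (- ((1 + v) * t) * s) = Rpower (qR k) (- eta)).
    { rewrite <- Rpower_plus. f_equal. unfold eta. ring. }
    assert (h3 : Rpower (qR k) (- eta) < eps / (16 * A * Rpower 2 s)) by (apply hN2'; lra).
    pose proof (Rpower_pos (Rpower (D (S k) / qR k) t) s) as h4.
    apply Rle_lt_trans with (16 * A * Rpower 2 s * (Rpower (qR k) beta * Rpower (qR k) (- ((1 + v) * t) * s))).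
    + apply Rle_trans with (16 * (A * Rpower (qR k) beta) * (Rpower 2 s * Rpower (qR k) (- ((1 + v) * t) * s))); [| right; ring].
      apply Rmult_le_compat; [pose proof (pos_INR (length l)); lra | | lra |].
      * apply Rmult_le_pos; lra.
      * apply Rmult_le_compat_l; lra.
    + rewrite h2. apply (Rmult_lt_compat_l (16 * A * Rpower 2 s)) in h3; [| apply Rmult_lt_0_compat; lra].
      replace (16 * A * Rpower 2 s * (eps / (16 * A * Rpower 2 s))) with eps in h3 by (field; lra). exact h3.
Qed.

End TauGtOne.

(** * Irrationality exponents *)

Lemma W_set_approximations theta v v' : 0 < v <= v' -> W_set theta v' ->
  forall N : nat, exists j : nat, (N <= j)%nat /\ rpow (INR j) v * distZ (INR j * theta) < 1.
Proof.
  intros hv [_ hl] N. destruct (hl 1 ltac:(lra) (N + 1)%nat) as (j & hj1 & hj2).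
  exists j. split; [lia |]. eapply Rle_lt_trans; [| exact hj2].
  apply Rmult_le_compat_r; [apply distZ_ge0 |].
  assert (1 <= INR j) by (apply (le_INR 1); lia).
  rewrite !rpow_pos by lra. apply Rle_Rpower; lra.
Qed.

Lemma W_set_above theta w v : irr_exponent_eq theta w -> v < w -> exists v', W_set theta v' /\ v < v'.
Proof.
  intros [_ h] hv. apply NNPP. intros hno.
  assert (w <= v); [| lra]. apply h. intros x hx. apply Rnot_lt_le. intros hlt.
  apply hno. now exists x.
Qed.

Section Exponent.

Context {theta : R} {Hth : irrational01 theta}.

Notation D := (cfD theta).
Notation Q := (cfQ theta).
Notation qR k := (INR (cfQ theta (S k))).

Lemma cfD_lower_bound w w' : irr_exponent_eq theta w -> 0 < w' -> w < w' ->
  exists c0 k1, 0 < c0 /\ forall k, (k1 <= k)%nat -> c0 * Rpower (qR k) (- w') <= D (S k).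
Proof.
  intros [h _] h0 hw.
  assert (hno : ~ liminf_zero theta w').
  { intros hl. specialize (h w' (conj h0 hl)). lra. }
  unfold liminf_zero in hno. apply not_all_ex_not in hno. destruct hno as [eps hno].
  apply imply_to_and in hno. destruct hno as [he hno].
  apply not_all_ex_not in hno. destruct hno as [N hN].
  exists eps, N. split; [exact he |]. intros k hk.
  pose proof (cfQ_ge1 k) as hq.
  pose proof (Rpower_pos (qR k) w') as hp.
  assert (h1 : eps <= Rpower (qR k) w' * distZ ((qR k) * theta)).
  { apply Rnot_lt_le. intros hlt. apply hN. exists (Q (S k)).
    split; [pose proof (cfQ_ge k); lia |]. rewrite rpow_pos by lra. exact hlt. }
  pose proof (cf_distZ k) as h2.
  apply (Rmult_le_compat_l (Rpower (qR k) w')) in h2; [| lra].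
  rewrite Rpower_Ropp. apply Rmult_le_reg_r with (Rpower (qR k) w'); [exact hp |].
  rewrite Rmult_assoc, Rinv_l by lra. lra.
Qed.

(** Replace [j] by the last denominator [q_k <= j]: best approximation gives
    [d_k <= ||j theta|| < j^(-v) <= q_k^(-v)]. *)
Lemma cfD_upper_bound v : 0 < v ->
  (forall N : nat, exists j : nat, (N <= j)%nat /\ rpow (INR j) v * distZ (INR j * theta) < 1) ->
  forall n, exists k, (n <= k)%nat /\ D (S k) <= Rpower (qR k) (- v).
Proof.
  intros hv h n. destruct (h (Q (S n))) as (j & hj1 & hj2).
  destruct (cf_locate n (INR j)) as (k & hk1 & hk2 & hk3); [now apply le_INR |].
  exists k. split; [exact hk1 |].
  pose proof (cfQ_ge1 k) as hq.
  assert (hjp : (0 < j)%nat) by (apply INR_lt; simpl; lra).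
  apply INR_lt in hk3.
  pose proof (cf_best (S k) j ltac:(lia)) as h1.
  rewrite rpow_pos in hj2 by lra. pose proof (Rpower_pos (INR j) v) as hp.
  apply Rle_trans with (Rpower (INR j) (- v)).
  - rewrite Rpower_Ropp. apply Rmult_le_reg_l with (Rpower (INR j) v); [exact hp |].
    rewrite Rinv_r by lra.
    apply (Rmult_le_compat_l (Rpower (INR j) v)) in h1; lra.
  - rewrite !Rpower_Ropp. apply Rinv_le_contravar; [apply Rpower_pos |].
    apply Rle_Rpower_l; lra.
Qed.

(** From [d_k <= q_k^(-v)] follows [q_(k+1) >= q_k^v / 2], so [2 q_(k+1)^tau >= 2^(1-tau) q_k];
    strictness comes from [tau < 1]. *)
Lemma constraint_infinite tau v : 0 < tau < 1 -> 1 <= tau * v ->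
  (forall n, exists k, (n <= k)%nat /\ D (S k) <= Rpower (qR k) (- v)) ->
  forall n, exists k, (n <= k)%nat /\ constraint tau theta k.
Proof.
  intros ht htv h n. destruct (h n) as (k & hk & hDk). exists k. split; [exact hk |].
  unfold constraint.
  pose proof (cfQ_ge1 k) as hq.
  pose proof (cfD_pos (S k)) as hd.
  pose proof (lnQ_lnD (S k)) as [_ h1]. pose proof (lnQ_ge0 k) as h2.
  apply ln_Rle in hDk; [| exact hd]. rewrite ln_Rpower in hDk.
  apply ln_lt_inv; [lra | apply Rmult_lt_0_compat; [lra | apply Rpower_pos] |].
  rewrite ln_mult, ln_Rpower by (try lra; apply Rpower_pos).
  pose proof ln2_pos as h3.
  set (A := ln (qR k)) in *. set (A1 := ln (qR (S k))) in *.
  assert (h4 : tau * (v * A - ln 2) <= tau * A1) by (apply Rmult_le_compat_l; lra).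
  assert (h5 : 1 * A <= (tau * v) * A) by (apply Rmult_le_compat_r; lra).
  assert (h6 : 0 < (1 - tau) * ln 2) by (apply Rmult_lt_0_compat; lra).
  lra.
Qed.

End Exponent.

(** * From approximation exponents to dimension bounds *)

Lemma U_set_antitone tau tau' theta y : tau <= tau' -> U_set tau' theta y -> U_set tau theta y.
Proof.
  intros h [h01 [Q0 hQ]]. split; [exact h01 |]. exists (Rmax Q0 1). intros Q hQ'.
  destruct (hQ Q) as (n & h1 & h2 & h3); [eapply Rle_trans; [apply Rmax_l | exact hQ'] |].
  exists n. repeat split; auto. eapply Rlt_le_trans; [exact h3 |].
  apply Rle_Rpower; [eapply Rle_trans; [apply Rmax_r | exact hQ'] | lra].
Qed.

Lemma exponent_between u w : u < w -> 0 < w -> exists v, 0 < v < w /\ u < v.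
Proof.
  intros h1 h2. exists (Rmax ((u + w) / 2) (w / 2)).
  pose proof (Rmax_l ((u + w) / 2) (w / 2)). pose proof (Rmax_r ((u + w) / 2) (w / 2)).
  assert (Rmax ((u + w) / 2) (w / 2) < w) by (apply Rmax_lub_lt; lra). lra.
Qed.

(** Raising [tau] makes [tau' w > 1] strict, which settles the endpoint [tau = 1/w]; raising [w]
    makes the lower bound on [d_k] hold at all large levels. *)
Lemma lower_bound_perturbation s tau w : 0 < s -> 0 < tau < 1 -> 1 < w -> 1 <= tau * w ->
  s * (tau * (w * w - 1)) < w - tau ->
  exists tau' w', tau < tau' < 1 /\ w < w' /\ s * (tau' * (w' * w' - 1)) < w' - tau'.
Proof.
  intros hs ht hw htw h.
  set (h0 := w - tau - s * (tau * (w * w - 1))).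
  assert (hh0 : 0 < h0) by (unfold h0; lra).
  set (K := s * (w * w - 1) + 1).
  assert (hK : 1 <= K).
  { assert (0 <= w * w - 1) by nra. assert (0 <= s * (w * w - 1)) by (apply Rmult_le_pos; lra). unfold K. lra. }
  set (eta := Rmin ((1 - tau) / 2) (h0 / (2 * K))).
  assert (he1 : eta <= (1 - tau) / 2) by apply Rmin_l.
  assert (he2 : eta <= h0 / (2 * K)) by apply Rmin_r.
  assert (he0 : 0 < eta) by (apply Rmin_glb_lt; [lra | apply Rdiv_lt_0_compat; lra]).
  apply (Rmult_le_compat_r K) in he2; [| lra].
  replace (h0 / (2 * K) * K) with (h0 / 2) in he2 by (field; lra).
  set (L := s * (2 * w + 1)).
  assert (hL : 0 < L) by (unfold L; apply Rmult_lt_0_compat; lra).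
  set (z := Rmin 1 (h0 / (4 * L))).
  assert (hz1 : z <= 1) by apply Rmin_l.
  assert (hz2 : z <= h0 / (4 * L)) by apply Rmin_r.
  assert (hz0 : 0 < z) by (apply Rmin_glb_lt; [lra | apply Rdiv_lt_0_compat; lra]).
  apply (Rmult_le_compat_r L) in hz2; [| lra].
  replace (h0 / (4 * L) * L) with (h0 / 4) in hz2 by (field; lra).
  exists (tau + eta), (w + z). split; [lra |]. split; [lra |].
  assert (e1 : s * ((tau + eta) * (w * w - 1)) + (tau + eta) <= w - h0 / 2).
  { unfold K in he2. unfold h0 in *. lra. }
  assert (e2 : s * ((tau + eta) * (2 * w * z + z * z)) <= h0 / 4).
  { apply Rle_trans with (z * L); [| exact hz2].
    assert (h1 : 2 * w * z + z * z <= (2 * w + 1) * z) by nra.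
    assert (h2 : (tau + eta) * (2 * w * z + z * z) <= 1 * ((2 * w + 1) * z)).
    { apply Rmult_le_compat; [lra | nra | lra | exact h1]. }
    apply (Rmult_le_compat_l s) in h2; [| lra]. unfold L. lra. }
  replace (s * ((tau + eta) * ((w + z) * (w + z) - 1)))
    with (s * ((tau + eta) * (w * w - 1)) + s * ((tau + eta) * (2 * w * z + z * z))) by ring.
  lra.
Qed.

Section DimensionBounds.

Context {theta : R} {Hth : irrational01 theta}.

Lemma U_set_null_finite (w tau s : R) : irr_exponent_eq theta w -> 1 < w -> 0 < tau -> 0 < s ->
  (1 / tau + 1) / (w + 1) < s -> hausdorff_null s (U_set tau theta).
Proof.
  intros hexp hw ht hs h.
  assert (h1 : (1 / tau + 1) / s - 1 < w).
  { apply (Rmult_lt_compat_r ((w + 1) / s)) in h; [| apply Rdiv_lt_0_compat; lra].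
    replace ((1 / tau + 1) / (w + 1) * ((w + 1) / s)) with ((1 / tau + 1) / s) in h by (field; lra).
    replace (s * ((w + 1) / s)) with (w + 1) in h by (field; lra). lra. }
  destruct (exponent_between _ w h1 ltac:(lra)) as (v & hv1 & hv2).
  destruct (W_set_above theta w v hexp ltac:(lra)) as (v' & hv3 & hv4).
  apply (U_set_null_of_approximations theta tau s v irrational01_irr); try lra.
  - apply (Rmult_lt_compat_r s) in hv2; [| exact hs].
    replace (((1 / tau + 1) / s - 1) * s) with (1 / tau + 1 - s) in hv2 by (field; lra). lra.
  - apply (W_set_approximations theta v v'); [lra | exact hv3].
Qed.

Lemma U_set_not_null_le_one (w tau s : R) : irr_exponent_eq theta w -> 1 < w -> 1 / w <= tau <= 1 ->
  0 < s < (w / tau - 1) / (w ^ 2 - 1) -> ~ hausdorff_null s (U_set tau theta).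
Proof.
  intros hexp hw ht [hs0 hs].
  assert (htp : 0 < tau).
  { assert (0 < 1 / w) by (apply Rdiv_lt_0_compat; lra). lra. }
  assert (htw : 1 <= tau * w).
  { destruct ht as [ht _]. apply (Rmult_le_compat_r w) in ht; [| lra].
    replace (1 / w * w) with 1 in ht by (field; lra). exact ht. }
  assert (hww : 0 < w * w - 1) by nra.
  assert (hs' : s * (tau * (w * w - 1)) < w - tau).
  { apply (Rmult_lt_compat_r (tau * (w * w - 1))) in hs; [| apply Rmult_lt_0_compat; lra].
    replace ((w / tau - 1) / (w ^ 2 - 1) * (tau * (w * w - 1))) with (w - tau) in hs; [exact hs |].
    simpl. field. split; nra. }
  (* At [tau = 1] only [w] can be enlarged: the bound [s < 1/(w + 1)] leaves room for the exponent
     [1/s - 1 > w], for which [s (1 + w) <= 1] holds with equality. *)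
  destruct (Req_dec tau 1) as [-> | hne].
  - assert (h1 : s * (w + 1) < 1).
    { apply Rmult_lt_reg_r with (w - 1); [lra |]. lra. }
    assert (h2 : w < / s - 1).
    { apply Rmult_lt_reg_l with s; [exact hs0 |].
      replace (s * (/ s - 1)) with (1 - s) by (field; lra). lra. }
    destruct (cfD_lower_bound w (/ s - 1) hexp ltac:(lra) h2) as (c0 & k1 & hc0 & hD).
    apply (U_set_one_not_null s (/ s - 1) c0 k1); auto; try lra.
    replace (s * (1 + (/ s - 1))) with 1 by (field; lra). lra.
  - destruct (lower_bound_perturbation s tau w hs0 ltac:(lra) hw htw hs') as (tau' & w' & ht' & hw' & h1).
    intros hnull.
    destruct (cfD_lower_bound w w' hexp ltac:(lra) hw') as (c0 & k1 & hc0 & hD).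
    assert (htw' : 1 < tau' * w) by nra.
    assert (hv : / tau' < w).
    { apply Rmult_lt_reg_l with tau'; [lra |]. rewrite Rinv_r; lra. }
    destruct (exponent_between _ w hv ltac:(lra)) as (v & hv1 & hv2).
    destruct (W_set_above theta w v hexp ltac:(lra)) as (v' & hv3 & hv4).
    apply (U_set_lt_one_not_null tau' s w' c0 k1); auto; try lra.
    + nra.
    + apply (constraint_infinite tau' v); [lra | |].
      * apply (Rmult_lt_compat_l tau') in hv2; [| lra]. rewrite Rinv_r in hv2; lra.
      * apply cfD_upper_bound; [lra |]. apply (W_set_approximations theta v v'); [lra | exact hv3].
    + revert hnull. apply hausdorff_null_subset. intros x. apply U_set_antitone. lra.
Qed.

Lemma U_set_null_above_one (w tau s : R) : irr_exponent_eq theta w -> 1 < w -> 1 < tau <= w ->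
  (w / tau - 1) / (w ^ 2 - 1) < s -> hausdorff_null s (U_set tau theta).
Proof.
  intros hexp hw ht hs.
  assert (hww : 0 < w * w - 1) by nra.
  assert (hs' : w - tau < s * (tau * (w * w - 1))).
  { apply (Rmult_lt_compat_r (tau * (w * w - 1))) in hs; [| apply Rmult_lt_0_compat; lra].
    replace ((w / tau - 1) / (w ^ 2 - 1) * (tau * (w * w - 1))) with (w - tau) in hs; [exact hs |].
    simpl. field. split; nra. }
  assert (hs0 : 0 < s).
  { apply Rmult_lt_reg_r with (tau * (w * w - 1)); [apply Rmult_lt_0_compat; lra |]. lra. }
  (* [beta] strictly between the box-counting exponent [(w - tau) / ((1 + tau) (w - 1))] and
     [s tau (1 + w) / (1 + tau)]; both strict inequalities survive small changes of [w]. *)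
  set (b0 := (w - tau) / (w - 1)). set (b1 := s * (tau * (1 + w))).
  assert (hb0 : 0 <= b0) by (unfold b0; apply Rmult_le_pos; [lra | left; apply Rinv_0_lt_compat; lra]).
  assert (hb0w : b0 * (w - 1) = w - tau) by (unfold b0; field; lra).
  assert (hb01 : b0 < b1).
  { apply Rmult_lt_reg_r with (w - 1); [lra |]. rewrite hb0w. unfold b1. lra. }
  set (b := (b0 + b1) / 2).
  assert (hb : b0 < b < b1) by (unfold b; lra).
  set (beta := b / (1 + tau)).
  assert (hbeta : beta * (1 + tau) = b) by (unfold beta; field; lra).
  set (g := b * (w - 1) - (w - tau)).
  assert (hg : 0 < g) by (unfold g; rewrite <- hb0w; nra).
  destruct (cfD_lower_bound w (w + g / 2) hexp ltac:(lra) ltac:(lra)) as (c0 & k1 & hc0 & hD).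
  assert (hv : b / (s * tau) - 1 < w).
  { assert (hst : 0 < s * tau) by (apply Rmult_lt_0_compat; lra).
    apply Rmult_lt_reg_r with (s * tau); [exact hst |].
    replace ((b / (s * tau) - 1) * (s * tau)) with (b - s * tau) by (field; split; lra).
    destruct hb as [_ hb]. unfold b1 in hb. lra. }
  destruct (exponent_between _ w hv ltac:(lra)) as (v & hv1 & hv2).
  destruct (W_set_above theta w v hexp ltac:(lra)) as (v' & hv3 & hv4).
  apply (U_set_null_gt_one tau (w + g / 2) beta c0 v s k1); auto; try lra.
  - unfold beta. apply Rdiv_lt_0_compat; lra.
  - replace (beta * ((1 + tau) * (w + g / 2 - 1))) with (beta * (1 + tau) * (w + g / 2 - 1)) by ring.
    rewrite hbeta. assert (h1 : 0 <= b * g) by (apply Rmult_le_pos; lra). unfold g at 1 in hg.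
    assert (h2 : b * (w - 1) = g + (w - tau)) by (unfold g; ring). lra.
  - rewrite hbeta.
    assert (hst : 0 < s * tau) by (apply Rmult_lt_0_compat; lra).
    apply (Rmult_lt_compat_r (s * tau)) in hv2; [| exact hst].
    replace ((b / (s * tau) - 1) * (s * tau)) with (b - s * tau) in hv2 by (field; split; lra). lra.
  - apply cfD_upper_bound; [lra |]. apply (W_set_approximations theta v v'); [lra | exact hv3].
Qed.

Lemma U_set_null_infinite (tau s : R) : irr_exponent_infinite theta -> 0 < tau -> 0 < s ->
  hausdorff_null s (U_set tau theta).
Proof.
  intros hinf ht hs.
  assert (h0 : 0 < (1 / tau + 1) / s).
  { apply Rdiv_lt_0_compat; [| exact hs]. assert (0 < 1 / tau) by (apply Rdiv_lt_0_compat; lra). lra. }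
  destruct (hinf ((1 / tau + 1) / s)) as (v & hv1 & hv2).
  apply (U_set_null_of_approximations theta tau s v irrational01_irr); try lra.
  - apply (Rmult_lt_compat_r s) in hv2; [| exact hs].
    replace ((1 / tau + 1) / s * s) with (1 / tau + 1) in hv2 by (field; lra). lra.
  - apply (W_set_approximations theta v v); [lra | exact hv1].
Qed.

End DimensionBounds.

Theorem theorem3 (theta : R) (Htheta : 0 < theta < 1)
  (Hirr : ~ exists (p q : Z), q <> 0%Z /\ theta = IZR p / IZR q) :
  (forall w : R, irr_exponent_eq theta w -> 1 < w ->
     (forall tau, 1 / w <= tau <= 1 ->
        (w / tau - 1) / (w ^ 2 - 1) <= hdim (U_set tau theta) /\
        hdim (U_set tau theta) <= (1 / tau + 1) / (w + 1)) /\
     (forall tau, 1 < tau <= w ->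
        0 <= hdim (U_set tau theta) /\
        hdim (U_set tau theta) <= (w / tau - 1) / (w ^ 2 - 1))) /\
  (irr_exponent_infinite theta ->
     forall tau, 0 < tau -> hdim (U_set tau theta) = 0).
Proof.
  assert (Hth : irrational01 theta) by (split; assumption).
  split.
  - intros w hexp hw. split.
    + intros tau ht.
      assert (htp : 0 < tau).
      { assert (0 < 1 / w) by (apply Rdiv_lt_0_compat; lra). lra. }
      assert (hb : 0 < (1 / tau + 1) / (w + 1)).
      { assert (0 < 1 / tau) by (apply Rdiv_lt_0_compat; lra). apply Rdiv_lt_0_compat; lra. }
      split.
      (* Any exponent above the upper bound is null; this one only ensures that the infimum
         exists. *)
      * apply (hdim_ge _ _ ((1 / tau + 1) / (w + 1) + 1)); [lra | |].
        -- apply (U_set_null_finite w); auto; lra.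
        -- intros s hs. now apply (U_set_not_null_le_one w).
      * apply hdim_le; [lra |]. intros s hs. apply (U_set_null_finite w); auto; lra.
    + intros tau ht.
      assert (hb : 0 <= (w / tau - 1) / (w ^ 2 - 1)).
      { apply Rmult_le_pos.
        - assert (1 <= w / tau); [| lra]. apply Rmult_le_reg_r with tau; [lra |].
          replace (w / tau * tau) with w by (field; lra). lra.
        - left. apply Rinv_0_lt_compat. simpl. nra. }
      split.
      * apply (hdim_ge _ _ ((w / tau - 1) / (w ^ 2 - 1) + 1)); [lra | |].
        -- apply (U_set_null_above_one w); auto; lra.
        -- intros s hs. lra.
      * apply hdim_le; [exact hb |]. intros s hs. now apply (U_set_null_above_one w).
  - intros hinf tau ht. apply Rle_antisym.
    + apply hdim_le; [lra |]. intros s hs. now apply U_set_null_infinite.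
    + apply (hdim_ge _ _ 1); [lra | apply U_set_null_infinite; auto; lra |]. intros s hs. lra.
Qed.
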